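(* Let $a,b>-1$ and, for $j=0,1,2,\ldots$, let $$\varphi_j(x)=\frac{1}{\sqrt{h_j^{(a,b)}}}P_j^{(a,b)}(x)(1-x)^{a/2}(1+x)^{b/2},\qquad x\in[-1,1],$$ and $K_N^{(2)}(x,y)=\sum_{j=0}^{N-1}\varphi_j(x)\varphi_j(y)$. Then for $x,y\in\mathbb{R}$, as $N\to\infty$, $$\frac{1}{N}K_N^{(2)}\left(\frac{x}{N},\frac{y}{N}\right)=K_{\mathrm{sine}}(x,y)+O(N^{-1}),$$ where $K_{\mathrm{sine}}(x,y)=\frac{\sin(x-y)}{\pi(x-y)}$ (with $K_{\mathrm{sine}}(x,x)=1/\pi$). The error term is uniform for $x$ and $y$ in compact subsets of $\mathbb{R}$.
   Context: $P_j^{(a,b)}$ denotes the Jacobi polynomial of degree $j$, orthogonal on $[-1,1]$ with respect to $(1-x)^a(1+x)^b$: $\int_{-1}^1 P_j^{(a,b)}P_k^{(a,b)}(1-x)^a(1+x)^b\,dx=h_j^{(a,b)}\delta_{jk}$, where $h_j^{(a,b)}=\frac{2^{a+b+1}\Gamma(j+a+1)\Gamma(j+b+1)}{j!(2j+a+b+1)\Gamma(j+a+b+1)}$ (standard normalization of Szegő). Thus $\{\varphi_j\}$ is orthonormal in $L^2[-1,1]$. *)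

(* Defs.v *)
From Stdlib Require Import Reals.
From Coquelicot Require Import Coquelicot.
Open Scope R_scope.

Fixpoint rsum (f : nat -> R) (n : nat) : R :=
  match n with O => 0 | S m => rsum f m + f m end.
Fixpoint rprod (f : nat -> R) (n : nat) : R :=
  match n with O => 1 | S m => rprod f m * f m end.

Definition gbinom (r : R) (k : nat) : R :=
  rprod (fun i => r - INR i) k / INR (Stdlib.Arith.Factorial.fact k).

Definition Gamma (s : R) : R :=
  RInt_gen (fun t => Rpower t (s - 1) * exp (- t))
           (at_right 0) (Rbar_locally p_infty).

Definition rpow (u p : R) : R :=
  if Rlt_dec 0 u then Rpower u p
  else if Req_EM_T p 0 then 1 else 0.

(* Jacobi polynomial P_n^(a,b)(x), Szego normalization (Szego (4.3.2)):
   sum_s binom(n+a, n-s) binom(n+b, s) ((x-1)/2)^s ((x+1)/2)^(n-s) *)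
Definition jacobiP (a b : R) (n : nat) (x : R) : R :=
  rsum (fun s => gbinom (INR n + a) (n - s) * gbinom (INR n + b) s
                 * ((x - 1) / 2) ^ s * ((x + 1) / 2) ^ (n - s)) (S n).

(* h_j^(a,b) = 2^(a+b+1) G(j+a+1) G(j+b+1) / (j! (2j+a+b+1) G(j+a+b+1));
   for j = 0 the factor (a+b+1) G(a+b+1) is read as G(a+b+2)
   (a+b+1 may be <= 0 when j = 0). *)
Definition jacobi_h (a b : R) (j : nat) : R :=
  match j with
  | O => Rpower 2 (a + b + 1) * Gamma (a + 1) * Gamma (b + 1) / Gamma (a + b + 2)
  | S _ => Rpower 2 (a + b + 1) * Gamma (INR j + a + 1) * Gamma (INR j + b + 1)
           / (INR (Stdlib.Arith.Factorial.fact j) * (2 * INR j + a + b + 1) * Gamma (INR j + a + b + 1))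
  end.

Definition phi (a b : R) (j : nat) (x : R) : R :=
  / sqrt (jacobi_h a b j) * jacobiP a b j x
  * rpow (1 - x) (a / 2) * rpow (1 + x) (b / 2).

Definition KN2 (a b : R) (N : nat) (x y : R) : R :=
  rsum (fun j => phi a b j x * phi a b j y) N.

Definition Ksine (x y : R) : R :=
  if Req_EM_T x y then / PI else sin (x - y) / (PI * (x - y)).

(* Main.v *)
(** The kernel is first stripped of the weight: at [x/N] the factor
    [(1-x/N)^(a/2) (1+x/N)^(b/2)] is [1 + O(1/N)].  For the polynomial kernel the
    Christoffel-Darboux formula leaves only [P_N] and [P_(N-1)].  The lowering and
    raising relations say that [(f, g) = (P_N(t/N), P_(N-1)(t/N))] satisfies
    [f' = g + O(1/N)], [g' = - f + O(1/N)], so [(f, g)] is a rotation up to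
    [O(1/N)], and [f(x) g(y) - g(x) f(y)] equals [(f(0)^2 + g(0)^2) sin (x - y)] up
    to a relative error [O(1/N)] which is also proportional to [x - y].

    It remains to see that [p_n(0)^2 + p_(n+1)(0)^2 = 2/PI + O(1/n)] for the
    orthonormal polynomials [p_n].  By the three-term recurrence consecutive values
    of this energy differ by [O(1/n^2)], so only its limit is needed.  Up to a
    factor [2^n], [P_n(0)] is the coefficient of [z^n] in
    [(1-z^2)^(n-1) (1+z)^(a+1) (1-z)^(b+1)], that is, an alternating sum of
    binomials [C(n-1, k)] against the absolutely summable coefficients of
    [G(z) = (1+z)^(a+1) (1-z)^(b+1)].  Wallis' product and dominated convergence
    turn it into the real and imaginary parts of [G(i)], and
    [|G(i)|^2 = 2^(a+b+2)]; the norms [h_n] are controlled by [n h_n -> 2^(a+b)],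
    which follows from [Gamma(n+c) ~ Gamma(n) n^c]. *)

Require Import Defs.
From Stdlib Require Import Reals Lra Lia Psatz Factorial.
From Coquelicot Require Import Coquelicot.
Open Scope R_scope.

(** * Relations between Jacobi polynomials *)

(** [P_n(0)] oscillates in sign, and its normalized size along even or odd [n] depends on [a] and
    [b]; only the sum of two consecutive normalized squares has a limit free of the parameters.
    Hence an energy is followed, not an asymptotic formula for [P_n(0)]. Dominated convergence gives
    its limit without a rate; the rate comes from increments whose tails sum to [O(1/n)], and for
    these the first-order terms of norms and recurrence coefficients must cancel exactly. The other
    obstacle is the division by [x - y] in the Christoffel-Darboux formula. Approximating [f] and
    [g] separately by cosines and sines would lose uniformity near the diagonal, so errors are
    measured as differences between the times [x] and [y] in a rotating frame. The diagonal itself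
    is reached by continuity at fixed [N]. The exponents [a + 1], [b + 1] make the binomial
    coefficients absolutely summable for all [a, b > -1]; the price is the power [n - 1] of
    [1 - z^2], whose parity separates even from odd [n]. *)

Lemma rsum_ext (f g : nat -> R) (n : nat) :
  (forall k, (k < n)%nat -> f k = g k) -> rsum f n = rsum g n.
Proof.
induction n as [|n IH]; intros H; simpl; [easy|].
rewrite IH by (intros; apply H; lia); rewrite H by lia; easy.
Qed.

Lemma rprod_ext (f g : nat -> R) (n : nat) :
  (forall k, (k < n)%nat -> f k = g k) -> rprod f n = rprod g n.
Proof.
induction n as [|n IH]; intros H; simpl; [easy|].
rewrite IH by (intros; apply H; lia); rewrite H by lia; easy.
Qed.

Lemma rsum_plus (f g : nat -> R) (n : nat) :
  rsum (fun k => f k + g k) n = rsum f n + rsum g n.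
Proof. induction n as [|n IH]; simpl; [lra|rewrite IH; ring]. Qed.

Lemma rsum_scal (c : R) (f : nat -> R) (n : nat) :
  rsum (fun k => c * f k) n = c * rsum f n.
Proof. induction n as [|n IH]; simpl; [lra|rewrite IH; ring]. Qed.

Lemma rsum_shift (f : nat -> R) (n : nat) :
  rsum f (S n) = f 0%nat + rsum (fun k => f (S k)) n.
Proof.
induction n as [|n IH]; [simpl; ring|].
change (rsum f (S (S n))) with (rsum f (S n) + f (S n)).
rewrite IH; simpl; ring.
Qed.

Lemma rprod_shift (f : nat -> R) (n : nat) :
  rprod f (S n) = f 0%nat * rprod (fun k => f (S k)) n.
Proof.
induction n as [|n IH]; [simpl; ring|].
change (rprod f (S (S n))) with (rprod f (S n) * f (S n)).
rewrite IH; simpl; ring.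
Qed.

Lemma INR_fact_pos (n : nat) : 0 < INR (fact n).
Proof. apply lt_0_INR, lt_O_fact. Qed.

Definition poch (a : R) (n : nat) : R := rprod (fun i => a + 1 + INR i) n.

Lemma poch_pos (a : R) (n : nat) : -1 < a -> 0 < poch a n.
Proof.
intros ha; unfold poch; induction n as [|n IH]; simpl; [lra|].
apply Rmult_lt_0_compat; [easy|]. pose proof (pos_INR n); lra.
Qed.

(** Coefficients of [0F1(; a+1; z)]. By Bateman's generating function, [P_n] divided by
    [poch a n * poch b n] is the coefficient of [z^n] in [0F1(; a+1; X z) 0F1(; b+1; Y z)], with
    [X = (x-1)/2] and [Y = (x+1)/2]. *)
Definition bcoef (a : R) (s : nat) : R := / (INR (fact s) * poch a s).

Lemma bcoef_S (a : R) (s : nat) : -1 < a ->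
  INR (S s) * (INR (S s) + a) * bcoef a (S s) = bcoef a s.
Proof.
intros ha; unfold bcoef.
rewrite fact_simpl, mult_INR.
change (poch a (S s)) with (poch a s * (a + 1 + INR s)).
pose proof (poch_pos a s ha); pose proof (INR_fact_pos s).
pose proof (pos_INR s). rewrite S_INR.
field; repeat split; lra.
Qed.

(* [hsum a b c n] is the homogeneous polynomial of degree [n] in [X], [Y] with
   coefficients [c s r * bcoef a s * bcoef b r]. Multiplying by [X] or [Y] only
   changes the weight [c], so every relation between Jacobi polynomials below
   becomes a polynomial identity in [s] and [r]. *)
Definition hsum (a b : R) (c : R -> R -> R) (n : nat) (X Y : R) : R :=
  rsum (fun s => c (INR s) (INR (n - s)) * bcoef a s * bcoef b (n - s)
                 * X ^ s * Y ^ (n - s)) (S n).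

(** Only weights on the line [s + r = n] matter; this is where the degree enters the identities
    below. *)
Lemma hsum_ext (a b : R) (c1 c2 : R -> R -> R) (n : nat) (X Y : R) :
  (forall s r, s + r = INR n -> c1 s r = c2 s r) ->
  hsum a b c1 n X Y = hsum a b c2 n X Y.
Proof.
intros H; apply rsum_ext; intros k Hk.
rewrite H; [easy|]. rewrite <- plus_INR; f_equal; lia.
Qed.

Lemma hsum_plus (a b : R) (c1 c2 : R -> R -> R) (n : nat) (X Y : R) :
  hsum a b c1 n X Y + hsum a b c2 n X Y
  = hsum a b (fun s r => c1 s r + c2 s r) n X Y.
Proof.
unfold hsum; rewrite <- rsum_plus; apply rsum_ext; intros; ring.
Qed.

Lemma hsum_scal (a b k : R) (c : R -> R -> R) (n : nat) (X Y : R) :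
  k * hsum a b c n X Y = hsum a b (fun s r => k * c s r) n X Y.
Proof.
unfold hsum; rewrite <- rsum_scal; apply rsum_ext; intros; ring.
Qed.

Lemma hsum_minus (a b : R) (c1 c2 : R -> R -> R) (n : nat) (X Y : R) :
  hsum a b c1 n X Y - hsum a b c2 n X Y
  = hsum a b (fun s r => c1 s r - c2 s r) n X Y.
Proof.
replace (hsum a b c1 n X Y - hsum a b c2 n X Y)
  with (hsum a b c1 n X Y + (-1) * hsum a b c2 n X Y) by ring.
rewrite hsum_scal, hsum_plus; apply hsum_ext; intros; ring.
Qed.

(** Raising the exponent of [X] costs the factor [s (s + a)], by [bcoef_S]. It vanishes at [s = 0],
    so the new boundary term disappears whatever [c] is at [-1]. *)
Lemma hsum_mulX (a b : R) (c : R -> R -> R) (n : nat) (X Y : R) : -1 < a ->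
  X * hsum a b c n X Y
  = hsum a b (fun s r => c (s - 1) r * (s * (s + a))) (S n) X Y.
Proof.
intros ha; unfold hsum at 2; rewrite rsum_shift; simpl (INR 0).
rewrite Rmult_0_l, Rmult_0_r, !Rmult_0_l, Rplus_0_l.
unfold hsum; rewrite <- rsum_scal; apply rsum_ext; intros k Hk.
replace (S n - S k)%nat with (n - k)%nat by lia.
rewrite <- (bcoef_S a k ha), S_INR.
replace (INR k + 1 - 1) with (INR k) by ring. simpl pow; ring.
Qed.

Lemma hsum_mulY (a b : R) (c : R -> R -> R) (n : nat) (X Y : R) : -1 < b ->
  Y * hsum a b c n X Y
  = hsum a b (fun s r => c s (r - 1) * (r * (r + b))) (S n) X Y.
Proof.
intros hb; unfold hsum at 2.
change (rsum ?f (S (S n))) with (rsum f (S n) + f (S n)); cbv beta.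
rewrite Nat.sub_diag; simpl (INR 0).
rewrite Rmult_0_l, Rmult_0_r, !Rmult_0_l, Rplus_0_r.
unfold hsum; rewrite <- rsum_scal; apply rsum_ext; intros k Hk.
replace (S n - k)%nat with (S (n - k))%nat by lia.
rewrite <- (bcoef_S b (n - k) hb), (S_INR (n - k)).
replace (INR (n - k) + 1 - 1) with (INR (n - k)) by ring. simpl pow; ring.
Qed.

Definition hq (a b : R) (n : nat) (X Y : R) : R := hsum a b (fun _ _ => 1) n X Y.

Lemma falling_poch (a : R) (n r s : nat) : (s + r)%nat = n ->
  rprod (fun i => INR n + a - INR i) r * poch a s = poch a n.
Proof.
revert s; induction r as [|r IH]; intros s H; simpl.
- rewrite <- H, Nat.add_0_r; ring.
- rewrite <- (IH (S s)) by lia.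
  change (poch a (S s)) with (poch a s * (a + 1 + INR s)).
  rewrite <- H, plus_INR, S_INR; ring.
Qed.

Definition xm (x : R) : R := (x - 1) / 2.
Definition xp (x : R) : R := (x + 1) / 2.

Lemma jacobiP_hq (a b : R) (n : nat) (x : R) : -1 < a -> -1 < b ->
  jacobiP a b n x = poch a n * poch b n * hq a b n (xm x) (xp x).
Proof.
intros ha hb; unfold jacobiP, hq, hsum; rewrite <- rsum_scal.
apply rsum_ext; intros s Hs; unfold gbinom, bcoef.
rewrite <- (falling_poch a n (n - s) s) by lia.
rewrite <- (falling_poch b n s (n - s)) by lia.
pose proof (poch_pos a s ha); pose proof (poch_pos b (n - s) hb).
pose proof (INR_fact_pos s); pose proof (INR_fact_pos (n - s)).
fold (xm x); fold (xp x). field; repeat split; lra.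
Qed.

(** The three-term recurrence in homogeneous form: powers of [Y - X], which equals 1 at [xm x],
    [xp x], pad the terms to degree [n + 2]. Then only weights have to be compared. *)
Lemma hq_rec (a b : R) (n : nat) (X Y : R) : -1 < a -> -1 < b ->
  let k := INR (S n) in let c := a + b in
  (k + 1) * (k + a + 1) * (k + b + 1) * (k + c + 1) * (2 * k + c) * hq a b (S (S n)) X Y
  = (2 * k + c + 1) * ((2 * k + c + 2) * (2 * k + c) * (X + Y) + (a * a - b * b) * (Y - X)) / 2
      * hq a b (S n) X Y
    - (2 * k + c + 2) * ((Y - X) * ((Y - X) * hq a b n X Y)).
Proof.
intros ha hb k c.
replace ((Y - X) * ((Y - X) * hq a b n X Y)) with
  (Y * (Y * hq a b n X Y) + (-2) * (X * (Y * hq a b n X Y)) + X * (X * hq a b n X Y)) by ring.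
replace ((2 * k + c + 1) * ((2 * k + c + 2) * (2 * k + c) * (X + Y) + (a * a - b * b) * (Y - X)) / 2
      * hq a b (S n) X Y) with
  ((2 * k + c + 1) * ((2 * k + c + 2) * (2 * k + c) - (a * a - b * b)) / 2 * (X * hq a b (S n) X Y)
   + (2 * k + c + 1) * ((2 * k + c + 2) * (2 * k + c) + (a * a - b * b)) / 2 * (Y * hq a b (S n) X Y))
  by field.
unfold hq.
rewrite !(hsum_mulY a b _ _ _ _ hb), !(hsum_mulX a b _ _ _ _ ha).
rewrite !hsum_scal, !hsum_plus.
rewrite hsum_scal, hsum_minus.
apply hsum_ext; intros s r H.
assert (Hk : k = s + r - 1) by (unfold k; rewrite H, (S_INR (S n)); ring).
rewrite Hk; unfold c; field.
Qed.

Lemma is_derive_rsum (f df : nat -> R -> R) (n : nat) (x : R) :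
  (forall k, is_derive (f k) x (df k x)) ->
  is_derive (fun y => rsum (fun k => f k y) n) x (rsum (fun k => df k x) n).
Proof.
intros H; induction n as [|n IH]; simpl.
- apply (is_derive_const (V := R_NormedModule) 0 x).
- apply (is_derive_plus (V := R_NormedModule)); [exact IH|apply H].
Qed.

(** The factor [2 X Y] restores the exponents lowered by differentiation, which leaves sums with the
    weights [s] and [r]. *)
Lemma hq_derive (a b : R) (n : nat) (x : R) :
  exists d, is_derive (fun y => hq a b n (xm y) (xp y)) x d /\
    2 * xm x * xp x * d
    = xp x * hsum a b (fun s _ => s) n (xm x) (xp x)
      + xm x * hsum a b (fun _ r => r) n (xm x) (xp x).
Proof.
eexists; split.
- unfold hq, hsum.
  apply (is_derive_rsum
    (fun s y => 1 * bcoef a s * bcoef b (n - s) * xm y ^ s * xp y ^ (n - s))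
    (fun s y => 1 * bcoef a s * bcoef b (n - s)
       * (INR s * / 2 * xm y ^ pred s * xp y ^ (n - s)
          + xm y ^ s * (INR (n - s) * / 2 * xp y ^ pred (n - s))))).
  intros k; unfold xm, xp; auto_derive; [easy|]. unfold Rdiv, Rminus; ring.
- unfold hsum; rewrite <- !rsum_scal, <- rsum_plus.
  apply rsum_ext; intros s Hs.
  (* At [k = 0] the truncated [pred] is harmless, because the factor [INR k] vanishes. *)
  assert (H : forall k z, INR k * (z * z ^ pred k) = INR k * z ^ k).
  { intros [|k] z; simpl; ring. }
  transitivity (bcoef a s * bcoef b (n - s)
    * (xp x * xp x ^ (n - s) * (INR s * (xm x * xm x ^ pred s))
       + xm x * xm x ^ s * (INR (n - s) * (xp x * xp x ^ pred (n - s))))).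
  + field.
  + rewrite !H; ring.
Qed.

(** On [s + r = k] one has [(2k+a+b) s = k (k+b) + s (s+a) - r (r+b)], and the last two terms are
    the weights that [X] and [Y] produce from degree [n]. *)
Lemma hq_weight_s (a b : R) (n : nat) (X Y : R) : -1 < a -> -1 < b ->
  let k := INR (S n) in
  (2 * k + a + b) * hsum a b (fun s _ => s) (S n) X Y
  = k * (k + b) * hq a b (S n) X Y - (Y - X) * hq a b n X Y.
Proof.
intros ha hb k.
replace (k * (k + b) * hq a b (S n) X Y - (Y - X) * hq a b n X Y) with
  (k * (k + b) * hq a b (S n) X Y + X * hq a b n X Y + (-1) * (Y * hq a b n X Y)) by ring.
unfold hq; rewrite (hsum_mulX a b _ _ _ _ ha), (hsum_mulY a b _ _ _ _ hb).
rewrite !hsum_scal, !hsum_plus; apply hsum_ext; intros s r H.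
unfold k; rewrite <- H; ring.
Qed.

Lemma hq_weight_r (a b : R) (n : nat) (X Y : R) : -1 < a -> -1 < b ->
  let k := INR (S n) in
  (2 * k + a + b) * hsum a b (fun _ r => r) (S n) X Y
  = k * (k + a) * hq a b (S n) X Y + (Y - X) * hq a b n X Y.
Proof.
intros ha hb k.
replace (k * (k + a) * hq a b (S n) X Y + (Y - X) * hq a b n X Y) with
  (k * (k + a) * hq a b (S n) X Y + (-1) * (X * hq a b n X Y) + Y * hq a b n X Y) by ring.
unfold hq; rewrite (hsum_mulX a b _ _ _ _ ha), (hsum_mulY a b _ _ _ _ hb).
rewrite !hsum_scal, !hsum_plus; apply hsum_ext; intros s r H.
unfold k; rewrite <- H; ring.
Qed.

(** [Y] and [X] turn the weights [s] and [r] into [s r (r+b)] and [r s (s+a)], whose sum is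
    [s r (k+c)] on [s + r = k]; hence the factor [k + c]. *)
Lemma hq_raise (a b : R) (n : nat) (X Y : R) : -1 < a -> -1 < b ->
  let k := INR (S n) in let c := a + b in
  (2 * k + c) * (Y * hsum a b (fun s _ => s) n X Y + X * hsum a b (fun _ r => r) n X Y)
  = (k + c) * (k * (k + a) * (k + b) * hq a b (S n) X Y
      - (k + b) * (X * hq a b n X Y) - (k + a) * (Y * hq a b n X Y)).
Proof.
intros ha hb k c; unfold hq.
rewrite !(hsum_mulY a b _ _ _ _ hb), !(hsum_mulX a b _ _ _ _ ha).
rewrite !hsum_scal, !hsum_plus, !hsum_minus, !hsum_scal; apply hsum_ext; intros s r H.
unfold k, c; rewrite <- H; ring.
Qed.

Lemma poch_S (a : R) (n : nat) : poch a (S n) = poch a n * (INR (S n) + a).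
Proof. unfold poch; simpl rprod; rewrite S_INR; ring. Qed.

Lemma xp_minus_xm (x : R) : xp x - xm x = 1.
Proof. unfold xp, xm; field. Qed.

Lemma jacobiP_derive_lower (a b : R) (n : nat) (x : R) :
  -1 < a -> -1 < b -> -1 < x < 1 ->
  let k := INR (S n) in let c := a + b in
  is_derive (jacobiP a b (S n)) x
    ((k * (a - b - (2 * k + c) * x) * jacobiP a b (S n) x
      + 2 * (k + a) * (k + b) * jacobiP a b n x) / ((2 * k + c) * (1 - x * x))).
Proof.
intros ha hb hx k c.
destruct (hq_derive a b (S n) x) as [d [Hd Ed]].
apply (is_derive_ext (fun y => poch a (S n) * poch b (S n) * hq a b (S n) (xm y) (xp y))).
{ intros t; symmetry; apply jacobiP_hq; easy. }
assert (Hk : 1 <= k) by (unfold k; rewrite S_INR; pose proof (pos_INR n); lra).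
assert (Hc : 2 * k + c <> 0) by (unfold c; lra).
assert (Hx : 1 - x * x <> 0) by nra.
evar_last. { apply is_derive_scal; exact Hd. }
rewrite !jacobiP_hq, !poch_S by easy; fold k.
pose proof (hq_weight_s a b n (xm x) (xp x) ha hb) as Hs; cbv zeta in Hs.
pose proof (hq_weight_r a b n (xm x) (xp x) ha hb) as Hr; cbv zeta in Hr.
fold k in Hs, Hr; rewrite xp_minus_xm in Hs, Hr.
set (q1 := hq a b (S n) (xm x) (xp x)) in *.
set (q0 := hq a b n (xm x) (xp x)) in *.
assert (E : (2 * k + c) * (2 * xm x * xp x * d)
            = xp x * (k * (k + b) * q1 - 1 * q0) + xm x * (k * (k + a) * q1 + 1 * q0)).
{ rewrite Ed, <- Hs, <- Hr; unfold c; ring. }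
assert (E2 : d = (k * (a - b - (2 * k + c) * x) * q1 + 2 * q0)
             / ((2 * k + c) * (1 - x * x))).
(* Inside [(-1, 1)] the factor [2 X Y = - (1 - x^2) / 2] can be cancelled. *)
{ apply (Rmult_eq_reg_l ((2 * k + c) * (2 * xm x * xp x))).
  - rewrite Rmult_assoc, E; unfold xm, xp, c in *; field; lra.
  - apply Rmult_integral_contrapositive_currified; [easy|]; unfold xm, xp; nra. }
rewrite E2; field; lra.
Qed.

Lemma jacobiP_derive_raise (a b : R) (n : nat) (x : R) :
  -1 < a -> -1 < b -> -1 < x < 1 ->
  let k := INR (S n) in let c := a + b in
  is_derive (jacobiP a b n) x
    (((k + c) * (a - b + (2 * k + c) * x) * jacobiP a b n x
      - 2 * k * (k + c) * jacobiP a b (S n) x) / ((2 * k + c) * (1 - x * x))).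
Proof.
intros ha hb hx k c.
destruct (hq_derive a b n x) as [d [Hd Ed]].
apply (is_derive_ext (fun y => poch a n * poch b n * hq a b n (xm y) (xp y))).
{ intros t; symmetry; apply jacobiP_hq; easy. }
assert (Hk : 1 <= k) by (unfold k; rewrite S_INR; pose proof (pos_INR n); lra).
assert (Hc : 2 * k + c <> 0) by (unfold c; lra).
assert (Hx : 1 - x * x <> 0) by nra.
evar_last. { apply is_derive_scal; exact Hd. }
rewrite !jacobiP_hq, !poch_S by easy; fold k.
pose proof (hq_raise a b n (xm x) (xp x) ha hb) as Hr; cbv zeta in Hr.
fold k c in Hr; rewrite <- Ed in Hr.
set (q1 := hq a b (S n) (xm x) (xp x)) in *.
set (q0 := hq a b n (xm x) (xp x)) in *.
assert (E2 : d = ((k + c) * (a - b + (2 * k + c) * x) * q0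
                  - 2 * k * (k + c) * (k + a) * (k + b) * q1)
             / ((2 * k + c) * (1 - x * x))).
{ apply (Rmult_eq_reg_l ((2 * k + c) * (2 * xm x * xp x))).
  - rewrite Rmult_assoc, Hr; unfold xm, xp, c in *; field; lra.
  - apply Rmult_integral_contrapositive_currified; [easy|]; unfold xm, xp; nra. }
rewrite E2; field; lra.
Qed.

(** The recurrence reads [P_(k+1) = (recA x + recB) P_k - recC P_(k-1)]. It is applied at [k >= 1],
    where [a + b > -2] keeps all denominators positive. *)
Definition recA (a b k : R) : R :=
  (2 * k + a + b + 1) * (2 * k + a + b + 2) / (2 * (k + 1) * (k + a + b + 1)).
Definition recB (a b k : R) : R :=
  (2 * k + a + b + 1) * (a * a - b * b) / (2 * (k + 1) * (k + a + b + 1) * (2 * k + a + b)).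
Definition recC (a b k : R) : R :=
  (k + a) * (k + b) * (2 * k + a + b + 2) / ((k + 1) * (k + a + b + 1) * (2 * k + a + b)).

Lemma jacobiP_rec (a b : R) (n : nat) (x : R) : -1 < a -> -1 < b ->
  jacobiP a b (S (S n)) x
  = (recA a b (INR (S n)) * x + recB a b (INR (S n))) * jacobiP a b (S n) x
    - recC a b (INR (S n)) * jacobiP a b n x.
Proof.
intros ha hb.
pose proof (hq_rec a b n (xm x) (xp x) ha hb) as H; cbv zeta in H.
rewrite !jacobiP_hq, !poch_S by easy; rewrite (S_INR (S n)).
rewrite xp_minus_xm, !Rmult_1_l, Rmult_1_r in H.
replace (xm x + xp x) with x in H by (unfold xm, xp; field).
set (k := INR (S n)) in *.
assert (Hk : 1 <= k) by (unfold k; rewrite S_INR; pose proof (pos_INR n); lra).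
set (q2 := hq a b (S (S n)) (xm x) (xp x)) in *.
set (q1 := hq a b (S n) (xm x) (xp x)) in *.
set (q0 := hq a b n (xm x) (xp x)) in *.
apply (Rmult_eq_reg_l ((k + 1) * (k + (a + b) + 1) * (2 * k + (a + b)))).
- transitivity (poch a n * (k + a) * (poch b n * (k + b)) *
    ((k + 1) * (k + a + 1) * (k + b + 1) * (k + (a + b) + 1) * (2 * k + (a + b)) * q2)).
  + ring.
  + rewrite H; unfold recA, recB, recC; field; lra.
- repeat apply Rmult_integral_contrapositive_currified; lra.
Qed.

(** * The Gamma function *)

(** Monotone convergence: the improper integral is the supremum of the integrals over compact
    intervals. The second conclusion is what later gives [0 < Gamma s]. *)
Lemma ex_RInt_gen_nonneg_bounded (f : R -> R) (B : R) :
  (forall t, 0 < t -> continuous f t) -> (forall t, 0 < t -> 0 <= f t) ->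
  (forall u v, 0 < u -> u <= v -> RInt f u v <= B) ->
  exists l, is_RInt_gen f (at_right 0) (Rbar_locally p_infty) l /\
    forall u v, 0 < u -> u <= v -> RInt f u v <= l.
Proof.
intros Hc Hp HB.
assert (Hex : forall u v, 0 < u -> u <= v -> ex_RInt f u v).
{ intros u v Hu Huv; apply (ex_RInt_continuous (V := R_CompleteNormedModule)).
  intros z Hz; rewrite Rmin_left, Rmax_right in Hz by lra; apply Hc; lra. }
assert (Hge : forall u v, 0 < u -> u <= v -> 0 <= RInt f u v).
{ intros u v Hu Huv; apply RInt_ge_0; [easy|now apply Hex|].
  intros x Hx; apply Hp; lra. }
assert (Hmono : forall u v u' v', 0 < u' -> u' <= u -> u <= v -> v <= v' ->
          RInt f u v <= RInt f u' v').
{ intros u v u' v' H1 H2 H3 H4.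
  assert (E1 := RInt_Chasles f u' u v' (Hex u' u H1 H2) (Hex u v' ltac:(lra) ltac:(lra))).
  assert (E2 := RInt_Chasles f u v v' (Hex u v ltac:(lra) H3) (Hex v v' ltac:(lra) H4)).
  unfold plus in E1, E2; simpl in E1, E2.
  pose proof (Hge u' u H1 H2); pose proof (Hge v v' ltac:(lra) H4); lra. }
destruct (completeness (fun r => exists u v, 0 < u /\ u <= v /\ r = RInt f u v))
  as [l [Hub Hlub]].
- exists B; intros r [u [v [H1 [H2 H3]]]]; subst; auto.
- exists (RInt f 1 1), 1, 1; repeat split; lra.
- assert (Hl : forall u v, 0 < u -> u <= v -> RInt f u v <= l)
    by (intros u v H1 H2; apply Hub; exists u, v; auto).
  exists l; split; [|exact Hl].
  intros P [eps HP]; unfold filtermapi.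
  (* Either some compact interval comes within [eps] of the supremum, and then so do all larger
     ones, or [l - eps] would be a smaller upper bound. *)
  destruct (Classical_Prop.classic
     (exists u v, 0 < u /\ u <= v /\ l - eps < RInt f u v)) as [[u [v [H1 [H2 H3]]]]|Hno].
  + apply Filter_prod with (fun t => 0 < t < u) (fun t => v < t).
    * exists (mkposreal u H1); intros t Ht Ht0.
      unfold ball in Ht; simpl in Ht; unfold AbsRing_ball, abs, minus, plus, opp in Ht; simpl in Ht.
      rewrite Rabs_pos_eq in Ht; lra.
    * now exists v.
    * intros x y Hx Hy; exists (RInt f x y); split.
      -- apply (RInt_correct (V := R_CompleteNormedModule)), Hex; simpl; lra.
      -- apply HP; unfold ball; simpl; unfold AbsRing_ball, abs, minus, plus, opp; simpl.
         pose proof (Hmono u v x y ltac:(lra) ltac:(lra) H2 ltac:(lra)).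
         pose proof (Hl x y ltac:(lra) ltac:(lra)).
         apply Rabs_def1; lra.
  + exfalso.
    assert (H : l <= l - eps).
    { apply Hlub; intros r [u [v [H1 [H2 H3]]]]; subst.
      apply Rnot_lt_le; intros H; apply Hno; exists u, v; auto. }
    destruct eps as [e He]; simpl in H; lra.
Qed.

Definition gint (s t : R) : R := Rpower t (s - 1) * exp (- t).

Lemma Rpower_pos (x y : R) : 0 < Rpower x y.
Proof. apply exp_pos. Qed.

Lemma gint_pos (s t : R) : 0 < gint s t.
Proof. apply Rmult_lt_0_compat; apply exp_pos. Qed.

Lemma gint_continuous (s t : R) : 0 < t -> continuous (gint s) t.
Proof.
intros Ht; apply (ex_derive_continuous (V := R_NormedModule)).
unfold gint, Rpower; auto_derive; easy.
Qed.

Lemma gint_add (s p t : R) : 0 < t -> gint (s + p) t = Rpower t p * gint s t.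
Proof.
intros Ht; unfold gint; rewrite <- Rmult_assoc, <- Rpower_plus; do 2 f_equal; ring.
Qed.

(* [s ln (t/s) <= t - s] *)
Lemma Rpower_exp_bound (s t : R) : 0 < s -> 0 < t ->
  Rpower t s * exp (- t) <= exp (s * ln s - s).
Proof.
intros Hs Ht; unfold Rpower; rewrite <- exp_plus.
apply Rnot_lt_le; intros H; apply exp_lt_inv in H.
assert (Hts : 0 < t / s) by (apply Rdiv_lt_0_compat; lra).
pose proof (exp_ineq1_le (ln (t / s))) as E; rewrite exp_ln in E by easy.
unfold Rdiv in E; rewrite ln_mult, ln_Rinv in E by (try apply Rinv_0_lt_compat; lra).
assert (s * (1 + (ln t + - ln s)) <= s * (t * / s)) by (apply Rmult_le_compat_l; lra).
replace (s * (t * / s)) with t in H0 by (field; lra). nra.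
Qed.

(** One majorant serves both ends of the half-line: the derivative of [K (1 - 1/(1 + t^s))], a
    function with values between 0 and [K]. It dominates because [exp (-t) (1 + t^s)^2] is
    bounded. *)
Lemma gint_integral_bound (s : R) : 0 < s ->
  exists B, forall u v, 0 < u -> u <= v -> RInt (gint s) u v <= B.
Proof.
intros Hs.
(* [K s] bounds [exp (-t) (1 + t^s)^2] term by term, through [Rpower_exp_bound] at [s] and [2s]. *)
set (K := (1 + 2 * exp (s * ln s - s) + exp ((s + s) * ln (s + s) - (s + s))) / s).
assert (HK : 0 < K).
{ unfold K; apply Rdiv_lt_0_compat; [|easy].
  pose proof (exp_pos (s * ln s - s)); pose proof (exp_pos ((s + s) * ln (s + s) - (s + s))); lra. }
set (H := fun t => K * (1 - / (1 + Rpower t s))).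
set (dH := fun t => K * (s * Rpower t (s - 1) / (1 + Rpower t s) ^ 2)).
exists K; intros u v Hu Huv.
assert (I : is_RInt dH u v (H v - H u)).
{ apply (is_RInt_derive (V := R_CompleteNormedModule) H dH); intros t Ht;
    rewrite Rmin_left, Rmax_right in Ht by lra.
  - unfold H, dH. replace (Rpower t (s - 1)) with (Rpower t s / t).
    2:{ unfold Rminus; rewrite Rpower_plus, Rpower_Ropp, Rpower_1 by lra; easy. }
    pose proof (Rpower_pos t s) as Hp; unfold Rpower in *; auto_derive.
    + repeat split; lra.
    + field; lra.
  - apply (ex_derive_continuous (V := R_NormedModule)).
    pose proof (Rpower_pos t s) as Hp; unfold dH; unfold Rpower in *; auto_derive.
    repeat split; try lra. apply Rgt_not_eq, Rmult_lt_0_compat; lra. }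
apply Rle_trans with (H v - H u).
- rewrite <- (is_RInt_unique _ _ _ _ I).
  apply RInt_le; [easy| |exists (H v - H u); exact I|].
  + apply (ex_RInt_continuous (V := R_CompleteNormedModule)); intros z Hz.
    rewrite Rmin_left, Rmax_right in Hz by lra; apply gint_continuous; lra.
  + intros t Ht; unfold gint, dH.
    pose proof (Rpower_pos t (s - 1)); pose proof (Rpower_pos t s).
    replace (K * (s * Rpower t (s - 1) / (1 + Rpower t s) ^ 2))
      with (Rpower t (s - 1) * (K * s / (1 + Rpower t s) ^ 2)) by (field; lra).
    apply Rmult_le_compat_l; [lra|].
    apply (Rmult_le_reg_r ((1 + Rpower t s) ^ 2)); [apply pow_lt; lra|].
    replace (K * s / (1 + Rpower t s) ^ 2 * (1 + Rpower t s) ^ 2) with (K * s) by (field; lra).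
    unfold K; unfold Rdiv at 1; rewrite Rmult_assoc, Rinv_l, Rmult_1_r by lra.
    pose proof (Rpower_exp_bound s t Hs ltac:(lra)).
    pose proof (Rpower_exp_bound (s + s) t ltac:(lra) ltac:(lra)).
    rewrite (Rpower_plus s s) in H3.
    assert (exp (- t) < 1) by (rewrite <- exp_0; apply exp_increasing; lra).
    replace (exp (- t) * (1 + Rpower t s) ^ 2)
      with (exp (- t) + 2 * (Rpower t s * exp (- t)) + Rpower t s * Rpower t s * exp (- t)) by ring.
    lra.
- unfold H.
  assert (0 < / (1 + Rpower v s)) by (apply Rinv_0_lt_compat; pose proof (Rpower_pos v s); lra).
  assert (/ (1 + Rpower u s) < 1).
  { rewrite <- Rinv_1; apply Rinv_lt_contravar; pose proof (Rpower_pos u s); lra. }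
  nra.
Qed.

(** [RInt_gen] is total; from here on [Gamma] is known to be a convergent integral at positive
    arguments. *)
Lemma Gamma_is_RInt_gen (s : R) : 0 < s ->
  is_RInt_gen (gint s) (at_right 0) (Rbar_locally p_infty) (Gamma s) /\ 0 < Gamma s.
Proof.
intros Hs; destruct (gint_integral_bound s Hs) as [B HB].
destruct (ex_RInt_gen_nonneg_bounded (gint s) B) as [l [Hl Hle]]; auto.
- intros t Ht; now apply gint_continuous.
- intros t Ht; apply Rlt_le, gint_pos.
- assert (E : Gamma s = l).
  { unfold Gamma; fold (gint s).
    apply (is_RInt_gen_unique (V := R_CompleteNormedModule)); exact Hl. }
  rewrite E; split; [exact Hl|].
  apply Rlt_le_trans with (RInt (gint s) 1 2); [|apply Hle; lra].
  apply RInt_gt_0; [lra| |].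
  + intros; apply gint_pos.
  + intros t Ht; apply gint_continuous; lra.
Qed.

Lemma filter_prod_0_infty_pos (P : R -> Prop) : (forall t, 0 < t -> P t) ->
  filter_prod (at_right 0) (Rbar_locally p_infty)
    (fun ab => forall x, Rmin (fst ab) (snd ab) <= x <= Rmax (fst ab) (snd ab) -> P x).
Proof.
intros H; apply Filter_prod with (fun t => 0 < t) (fun t => 0 < t).
- exists (mkposreal 1 Rlt_0_1); intros; easy.
- now exists 0.
- intros x y Hx Hy z [Hz _]; apply H; simpl in Hz.
  apply Rlt_le_trans with (2 := Hz); now apply Rmin_glb_lt.
Qed.

Lemma is_RInt_gen_primitive (F f : R -> R) (la lb : R) :
  (forall t, 0 < t -> is_derive F t (f t)) -> (forall t, 0 < t -> continuous f t) ->
  filterlim F (at_right 0) (locally la) -> filterlim F (Rbar_locally p_infty) (locally lb) ->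
  is_RInt_gen f (at_right 0) (Rbar_locally p_infty) (lb - la).
Proof.
intros Hd Hc Ha Hb.
apply (is_RInt_gen_ext (V := R_NormedModule) (Derive F)).
- eapply filter_imp; [|apply (filter_prod_0_infty_pos (fun t => Derive F t = f t))].
  + intros ab H x Hx; apply H; lra.
  + intros t Ht; apply is_derive_unique, Hd, Ht.
- apply is_RInt_gen_Derive; try assumption.
  + apply (filter_prod_0_infty_pos (fun t => ex_derive F t)).
    intros t Ht; exists (f t); auto.
  + apply (filter_prod_0_infty_pos (fun t => continuous (Derive F) t)).
    intros t Ht; apply (continuous_ext_loc _ f); [|now apply Hc].
    exists (mkposreal t Ht); intros y Hy; symmetry; apply is_derive_unique, Hd.
    unfold ball in Hy; simpl in Hy; unfold AbsRing_ball, abs, minus, plus, opp in Hy; simpl in Hy.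
    apply Rabs_def2 in Hy; lra.
Qed.

Lemma Rpower_exp_lim_0 (s : R) : 0 < s ->
  filterlim (fun t => - (Rpower t s * exp (- t))) (at_right 0) (locally 0).
Proof.
intros Hs P [eps HP]; unfold filtermap.
exists (mkposreal _ (Rpower_pos eps (/ s))); intros t Ht Ht0; apply HP.
unfold ball in *; simpl in *; unfold AbsRing_ball, abs, minus, plus, opp in *; simpl in *.
rewrite Ropp_0, Rplus_0_r in Ht |- *; rewrite Rabs_Ropp.
rewrite Rabs_pos_eq in Ht by lra.
rewrite Rabs_pos_eq by (apply Rlt_le, Rmult_lt_0_compat; apply exp_pos).
assert (H1 : exp (- t) < 1) by (rewrite <- exp_0; apply exp_increasing; lra).
assert (H2 : Rpower t s < eps).
{ destruct eps as [e He]; simpl in *.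
  replace e with (Rpower (Rpower e (/ s)) s).
  - apply Rlt_Rpower_l; lra.
  - rewrite Rpower_mult, Rinv_l, Rpower_1; lra. }
pose proof (exp_pos (- t)); pose proof (Rpower_pos t s); nra.
Qed.

Lemma Rpower_exp_lim_infty (s : R) : 0 < s ->
  filterlim (fun t => - (Rpower t s * exp (- t))) (Rbar_locally p_infty) (locally 0).
Proof.
intros Hs P [eps HP]; unfold filtermap.
(* [K] bounds [t^(s+1) exp (-t)], so that [t^s exp (-t) <= K / t]. *)
set (K := exp ((s + 1) * ln (s + 1) - (s + 1))).
assert (HK : 0 < K) by apply exp_pos.
destruct eps as [e He].
assert (HKe : 0 < K / e) by (apply Rdiv_lt_0_compat; easy).
exists (K / e); intros t Ht; apply HP.
unfold ball in *; simpl in *; unfold AbsRing_ball, abs, minus, plus, opp in *; simpl in *.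
rewrite Ropp_0, Rplus_0_r, Rabs_Ropp.
rewrite Rabs_pos_eq by (apply Rlt_le, Rmult_lt_0_compat; apply exp_pos).
pose proof (Rpower_exp_bound (s + 1) t ltac:(lra) ltac:(lra)) as H; fold K in H.
rewrite Rpower_plus, Rpower_1 in H by lra.
apply (Rmult_lt_reg_l t); [lra|].
apply Rle_lt_trans with K; [lra|].
apply (Rmult_lt_compat_r e) in Ht; [|easy].
unfold Rdiv in Ht; rewrite Rmult_assoc, Rinv_l in Ht by lra; lra.
Qed.

(** Integration by parts, done by integrating the derivative of [- t^s exp (-t)], which vanishes at
    both ends. *)
Lemma Gamma_S (s : R) : 0 < s -> Gamma (s + 1) = s * Gamma s.
Proof.
intros Hs.
destruct (Gamma_is_RInt_gen s Hs) as [H1 _].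
destruct (Gamma_is_RInt_gen (s + 1) ltac:(lra)) as [H2 _].
assert (H3 := is_RInt_gen_primitive (fun t => - (Rpower t s * exp (- t)))
  (fun t => minus (gint (s + 1) t) (scal s (gint s t))) 0 0).
assert (H4 := is_RInt_gen_minus _ _ _ _ H2 (is_RInt_gen_scal _ s _ H1)).
assert (E : minus (Gamma (s + 1)) (scal s (Gamma s)) = 0 - 0).
{ transitivity (RInt_gen (fun t => minus (gint (s + 1) t) (scal s (gint s t)))
                  (at_right 0) (Rbar_locally p_infty)).
  { symmetry; apply (is_RInt_gen_unique (V := R_CompleteNormedModule)); exact H4. }
  apply (is_RInt_gen_unique (V := R_CompleteNormedModule)), H3.
  - intros t Ht; unfold minus, plus, opp, scal; simpl; unfold mult; simpl.
    rewrite gint_add, Rpower_1 by easy; unfold gint.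
    unfold Rminus; rewrite Rpower_plus, Rpower_Ropp, Rpower_1 by easy.
    unfold Rpower; auto_derive; [easy|]; field; lra.
  - intros t Ht; apply (continuous_minus (V := R_NormedModule)).
    + now apply gint_continuous.
    + apply (continuous_scal_r (V := R_NormedModule)); now apply gint_continuous.
  - now apply Rpower_exp_lim_0.
  - now apply Rpower_exp_lim_infty. }
unfold minus, plus, opp, scal in E; simpl in E; unfold mult in E; simpl in E; lra.
Qed.

Lemma Gamma_1 : Gamma 1 = 1.
Proof.
replace 1 with (0 - - (1)) at 2 by ring.
unfold Gamma; apply (is_RInt_gen_unique (V := R_CompleteNormedModule)).
apply (is_RInt_gen_primitive (fun t => - exp (- t))).
- intros t Ht; unfold Rpower; auto_derive; [easy|].
  replace ((1 - 1) * ln t) with 0 by ring; rewrite exp_0; ring.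
- intros t Ht; apply gint_continuous; easy.
- replace (- (1)) with (- exp (- 0)) by (rewrite Ropp_0, exp_0; easy).
  assert (Hc : continuous (fun t => - exp (- t)) 0).
  { apply (ex_derive_continuous (V := R_NormedModule)); auto_derive; easy. }
  intros P HP; destruct (Hc P HP) as [e He]; exists e; intros y Hy _; now apply He.
- intros P [[e He] HP]; unfold filtermap.
  exists (Rmax 0 (/ e)); intros t Ht; apply HP.
  unfold ball in *; simpl in *; unfold AbsRing_ball, abs, minus, plus, opp in *; simpl in *.
  rewrite Ropp_0, Rplus_0_r, Rabs_Ropp, Rabs_pos_eq by apply Rlt_le, exp_pos.
  pose proof (Rmax_l 0 (/ e)); pose proof (Rmax_r 0 (/ e)).
  rewrite exp_Ropp, <- (Rinv_inv e).
  pose proof (Rinv_0_lt_compat e He); pose proof (exp_ineq1_le t).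
  apply Rinv_lt_contravar; [|lra]. apply Rmult_lt_0_compat; lra.
Qed.

Lemma Gamma_fact (n : nat) : Gamma (INR n + 1) = INR (fact n).
Proof.
induction n as [|n IH].
- simpl; rewrite Rplus_0_l; apply Gamma_1.
- rewrite fact_simpl, mult_INR, Gamma_S, S_INR, IH; [easy|].
  rewrite S_INR; pose proof (pos_INR n); lra.
Qed.

Lemma Gamma_comparison (f g : R -> R) (lf lg : R) :
  is_RInt_gen f (at_right 0) (Rbar_locally p_infty) lf ->
  is_RInt_gen g (at_right 0) (Rbar_locally p_infty) lg ->
  (forall t, 0 < t -> 0 <= f t <= g t) -> lf <= lg.
Proof.
intros Hf Hg H.
apply Rle_trans with (1 := Rle_abs lf).
apply (RInt_gen_norm (V := R_CompleteNormedModule)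
  (Fa := at_right 0) (Fb := Rbar_locally p_infty) f g lf lg); try assumption.
- apply Filter_prod with (fun t => 0 < t < 1) (fun t => 1 < t).
  + exists (mkposreal 1 Rlt_0_1); intros t Ht Ht0.
    unfold ball in Ht; simpl in Ht; unfold AbsRing_ball, abs, minus, plus, opp in Ht; simpl in Ht.
    apply Rabs_def2 in Ht; lra.
  + now exists 1.
  + intros; simpl; lra.
- apply Filter_prod with (fun t => 0 < t) (fun _ => True).
  + exists (mkposreal 1 Rlt_0_1); intros; easy.
  + exists 0; easy.
  + intros x y Hx _ z Hz; simpl in Hz; change (Rabs (f z) <= g z).
    destruct (H z ltac:(lra)); rewrite Rabs_pos_eq; easy.
Qed.

(* Both bounds integrate, against the density [gint s], an inequality for
   [(t/s)^p] that follows from [1 + y <= exp y]. *)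
Lemma Gamma_ratio_bounds (s p : R) : 0 < s -> 0 <= p <= 1 ->
  Gamma (s + p) <= Rpower s p * Gamma s /\
  Rpower s p * (1 - (1 - p) / s) * Gamma s <= Gamma (s + p).
Proof.
intros Hs Hp.
destruct (Gamma_is_RInt_gen s Hs) as [I0 _].
destruct (Gamma_is_RInt_gen (s + 1) ltac:(lra)) as [I1 _].
destruct (Gamma_is_RInt_gen (s + 1 + 1) ltac:(lra)) as [I2 _].
destruct (Gamma_is_RInt_gen (s + p) ltac:(lra)) as [Ip _].
pose proof (Rpower_pos s p) as Hsp.
(* In the variable [z = ln (t/s)] the upper bound is the convexity inequality
   [exp (p z) <= (1-p) + p exp z], integrated with [Gamma (s+1) = s Gamma s]. *)
assert (Ht : forall t, 0 < t -> exists z, t = s * exp z /\ Rpower t p = Rpower s p * exp (p * z)).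
{ intros t Ht; exists (ln t - ln s); split.
  - unfold Rminus; rewrite exp_plus, exp_Ropp, !exp_ln by easy; field; lra.
  - unfold Rpower; rewrite <- exp_plus; f_equal; ring. }
split.
- pose proof (is_RInt_gen_plus _ _ _ _ (is_RInt_gen_scal _ (Rpower s p * (1 - p)) _ I0)
    (is_RInt_gen_scal _ (Rpower s p * p / s) _ I1)) as J.
  assert (E := Gamma_comparison _ _ _ _ Ip J).
  unfold plus, scal in E; simpl in E; unfold mult in E; simpl in E.
  rewrite (Gamma_S s Hs) in E.
  replace (Rpower s p * Gamma s) with
    (Rpower s p * (1 - p) * Gamma s + Rpower s p * p / s * (s * Gamma s)) by (field; lra).
  apply E; intros t Ht0; split; [apply Rlt_le, gint_pos|].
  rewrite !gint_add, Rpower_1 by easy.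
  destruct (Ht t Ht0) as [z [Ez Ep]]; rewrite Ep; clear Ep; pose proof (gint_pos s t).
  assert (E1 : t / s = exp z) by (rewrite Ez; field; lra).
  replace (Rpower s p * (1 - p) * gint s t + Rpower s p * p / s * (t * gint s t))
    with (Rpower s p * ((1 - p) + p * (t / s)) * gint s t) by (field; lra).
  apply Rmult_le_compat_r; [lra|]; apply Rmult_le_compat_l; [lra|]; rewrite E1.
  pose proof (exp_ineq1_le ((1 - p) * z)) as A1; pose proof (exp_ineq1_le (- (p * z))) as A2.
  pose proof (exp_pos (p * z)) as A3.
  replace (exp z) with (exp (p * z) * exp ((1 - p) * z)) by (rewrite <- exp_plus; f_equal; ring).
  assert (A4 : 1 = exp (p * z) * exp (- (p * z))) by (rewrite <- exp_plus, Rplus_opp_r, exp_0; easy).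
  assert (B1 : p * (exp (p * z) * (1 + (1 - p) * z)) <= p * (exp (p * z) * exp ((1 - p) * z))).
  { apply Rmult_le_compat_l; [lra|]; apply Rmult_le_compat_l; lra. }
  assert (B2 : (1 - p) * (exp (p * z) * (1 + - (p * z))) <= (1 - p) * 1).
  { rewrite A4 at 4; apply Rmult_le_compat_l; [lra|]; apply Rmult_le_compat_l; lra. }
  lra.
(* For the lower bound the pointwise inequality is [(2-p) y <= y^p + (1-p) y^2] with [y = t/s]; the
   square brings in [Gamma (s+2)]. *)
- pose proof (is_RInt_gen_plus _ _ _ _ Ip
    (is_RInt_gen_scal _ (Rpower s p * (1 - p) / (s * s)) _ I2)) as J.
  pose proof (is_RInt_gen_scal _ (Rpower s p * (2 - p) / s) _ I1) as J1.
  assert (E := Gamma_comparison _ _ _ _ J1 J).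
  unfold plus, scal in E; simpl in E; unfold mult in E; simpl in E.
  rewrite (Gamma_S (s + 1)), (Gamma_S s) in E by lra.
  assert (E' : Rpower s p * (2 - p) / s * (s * Gamma s)
     <= Gamma (s + p) + Rpower s p * (1 - p) / (s * s) * ((s + 1) * (s * Gamma s))).
  { apply E; intros t Ht0; pose proof (gint_pos s t); pose proof (gint_pos (s + 1) t); split.
    - apply Rmult_le_pos; [|lra].
      apply Rmult_le_pos; [nra|]; apply Rlt_le, Rinv_0_lt_compat; easy.
    - rewrite !gint_add, Rpower_1 by easy.
      destruct (Ht t Ht0) as [z [Ez Ep]]; rewrite Ep; clear Ep.
      assert (E1 : t / s = exp z) by (rewrite Ez; field; lra).
      replace (Rpower s p * (2 - p) / s * (t * gint s t))
        with (Rpower s p * gint s t * ((2 - p) * (t / s))) by (field; lra).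
      replace (Rpower s p * exp (p * z) * gint s t +
               Rpower s p * (1 - p) / (s * s) * (t * (t * gint s t)))
        with (Rpower s p * gint s t * (exp (p * z) + (1 - p) * ((t / s) * (t / s))))
        by (field; lra).
      apply Rmult_le_compat_l; [nra|]; rewrite E1.
      replace (exp (p * z)) with (exp z * exp (- ((1 - p) * z)))
        by (rewrite <- exp_plus; f_equal; ring).
      pose proof (exp_ineq1_le (- ((1 - p) * z))); pose proof (exp_ineq1_le z).
      replace (exp z * exp (- ((1 - p) * z)) + (1 - p) * (exp z * exp z))
        with (exp z * (exp (- ((1 - p) * z)) + (1 - p) * exp z)) by ring.
      rewrite (Rmult_comm (2 - p)); apply Rmult_le_compat_l; [apply Rlt_le, exp_pos|].
      assert ((1 - p) * (1 + z) <= (1 - p) * exp z) by (apply Rmult_le_compat_l; lra).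
      lra. }
  replace (Rpower s p * (1 - (1 - p) / s) * Gamma s) with
    (Rpower s p * (2 - p) / s * (s * Gamma s)
     - Rpower s p * (1 - p) / (s * s) * ((s + 1) * (s * Gamma s))) by (field; lra).
  lra.
Qed.

Lemma is_lim_seq_INR_shift_ratio (c : R) :
  is_lim_seq (fun n => (INR n + c) / INR n) 1.
Proof.
apply (is_lim_seq_ext_loc (fun n => 1 + c * / INR n)).
- exists 1%nat; intros n Hn; field; apply not_0_INR; lia.
- replace (Finite 1) with (Rbar_plus 1 (Rbar_mult c 0))
    by (simpl; f_equal; ring).
  apply is_lim_seq_plus'; [apply is_lim_seq_const|].
  apply (is_lim_seq_scal_l (fun n => / INR n) c 0).
  replace (Finite 0) with (Rbar_inv p_infty) by easy.
  apply is_lim_seq_inv; [apply is_lim_seq_INR|easy].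
Qed.

Definition gratio (c : R) (n : nat) : R :=
  Gamma (INR n + c) / (Gamma (INR n) * Rpower (INR n) c).

Lemma gratio_S (c : R) : exists n0, forall n, (n0 <= n)%nat ->
  0 < INR n + c /\ 0 < INR n /\ gratio (c + 1) n = gratio c n * ((INR n + c) / INR n).
Proof.
destruct (nfloor_ex (Rabs c)) as [m [_ Hm]]; [apply Rabs_pos|].
exists (S m); intros n Hn; apply le_INR in Hn; rewrite S_INR in Hn.
pose proof (Rle_abs (- c)); rewrite Rabs_Ropp in H; pose proof (pos_INR m).
assert (0 < INR n) by lra; assert (0 < INR n + c) by lra.
repeat split; try easy; unfold gratio.
rewrite <- Rplus_assoc, Gamma_S, Rpower_plus, Rpower_1 by easy.
pose proof (proj2 (Gamma_is_RInt_gen (INR n) H1)); pose proof (Rpower_pos (INR n) c).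
field; lra.
Qed.

(** The two-sided bounds cover [0 <= c <= 1]. The functional equation carries the limit to [c + 1]
    and [c - 1], so each induction step widens the interval by one on both sides. *)
Lemma gratio_lim (c : R) : is_lim_seq (gratio c) 1.
Proof.
assert (H : forall k c, - INR k <= c <= INR k + 1 -> is_lim_seq (gratio c) 1).
{ clear c; induction k as [|k IH]; intros c Hc.
  - simpl in Hc.
    apply (is_lim_seq_le_le_loc (fun n => 1 - (1 - c) * / INR n) _ (fun _ => 1)).
    + exists 1%nat; intros n Hn; apply le_INR in Hn; simpl in Hn.
      destruct (Gamma_ratio_bounds (INR n) c ltac:(lra) ltac:(lra)) as [H1 H2].
      pose proof (proj2 (Gamma_is_RInt_gen (INR n) ltac:(lra))) as H3.
      pose proof (Rpower_pos (INR n) c) as H4; unfold gratio.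
      assert (H5 : 0 < Gamma (INR n) * Rpower (INR n) c) by nra.
      split; apply (Rmult_le_reg_r (Gamma (INR n) * Rpower (INR n) c)); try easy;
        unfold Rdiv in *; rewrite (Rmult_assoc (Gamma (INR n + c))), Rinv_l, Rmult_1_r by lra; lra.
    + replace (Finite 1) with (Finite (1 - (1 - c) * 0)) by (f_equal; ring).
      apply is_lim_seq_minus'; [apply is_lim_seq_const|].
      apply (is_lim_seq_scal_l (fun n => / INR n) (1 - c) 0).
      replace (Finite 0) with (Rbar_inv p_infty) by easy.
      apply is_lim_seq_inv; [apply is_lim_seq_INR|easy].
    + apply is_lim_seq_const.
  - rewrite S_INR in Hc; pose proof (pos_INR k).
    destruct (Rle_dec c (INR k + 1)) as [Hc1|Hc1]; [destruct (Rle_dec (- INR k) c) as [Hc2|Hc2]|].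
    + apply IH; lra.
    + destruct (gratio_S c) as [n0 Hn0].
      apply (is_lim_seq_ext_loc (fun n => gratio (c + 1) n / ((INR n + c) / INR n))).
      * exists n0; intros n Hn; destruct (Hn0 n Hn) as [H1 [H2 E]]; rewrite E; field; lra.
      * replace (Finite 1) with (Finite (1 / 1)) by (f_equal; field).
        apply is_lim_seq_div'; [apply IH; lra|apply is_lim_seq_INR_shift_ratio|lra].
    + destruct (gratio_S (c - 1)) as [n0 Hn0].
      apply (is_lim_seq_ext_loc (fun n => gratio (c - 1) n * ((INR n + (c - 1)) / INR n))).
      * exists n0; intros n Hn; destruct (Hn0 n Hn) as [_ [_ E]]; rewrite <- E; f_equal; ring.
      * replace (Finite 1) with (Finite (1 * 1)) by (f_equal; ring).
        apply is_lim_seq_mult'; [apply IH; lra|apply is_lim_seq_INR_shift_ratio]. }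
destruct (nfloor_ex (Rabs c)) as [m [_ Hm]]; [apply Rabs_pos|].
apply (H (S m)); rewrite S_INR.
pose proof (Rle_abs (- c)); pose proof (Rle_abs c); rewrite Rabs_Ropp in H0; lra.
Qed.

(** * The norms and Wallis' product *)

Lemma jacobi_h_pos (a b : R) (n : nat) : -1 < a -> -1 < b -> 0 < jacobi_h a b (S n).
Proof.
intros ha hb; unfold jacobi_h.
assert (Hn : 1 <= INR (S n)) by (rewrite S_INR; pose proof (pos_INR n); lra).
apply Rdiv_lt_0_compat.
- repeat apply Rmult_lt_0_compat; try apply exp_pos; apply Gamma_is_RInt_gen; lra.
- repeat apply Rmult_lt_0_compat; [apply INR_fact_pos|lra|apply Gamma_is_RInt_gen; lra].
Qed.

(** For orthogonal polynomials this comes from pairing [x P_k] with [P_(k-1)] in two ways; here it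
    is read off the Gamma quotients. It is what makes the Christoffel-Darboux sum telescope. *)
Lemma jacobi_h_S (a b : R) (n : nat) : -1 < a -> -1 < b ->
  recA a b (INR (S (S n))) * jacobi_h a b (S (S n))
  = recC a b (INR (S (S n))) * recA a b (INR (S n)) * jacobi_h a b (S n).
Proof.
intros ha hb; unfold jacobi_h, recA, recC.
rewrite (fact_simpl (S n)), mult_INR.
set (F := INR (fact (S n))).
assert (HF : 0 < F) by apply INR_fact_pos.
rewrite (S_INR (S n)).
assert (Hn : 1 <= INR (S n)) by (rewrite S_INR; pose proof (pos_INR n); lra).
set (k := INR (S n)) in *.
replace (k + 1 + a + 1) with (k + a + 1 + 1) by ring.
replace (k + 1 + b + 1) with (k + b + 1 + 1) by ring.
replace (k + 1 + a + b + 1) with (k + a + b + 1 + 1) by ring.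
rewrite !Gamma_S by lra.
pose proof (proj2 (Gamma_is_RInt_gen (k + a + b + 1) ltac:(lra))).
field; repeat split; lra.
Qed.

(** With [n! = Gamma (n + 1)] the norm is a quotient of [gratio]s in which the powers of [n] cancel;
    the factor [2n + a + b + 1] leaves [1/(2n)]. *)
Lemma jacobi_h_lim (a b : R) : -1 < a -> -1 < b ->
  is_lim_seq (fun n => INR n * jacobi_h a b n) (Rpower 2 (a + b)).
Proof.
intros ha hb.
apply (is_lim_seq_ext_loc (fun n => Rpower 2 (a + b) *
  (gratio (a + 1) n * gratio (b + 1) n
   / (gratio 1 n * gratio (a + b + 1) n * ((INR n + (a + b + 1) / 2) / INR n))))).
- exists 1%nat; intros n Hn.
  assert (Hn1 : 1 <= INR n) by (apply (le_INR 1); easy).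
  destruct n as [|n]; [lia|]; unfold jacobi_h, gratio.
  rewrite <- Gamma_fact; set (k := INR (S n)) in *.
  replace (k + a + b + 1) with (k + (a + b + 1)) by ring.
  rewrite <- !Rplus_assoc.
  replace (Rpower k (a + b + 1)) with (Rpower k (a + 1) * Rpower k (b + 1) / k).
  2:{ rewrite !Rpower_plus, Rpower_1 by lra; field; lra. }
  rewrite (Rpower_plus (a + b) 1 2), !Rpower_1 by lra.
  pose proof (proj2 (Gamma_is_RInt_gen (k + a + b + 1) ltac:(lra))).
  pose proof (proj2 (Gamma_is_RInt_gen (k + 1) ltac:(lra))).
  pose proof (proj2 (Gamma_is_RInt_gen k ltac:(lra))).
  pose proof (Rpower_pos k (a + 1)); pose proof (Rpower_pos k (b + 1)).
  field; repeat split; lra.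
- replace (Finite (Rpower 2 (a + b))) with (Finite (Rpower 2 (a + b) * (1 * 1 / (1 * 1 * 1))))
    by (f_equal; field).
  apply is_lim_seq_mult'; [apply is_lim_seq_const|].
  apply is_lim_seq_div'; [| |lra]; repeat apply is_lim_seq_mult'; try apply gratio_lim.
  apply is_lim_seq_INR_shift_ratio.
Qed.

(** * Wallis integrals and central binomial coefficients *)

Definition wallis (n : nat) : R := RInt (fun t => sin t ^ n) 0 (PI / 2).

Lemma ex_RInt_sin_pow (n : nat) (u v : R) : ex_RInt (fun t => sin t ^ n) u v.
Proof.
apply (ex_RInt_continuous (V := R_CompleteNormedModule)); intros z _.
apply (ex_derive_continuous (V := R_NormedModule)); auto_derive; easy.
Qed.

(** The difference of the two integrands is the derivative of [- cos t sin^(n+1) t], which vanishes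
    at both endpoints. *)
Lemma wallis_SS (n : nat) : (INR n + 2) * wallis (S (S n)) = (INR n + 1) * wallis n.
Proof.
assert (I : is_RInt (fun t => (INR n + 2) * sin t ^ S (S n) - (INR n + 1) * sin t ^ n) 0 (PI / 2)
          (- (cos (PI / 2) * sin (PI / 2) ^ S n) - - (cos 0 * sin 0 ^ S n))).
{ apply (is_RInt_derive (V := R_CompleteNormedModule) (fun t => - (cos t * sin t ^ S n))).
  - intros t _; auto_derive; [easy|].
    pose proof (sin2_cos2 t) as E; unfold Rsqr in E.
    change (match n with 0%nat => 1 | S _ => INR n + 1 end) with (INR (S n)).
    rewrite S_INR; simpl pow.
    transitivity (sin t * sin t * sin t ^ n - (INR n + 1) * (cos t * cos t) * sin t ^ n); [ring|].
    replace (cos t * cos t) with (1 - sin t * sin t) by lra; ring.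
  - intros t _; apply (ex_derive_continuous (V := R_NormedModule)); auto_derive; easy. }
rewrite cos_PI2, sin_0 in I; simpl (0 ^ S n) in I.
assert (J : is_RInt (fun t => (INR n + 2) * sin t ^ S (S n) - (INR n + 1) * sin t ^ n) 0 (PI / 2)
          ((INR n + 2) * wallis (S (S n)) - (INR n + 1) * wallis n)).
{ apply (is_RInt_minus (V := R_NormedModule));
  apply (is_RInt_scal (V := R_NormedModule)), (RInt_correct (V := R_CompleteNormedModule)), ex_RInt_sin_pow. }
apply (is_RInt_unique (V := R_CompleteNormedModule)) in I.
apply (is_RInt_unique (V := R_CompleteNormedModule)) in J.
rewrite I in J; lra.
Qed.

Lemma wallis_decr (n : nat) : wallis (S n) <= wallis n.
Proof.
pose proof PI_RGT_0.
apply RInt_le; [lra|apply ex_RInt_sin_pow|apply ex_RInt_sin_pow|].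
intros t Ht; simpl.
assert (0 <= sin t) by (apply sin_ge_0; lra).
pose proof (SIN_bound t); pose proof (pow_le _ n H0); nra.
Qed.

Lemma wallis_0 : wallis 0 = PI / 2.
Proof. unfold wallis; simpl; rewrite RInt_const; unfold scal; simpl; unfold mult; simpl; ring. Qed.

Lemma wallis_1 : wallis 1 = 1.
Proof.
transitivity (- cos (PI / 2) - - cos 0); [|rewrite cos_PI2, cos_0; ring].
unfold wallis; apply is_RInt_unique.
apply (is_RInt_derive (V := R_CompleteNormedModule) (fun t => - cos t)).
- intros t _; auto_derive; [easy|]; ring.
- intros t _; apply (ex_derive_continuous (V := R_NormedModule)); auto_derive; easy.
Qed.

Lemma wallis_product (n : nat) : (INR n + 1) * (wallis n * wallis (S n)) = PI / 2.
Proof.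
induction n as [|n IH].
- rewrite wallis_0, wallis_1; simpl; ring.
- rewrite <- IH, S_INR.
  replace ((INR n + 1 + 1) * (wallis (S n) * wallis (S (S n))))
    with (wallis (S n) * ((INR n + 2) * wallis (S (S n)))) by ring.
  rewrite wallis_SS; ring.
Qed.

(** This is [C(2m, m) / 4^m], as [gbinom_central] shows. *)
Fixpoint central (m : nat) : R :=
  match m with O => 1 | S k => central k * ((2 * INR k + 1) / (2 * INR k + 2)) end.

Lemma wallis_central (m : nat) : wallis (2 * m) = PI / 2 * central m.
Proof.
induction m as [|m IH]; [rewrite Rmult_1_r; apply wallis_0|].
pose proof (pos_INR m).
apply (Rmult_eq_reg_l (INR (2 * m) + 2)); [|rewrite mult_INR; simpl; lra].
replace (2 * S m)%nat with (S (S (2 * m))) by lia.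
rewrite wallis_SS, IH, mult_INR; simpl; field; lra.
Qed.

(** By monotonicity the square of [wallis (2m)] lies between its products with the next and the
    previous integral, and [wallis_product] gives both products exactly. *)
Lemma central_lim : is_lim_seq (fun m => INR m * (central m * central m)) (/ PI).
Proof.
pose proof PI_RGT_0 as HPI.
apply (is_lim_seq_ext_loc (fun m => 4 / (PI * PI) * (INR m * (wallis (2 * m) * wallis (2 * m))))).
{ exists 0%nat; intros m _; rewrite wallis_central; field; lra. }
apply (is_lim_seq_le_le_loc
  (fun m => / PI / ((INR m + / 2) / INR m)) _ (fun _ => / PI)).
- exists 1%nat; intros m Hm.
  assert (Hm1 : 1 <= INR m) by (apply (le_INR 1); easy).
  assert (Hw : 0 < wallis (2 * m)).
  { rewrite wallis_central; apply Rmult_lt_0_compat; [lra|].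
    clear; induction m as [|m IH]; simpl; [lra|].
    pose proof (pos_INR m); apply Rmult_lt_0_compat; [easy|]; apply Rdiv_lt_0_compat; lra. }
  pose proof (wallis_product (2 * m)) as E1; pose proof (wallis_decr (2 * m)) as D1.
  pose proof (wallis_product (2 * m - 1)) as E2; pose proof (wallis_decr (2 * m - 1)) as D2.
  replace (S (2 * m - 1)) with (2 * m)%nat in * by lia.
  rewrite minus_INR in E2 by lia.
  rewrite mult_INR in E1, E2; replace (INR 2) with 2 in E1, E2 by (simpl; ring); simpl (INR 1) in E2.
  split; apply (Rmult_le_reg_l (PI * PI / 4)); try nra.
  + transitivity (PI / 2 * (INR m / (2 * INR m + 1))); [right; field; lra|].
    rewrite <- E1.
    replace ((2 * INR m + 1) * (wallis (2 * m) * wallis (S (2 * m))) * (INR m / (2 * INR m + 1)))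
      with (INR m * (wallis (2 * m) * wallis (S (2 * m)))) by (field; lra).
    replace (PI * PI / 4 * (4 / (PI * PI) * (INR m * (wallis (2 * m) * wallis (2 * m)))))
      with (INR m * (wallis (2 * m) * wallis (2 * m))) by (field; lra).
    apply Rmult_le_compat_l; [lra|]; apply Rmult_le_compat_l; lra.
  + replace (PI * PI / 4 * / PI) with (PI / 2 / 2) by (field; lra).
    replace (PI * PI / 4 * (4 / (PI * PI) * (INR m * (wallis (2 * m) * wallis (2 * m)))))
      with (INR m * (wallis (2 * m) * wallis (2 * m))) by (field; lra).
    rewrite <- E2; nra.
- replace (Finite (/ PI)) with (Finite (/ PI / 1)) by (f_equal; field; lra).
  apply is_lim_seq_div'; [apply is_lim_seq_const|apply is_lim_seq_INR_shift_ratio|lra].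
- apply is_lim_seq_const.
Qed.

(** * Values at the origin as binomial sums *)

Lemma gbinom_0 (r : R) : gbinom r 0 = 1.
Proof. unfold gbinom; simpl; field. Qed.

Lemma gbinom_S (r : R) (k : nat) :
  INR (S k) * gbinom r (S k) = (r - INR k) * gbinom r k.
Proof.
unfold gbinom; rewrite fact_simpl, mult_INR; simpl rprod.
pose proof (INR_fact_pos k); assert (0 < INR (S k)) by (apply lt_0_INR; lia).
field; lra.
Qed.

Lemma gbinom_absorb (r : R) (k : nat) :
  INR (S k) * gbinom (r + 1) (S k) = (r + 1) * gbinom r k.
Proof.
unfold gbinom; rewrite fact_simpl, mult_INR, rprod_shift.
rewrite (rprod_ext (fun i => r + 1 - INR (S i)) (fun i => r - INR i))
  by (intros; rewrite S_INR; ring).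
pose proof (INR_fact_pos k); assert (0 < INR (S k)) by (apply lt_0_INR; lia).
simpl (INR 0); field; lra.
Qed.

Lemma gbinom_upper (r : R) (k : nat) :
  (r + 1 - INR k) * gbinom (r + 1) k = (r + 1) * gbinom r k.
Proof. rewrite <- gbinom_absorb, gbinom_S; easy. Qed.

Lemma gbinom_pascal (r : R) (k : nat) :
  gbinom (r + 1) (S k) = gbinom r (S k) + gbinom r k.
Proof.
assert (H : 0 < INR (S k)) by (apply lt_0_INR; lia).
apply (Rmult_eq_reg_l (INR (S k))); [|lra].
rewrite gbinom_absorb, Rmult_plus_distr_l, gbinom_S, S_INR; ring.
Qed.

(* The coefficient of [z^j] in [(1 + z)^A (1 - z)^B]. *)
Definition ecoef (A B : R) (j : nat) : R :=
  rsum (fun s => (-1) ^ s * gbinom A (j - s) * gbinom B s) (S j).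

Lemma ecoef_0 (A B : R) : ecoef A B 0 = 1.
Proof. unfold ecoef; simpl; rewrite !gbinom_0; ring. Qed.

Lemma ecoef_1 (A B : R) : ecoef A B 1 = A - B.
Proof. unfold ecoef, gbinom; simpl; field. Qed.

(** On generating functions this is multiplication by [1 + z]; [ecoef_Sr] and [ecoef_SS] are
    multiplication by [1 - z] and [1 - z^2]. *)
Lemma ecoef_Sl (A B : R) (j : nat) :
  ecoef (A + 1) B (S j) = ecoef A B (S j) + ecoef A B j.
Proof.
unfold ecoef.
change (rsum ?f (S (S j))) with (rsum f (S j) + f (S j)); cbv beta.
rewrite Nat.sub_diag, !gbinom_0.
replace (rsum _ (S j) + (-1) ^ S j * 1 * gbinom B (S j) + rsum _ (S j)) with
  (rsum (fun s => (-1) ^ s * gbinom A (S j - s) * gbinom B s) (S j)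
   + rsum (fun s => (-1) ^ s * gbinom A (j - s) * gbinom B s) (S j)
   + (-1) ^ S j * 1 * gbinom B (S j)) by ring.
rewrite <- rsum_plus; f_equal; apply rsum_ext; intros s Hs.
replace (S j - s)%nat with (S (j - s)) by lia; rewrite gbinom_pascal; ring.
Qed.

Lemma ecoef_Sr (A B : R) (j : nat) :
  ecoef A (B + 1) (S j) = ecoef A B (S j) - ecoef A B j.
Proof.
unfold ecoef; rewrite !(rsum_shift _ (S j)), !gbinom_0.
replace (rsum (fun s => (-1) ^ S s * gbinom A (S j - S s) * gbinom (B + 1) (S s)) (S j)) with
  (rsum (fun s => (-1) ^ S s * gbinom A (S j - S s) * gbinom B (S s)) (S j)
   + (-1) * rsum (fun s => (-1) ^ s * gbinom A (j - s) * gbinom B s) (S j)); [ring|].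
rewrite <- rsum_scal, <- rsum_plus; apply rsum_ext; intros s Hs.
rewrite gbinom_pascal; simpl; ring.
Qed.

Lemma ecoef_SS (A B : R) (j : nat) :
  ecoef (A + 1) (B + 1) (S (S j)) = ecoef A B (S (S j)) - ecoef A B j.
Proof. rewrite ecoef_Sl, !ecoef_Sr; ring. Qed.

(** The product rule for [(1+z)^(A+1) (1-z)^(B+1)]: in the convolution [j + 1] splits into two
    indices, and [gbinom_absorb] differentiates each factor. *)
Lemma ecoef_deriv (A B : R) (j : nat) :
  INR (S j) * ecoef (A + 1) (B + 1) (S j)
  = (A + 1) * ecoef A (B + 1) j - (B + 1) * ecoef (A + 1) B j.
Proof.
transitivity (rsum (fun s => INR (S j - s) * ((-1) ^ s * gbinom (A + 1) (S j - s) * gbinom (B + 1) s)) (S (S j))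
  + rsum (fun s => INR s * ((-1) ^ s * gbinom (A + 1) (S j - s) * gbinom (B + 1) s)) (S (S j))).
{ unfold ecoef; rewrite <- rsum_scal, <- rsum_plus; apply rsum_ext; intros s Hs.
  replace (INR (S j)) with (INR (S j - s) + INR s); [ring|].
  rewrite <- plus_INR; f_equal; lia. }
rewrite (rsum_shift (fun s => INR s * _)); simpl (INR 0 * _).
change (rsum ?f (S (S j))) with (rsum f (S j) + f (S j)) at 1; cbv beta.
rewrite Nat.sub_diag; simpl (INR 0).
replace ((A + 1) * ecoef A (B + 1) j - (B + 1) * ecoef (A + 1) B j)
  with ((A + 1) * ecoef A (B + 1) j + (- (B + 1)) * ecoef (A + 1) B j) by ring.
rewrite !Rmult_0_l, Rplus_0_l, Rplus_0_r; f_equal;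
  unfold ecoef; rewrite <- rsum_scal; apply rsum_ext; intros s Hs.
- replace (S j - s)%nat with (S (j - s)) by lia.
  transitivity ((-1) ^ s * (INR (S (j - s)) * gbinom (A + 1) (S (j - s))) * gbinom (B + 1) s); [ring|].
  rewrite gbinom_absorb; ring.
- transitivity ((-1) ^ S s * gbinom (A + 1) (S j - S s) * (INR (S s) * gbinom (B + 1) (S s))); [ring|].
  rewrite gbinom_absorb; simpl; ring.
Qed.

(** Coefficient form of [(1 - z^2) G' = ((A - B) - (A + B) z) G] for [G = (1+z)^A (1-z)^B]. *)
Lemma ecoef_rec (A B : R) (j : nat) :
  (INR j + 2) * ecoef A B (S (S j))
  = (A - B) * ecoef A B (S j) + (INR j - A - B) * ecoef A B j.
Proof.
(* The exponents are rewritten as [a + 1], [b + 1] to match [ecoef_deriv] and the multiplication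
   laws. *)
pose (a := A - 1); pose (b := B - 1).
replace A with (a + 1) by (unfold a; ring); replace B with (b + 1) by (unfold b; ring).
generalize a b; clear a b A B; intros a b.
replace (INR j + 2) with (INR (S (S j))) by (rewrite !S_INR; ring).
rewrite ecoef_deriv, (ecoef_Sl a b j), (ecoef_Sr a b j).
destruct j as [|i].
- rewrite !ecoef_0, !ecoef_1; simpl; ring.
- replace ((INR (S i) - (a + 1) - (b + 1)) * ecoef (a + 1) (b + 1) (S i)) with
    (INR (S i) * ecoef (a + 1) (b + 1) (S i) - (a + b + 2) * ecoef (a + 1) (b + 1) (S i)) by ring.
  rewrite ecoef_deriv, ecoef_SS.
  assert (E : ecoef (a + 1) (b + 1) (S i) = ecoef a b (S i) + ecoef a b i - ecoef (a + 1) b i)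
    by (rewrite ecoef_Sr, ecoef_Sl; ring).
  assert (E' : ecoef (a + 1) (b + 1) (S i) = ecoef a b (S i) - ecoef a b i + ecoef a (b + 1) i)
    by (rewrite ecoef_Sl, ecoef_Sr; ring).
  replace (ecoef a (b + 1) i) with (2 * ecoef a b i - ecoef (a + 1) b i) by lra.
  rewrite E; ring.
Qed.

Lemma jacobiP_at_0 (a b : R) (n : nat) :
  jacobiP a b n 0 = (/ 2) ^ n * ecoef (INR n + a) (INR n + b) n.
Proof.
unfold jacobiP, ecoef; rewrite <- rsum_scal; apply rsum_ext; intros s Hs.
replace ((0 - 1) / 2) with (-1 * / 2) by field; replace ((0 + 1) / 2) with (/ 2) by field.
rewrite Rpow_mult_distr.
replace ((/ 2) ^ n) with ((/ 2) ^ s * (/ 2) ^ (n - s)) by (rewrite <- pow_add; f_equal; lia).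
ring.
Qed.

(** If [y N] lists the coefficients of a power series in [w], the hypotheses say that each step in
    [N] multiplies it by [1 - w]; the conclusion expands [(1 - w)^N]. It is applied with
    [w = z^2]. *)
Lemma iterated_difference (y : nat -> nat -> R) :
  (forall N, y (S N) 0%nat = y N 0%nat) ->
  (forall N m, y (S N) (S m) = y N (S m) - y N m) ->
  forall N m, y N m
    = rsum (fun i => (-1) ^ (m - i) * gbinom (INR N) (m - i) * y 0%nat i) (S m).
Proof.
intros H0 HS N; induction N as [|N IH]; intros m.
- assert (Z : forall k, gbinom 0 (S k) = 0).
  { intros k; unfold gbinom; rewrite rprod_shift; simpl; unfold Rdiv; ring. }
  simpl rsum; rewrite Nat.sub_diag, gbinom_0; simpl pow.
  rewrite (rsum_ext _ (fun i => 0 * 0)).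
  + rewrite rsum_scal; ring.
  + intros i Hi; replace (m - i)%nat with (S (m - S i)) by lia.
    simpl (INR 0); rewrite Z; ring.
- destruct m as [|m].
  + rewrite H0, IH; simpl; rewrite !gbinom_0; ring.
  + rewrite HS, !IH.
    change (rsum ?f (S (S m))) with (rsum f (S m) + f (S m)); cbv beta.
    rewrite Nat.sub_diag, !gbinom_0.
    replace (rsum (fun i => (-1) ^ (S m - i) * gbinom (INR (S N)) (S m - i) * y 0%nat i) (S m)) with
      (rsum (fun i => (-1) ^ (S m - i) * gbinom (INR N) (S m - i) * y 0%nat i) (S m)
       + (-1) * rsum (fun i => (-1) ^ (m - i) * gbinom (INR N) (m - i) * y 0%nat i) (S m)); [ring|].
    rewrite <- rsum_scal, <- rsum_plus; apply rsum_ext; intros i Hi.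
    replace (S m - i)%nat with (S (m - i)) by lia; rewrite (S_INR N), gbinom_pascal; simpl; ring.
Qed.

(** The quotient [C(2m, m-i) / C(2m, m)]. It lies in [[0, 1]], tends to 1 for fixed [i] and vanishes
    for [i > m], so that the finite sums become dominated series. *)
Definition cratio (m i : nat) : R :=
  rprod (fun l => (INR m - INR l) / (INR m + INR l + 1)) i.

Lemma cratio_zero (m i : nat) : (m < i)%nat -> cratio m i = 0.
Proof.
unfold cratio; intros H; induction H as [|i H IH]; simpl; [|rewrite IH; ring].
unfold Rdiv; ring.
Qed.

Lemma cratio_bound (m i : nat) : 0 <= cratio m i <= 1.
Proof.
destruct (Nat.le_gt_cases i m) as [H|H].
- unfold cratio; induction i as [|i IH]; simpl; [lra|].
  specialize (IH ltac:(lia)).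
  assert (Hi : INR i + 1 <= INR m) by (rewrite <- S_INR; apply le_INR; easy).
  pose proof (pos_INR i).
  assert (0 <= (INR m - INR i) / (INR m + INR i + 1) <= 1).
  { split; [apply Rmult_le_pos; [lra|apply Rlt_le, Rinv_0_lt_compat; lra]|].
    apply (Rmult_le_reg_r (INR m + INR i + 1)); [lra|].
    unfold Rdiv; rewrite Rmult_assoc, Rinv_l by lra; lra. }
  nra.
- rewrite cratio_zero by easy; lra.
Qed.

Lemma cratio_lim (i : nat) : is_lim_seq (fun m => cratio m i) 1.
Proof.
unfold cratio; induction i as [|i IH]; simpl; [apply is_lim_seq_const|].
replace (Finite 1) with (Finite (1 * (1 / 1))) by (f_equal; field).
apply is_lim_seq_mult'; [exact IH|].
apply (is_lim_seq_ext_loc (fun m => ((INR m + - INR i) / INR m) / ((INR m + (INR i + 1)) / INR m))).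
- exists 1%nat; intros m Hm; apply (le_INR 1) in Hm; simpl in Hm; pose proof (pos_INR i); field; lra.
- apply is_lim_seq_div'; [apply is_lim_seq_INR_shift_ratio|apply is_lim_seq_INR_shift_ratio|lra].
Qed.

Lemma gbinom_central (m : nat) : gbinom (INR (2 * m)) m = 4 ^ m * central m.
Proof.
induction m as [|m IH]; [simpl; rewrite gbinom_0; ring|].
pose proof (pos_INR m).
assert (Hm : 0 < INR (S m)) by (apply lt_0_INR; lia).
assert (E : INR (2 * S m) = INR (2 * m) + 1 + 1).
{ rewrite !mult_INR, (S_INR m); simpl; ring. }
assert (E2 : INR (2 * m) = 2 * INR m) by (rewrite mult_INR; simpl; ring).
apply (Rmult_eq_reg_l (INR (S m) * INR (S m))); [|nra].
rewrite E, Rmult_assoc, gbinom_absorb.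
transitivity ((INR (2 * m) + 1 + 1) * ((INR (2 * m) + 1 - INR m) * gbinom (INR (2 * m) + 1) m)).
{ rewrite E2, S_INR; ring. }
rewrite gbinom_upper, IH, E2, S_INR; simpl; field; lra.
Qed.

Lemma gbinom_cratio (m i : nat) : (i <= m)%nat ->
  gbinom (INR (2 * m)) (m - i) = 4 ^ m * central m * cratio m i.
Proof.
induction i as [|i IH]; intros H.
- rewrite Nat.sub_0_r, gbinom_central; unfold cratio; simpl; ring.
- specialize (IH ltac:(lia)); pose proof (pos_INR i).
  assert (E2 : INR (2 * m) = 2 * INR m) by (rewrite mult_INR; simpl; ring).
  assert (Hi : INR i + 1 <= INR m) by (rewrite <- S_INR; apply le_INR; easy).
  pose proof (gbinom_S (INR (2 * m)) (m - S i)) as E.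
  replace (S (m - S i)) with (m - i)%nat in E by lia.
  rewrite IH, !minus_INR, S_INR in E by lia.
  rewrite E2 in *; change (cratio m (S i)) with
    (cratio m i * ((INR m - INR i) / (INR m + INR i + 1))).
  apply (Rmult_eq_reg_l (INR m + INR i + 1)); [|lra].
  transitivity ((2 * INR m - (INR m - (INR i + 1))) * gbinom (2 * INR m) (m - S i)); [ring|].
  rewrite <- E; field; lra.
Qed.

Lemma pow_m1_sub (m i : nat) : (i <= m)%nat -> (-1) ^ (m - i) = (-1) ^ m * (-1) ^ i.
Proof.
intros H; replace ((-1) ^ m) with ((-1) ^ (m - i) * (-1) ^ i)
  by (rewrite <- pow_add; f_equal; lia).
rewrite Rmult_assoc, <- Rpow_mult_distr; replace (-1 * -1) with 1 by ring.
rewrite pow1; ring.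
Qed.

(** With [G = (1+z)^A (1-z)^B] and [u = v^2], the series of [evc] and [odc] in [u] are the [E] and
    [O] of [G(i v) = E(u) + i v O(u)]. *)
Definition evc (A B : R) (i : nat) : R := (-1) ^ i * ecoef A B (2 * i).
Definition odc (A B : R) (i : nat) : R := (-1) ^ i * ecoef A B (S (2 * i)).

(** For [n = 2m] the power of [1 - z^2] is the odd number [2m - 1]; the factor [(m + i) / (2m)]
    converts [C(2m, m-i)] into [C(2m-1, m-i)]. It tends to [1/2], the factor of the odd case. *)
Lemma jacobiP_even_at_0 (a b : R) (m : nat) : (1 <= m)%nat ->
  jacobiP a b (2 * m) 0 = (-1) ^ m * central m *
    rsum (fun i => evc (a + 1) (b + 1) i * (cratio m i * ((INR m + INR i) / (2 * INR m)))) (S m).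
Proof.
intros Hm; rewrite jacobiP_at_0.
assert (Hm1 : 1 <= INR m) by (apply (le_INR 1); easy).
pose proof (iterated_difference
  (fun N m => ecoef (a + 1 + INR N) (b + 1 + INR N) (2 * m))) as Y; cbv beta in Y.
assert (E2 : INR (2 * m) = INR (2 * m - 1) + 1) by (rewrite <- S_INR; f_equal; lia).
replace (INR (2 * m) + a) with (a + 1 + INR (2 * m - 1)) by (rewrite E2; ring).
replace (INR (2 * m) + b) with (b + 1 + INR (2 * m - 1)) by (rewrite E2; ring).
rewrite Y; clear Y.
- rewrite <- !rsum_scal; apply rsum_ext; intros i Hi.
  pose proof (gbinom_upper (INR (2 * m - 1)) (m - i)) as G.
  rewrite <- E2, gbinom_cratio, minus_INR in G by lia.
  assert (E3 : INR (2 * m) = 2 * INR m) by (rewrite mult_INR; simpl; ring).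
  rewrite E3 in G.
  assert (G2 : gbinom (INR (2 * m - 1)) (m - i)
     = (INR m + INR i) * (4 ^ m * central m * cratio m i) / (2 * INR m)).
  { apply (Rmult_eq_reg_l (2 * INR m)); [|lra]; rewrite <- G; field; lra. }
  rewrite G2, pow_m1_sub, pow_mult by lia; simpl (INR 0); rewrite !Rplus_0_r; unfold evc.
  replace ((/ 2) ^ 2) with (/ 4) by field.
  rewrite pow_inv; field; split; [lra|apply pow_nonzero; lra].
- intros N; rewrite !ecoef_0; easy.
- intros N k; replace (2 * S k)%nat with (S (S (2 * k))) by lia.
  rewrite <- ecoef_SS, S_INR; f_equal; ring.
Qed.

Lemma jacobiP_odd_at_0 (a b : R) (m : nat) :
  jacobiP a b (S (2 * m)) 0 = (-1) ^ m * central m *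
    rsum (fun i => odc (a + 1) (b + 1) i * (cratio m i * / 2)) (S m).
Proof.
rewrite jacobiP_at_0.
pose proof (iterated_difference
  (fun N m => ecoef (a + 1 + INR N) (b + 1 + INR N) (S (2 * m)))) as Y; cbv beta in Y.
replace (INR (S (2 * m)) + a) with (a + 1 + INR (2 * m)) by (rewrite S_INR; ring).
replace (INR (S (2 * m)) + b) with (b + 1 + INR (2 * m)) by (rewrite S_INR; ring).
rewrite Y; clear Y.
- rewrite <- !rsum_scal; apply rsum_ext; intros i Hi.
  rewrite gbinom_cratio, pow_m1_sub by lia; simpl (INR 0); rewrite !Rplus_0_r; unfold odc.
  change ((/ 2) ^ S (2 * m)) with (/ 2 * (/ 2) ^ (2 * m)); rewrite pow_mult.
  replace ((/ 2) ^ 2) with (/ 4) by field.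
  rewrite pow_inv; field; apply pow_nonzero; lra.
- intros N; simpl (2 * 0)%nat; rewrite !ecoef_1, S_INR; ring.
- intros N k; replace (2 * S k)%nat with (S (S (2 * k))) by lia.
  rewrite <- ecoef_SS, S_INR; f_equal; ring.
Qed.

(** * Dominated convergence and the limit at the origin *)

Lemma rsum_sum_f_R0 (f : nat -> R) (n : nat) : rsum f (S n) = sum_f_R0 f n.
Proof. induction n as [|n IH]; [simpl; ring|]. simpl in *; rewrite IH; easy. Qed.

Lemma rsum_Rabs_le (f : nat -> R) (n : nat) :
  Rabs (rsum f n) <= rsum (fun k => Rabs (f k)) n.
Proof.
induction n as [|n IH]; simpl; [rewrite Rabs_R0; lra|].
eapply Rle_trans; [apply Rabs_triang|lra].
Qed.

Lemma is_series_rsum (f : nat -> R) (l : R) :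
  is_series f l <-> is_lim_seq (rsum f) l.
Proof.
rewrite (is_lim_seq_incr_1 (rsum f)); unfold is_series, is_lim_seq; simpl.
split; apply filterlim_ext; intros n; rewrite sum_n_Reals, <- rsum_sum_f_R0; easy.
Qed.

Lemma Rabs_mult_le_l (x y : R) : Rabs y <= 1 -> Rabs (x * y) <= Rabs x.
Proof.
intros H; rewrite Rabs_mult.
pose proof (Rabs_pos x); nra.
Qed.

Lemma Series_finite (f : nat -> R) (n : nat) :
  (forall k, (n <= k)%nat -> f k = 0) -> Series f = rsum f n.
Proof.
intros H; apply is_series_unique, is_series_rsum.
apply (is_lim_seq_ext_loc (fun _ => rsum f n)); [|apply is_lim_seq_const].
exists n; intros m Hm; induction Hm as [|m Hm IH]; [easy|].
simpl; rewrite <- IH, H by lia; ring.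
Qed.

Lemma Series_split (f : nat -> R) (n : nat) : ex_series f ->
  Series f = rsum f n + Series (fun k => f (n + k)%nat).
Proof.
intros Hf; induction n as [|n IH]; [simpl; rewrite Rplus_0_l; now apply Series_ext|].
rewrite IH, (Series_incr_1 (fun k => f (n + k)%nat)) by now apply ex_series_incr_n.
simpl rsum; rewrite Nat.add_0_r, Rplus_assoc; do 2 f_equal.
apply Series_ext; intros k; f_equal; lia.
Qed.

Lemma ex_series_nonneg_bounded (f : nat -> R) (B : R) :
  (forall n, 0 <= f n) -> (forall n, rsum f n <= B) -> ex_series f.
Proof.
intros H0 HB; destruct (ex_finite_lim_seq_incr (rsum f) B) as [l Hl]; auto.
- intros n; simpl; pose proof (H0 n); lra.
- exists l; now apply is_series_rsum.
Qed.

Lemma rsum_le_Series (f : nat -> R) (n : nat) :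
  (forall k, 0 <= f k) -> ex_series f -> rsum f n <= Series f.
Proof.
intros H0 Hf; rewrite (Series_split f n Hf).
pose proof (Series_le (fun _ => 0) (fun k => f (n + k)%nat)) as H.
assert (E : Series (fun _ => 0) = 0) by (rewrite (Series_finite _ 0); easy).
rewrite E in H; cut (0 <= Series (fun k => f (n + k)%nat)); [lra|].
apply H; [intros k; split; [lra|apply H0]|now apply ex_series_incr_n].
Qed.

(** Tannery's theorem: cut where the tail of [M] is below [eps / 4]; this controls the tails of
    [f n] and of [l], and a finite sum remains. *)
Lemma Series_dominated_lim (f : nat -> nat -> R) (l M : nat -> R) :
  (forall n k, Rabs (f n k) <= M k) -> ex_series M ->
  (forall k, is_lim_seq (fun n => f n k) (l k)) ->
  is_lim_seq (fun n => Series (f n)) (Series l).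
Proof.
intros HM HS Hl.
assert (HlM : forall k, Rabs (l k) <= M k).
{ intros k; apply (is_lim_seq_le (fun n => Rabs (f n k)) (fun _ => M k) (Rabs (l k)) (M k)).
  - intros n; apply HM.
  - apply (is_lim_seq_abs _ (l k)), Hl.
  - apply is_lim_seq_const. }
assert (Hex : forall g, (forall k, Rabs (g k) <= M k) -> ex_series g).
{ intros g Hg; apply (ex_series_le (K := R_AbsRing) (V := R_CompleteNormedModule) g M Hg HS). }
assert (Htail : forall g K, (forall k, Rabs (g k) <= M k) ->
          Rabs (Series g - rsum g K) <= Series M - rsum M K).
{ intros g K Hg; rewrite (Series_split g K (Hex g Hg)), (Series_split M K HS).
  replace (rsum g K + Series (fun k => g (K + k)%nat) - rsum g K)
    with (Series (fun k => g (K + k)%nat)) by ring.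
  assert (HT : ex_series (fun k => M (K + k)%nat)) by (apply (ex_series_incr_n M K); exact HS).
  eapply Rle_trans; [apply Series_Rabs|].
  - apply (ex_series_le (K := R_AbsRing) (V := R_CompleteNormedModule) _ (fun k => M (K + k)%nat)); [|exact HT].
    intros k; unfold norm; simpl; unfold abs; simpl; rewrite Rabs_Rabsolu; apply Hg.
  - eapply Rle_trans; [apply (Series_le _ (fun k => M (K + k)%nat)); [|exact HT]|lra].
    intros k; split; [apply Rabs_pos|apply Hg]. }
assert (HMK : is_lim_seq (rsum M) (Series M)) by (apply is_series_rsum, Series_correct, HS).
apply is_lim_seq_spec; intros [eps Heps]; simpl.
apply is_lim_seq_spec in HMK; destruct (HMK (mkposreal (eps / 4) ltac:(lra))) as [K HK].
specialize (HK K (le_n K)); simpl in HK.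
assert (HT : Series M - rsum M K < eps / 4).
{ rewrite Rabs_minus_sym in HK; eapply Rle_lt_trans; [apply Rle_abs|exact HK]. }
assert (Hfin : is_lim_seq (fun n => rsum (f n) K) (rsum l K)).
{ clear - Hl; induction K as [|K IH]; simpl; [apply is_lim_seq_const|].
  apply is_lim_seq_plus'; auto. }
apply is_lim_seq_spec in Hfin; destruct (Hfin (mkposreal (eps / 4) ltac:(lra))) as [N HN].
exists N; intros n Hn; specialize (HN n Hn); simpl in HN.
pose proof (Htail (f n) K (HM n)) as T1; pose proof (Htail l K HlM) as T2.
replace (Series (f n) - Series l) with
  ((Series (f n) - rsum (f n) K) + (rsum (f n) K - rsum l K) - (Series l - rsum l K)) by ring.
eapply Rle_lt_trans; [apply Rabs_triang|]; rewrite Rabs_Ropp.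
eapply Rle_lt_trans; [apply Rplus_le_compat_r, Rabs_triang|]; lra.
Qed.

(* For [k > A] the identity [(k + 1) |C(A, k + 1)| = (k - A) |C(A, k)|] makes
   [A |C(A, k)|] telescope. *)
Lemma ex_series_gbinom (A : R) : 0 < A -> ex_series (fun k => Rabs (gbinom A k)).
Proof.
intros HA; destruct (nfloor_ex A) as [m [_ Hm]]; [lra|].
apply (ex_series_incr_n _ (S m)).
set (g := fun k => Rabs (gbinom A (S m + k)%nat)).
apply (ex_series_nonneg_bounded g (INR (S m) * g 0%nat / A)).
- intros n; apply Rabs_pos.
- intros n.
  assert (H : A * rsum g n = INR (S m) * g 0%nat - INR (S m + n) * g n).
  { induction n as [|n IH]; simpl rsum.
    - rewrite Nat.add_0_r; ring.
    - rewrite Rmult_plus_distr_l, IH; unfold g.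
      replace (S m + S n)%nat with (S (S m + n)) by lia.
      pose proof (gbinom_S A (S m + n)) as E; apply (f_equal Rabs) in E.
      rewrite !Rabs_mult, (Rabs_pos_eq (INR _)) in E by apply pos_INR.
      rewrite E, (Rabs_left (A - INR (S m + n))).
      + ring.
      + rewrite plus_INR, S_INR; pose proof (pos_INR n); lra. }
  apply (Rmult_le_reg_l A); [easy|]; rewrite H.
  replace (A * (INR (S m) * g 0%nat / A)) with (INR (S m) * g 0%nat) by (field; lra).
  assert (0 <= INR (S m + n) * g n) by (apply Rmult_le_pos; [apply pos_INR|apply Rabs_pos]).
  lra.
Qed.

(** A Cauchy product of two absolutely summable binomial series. With [A = a + 1] and [B = b + 1],
    positivity is exactly [a, b > -1]. *)
Lemma ex_series_ecoef (A B : R) : 0 < A -> 0 < B ->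
  ex_series (fun j => Rabs (ecoef A B j)).
Proof.
intros HA HB.
assert (Habs : forall D, 0 < D -> ex_series (fun n => Rabs (Rabs (gbinom D n)))).
{ intros D HD; apply (ex_series_ext (fun n => Rabs (gbinom D n))).
  - intros n; now rewrite Rabs_Rabsolu.
  - now apply ex_series_gbinom. }
destruct (ex_series_gbinom A HA) as [la Hla], (ex_series_gbinom B HB) as [lb Hlb].
apply (ex_series_le (K := R_AbsRing) (V := R_CompleteNormedModule) _ (fun n =>
  sum_f_R0 (fun k => Rabs (gbinom B k) * Rabs (gbinom A (n - k)%nat)) n)).
- intros n; unfold norm; simpl; unfold abs; simpl; rewrite Rabs_Rabsolu.
  rewrite <- rsum_sum_f_R0; unfold ecoef.
  eapply Rle_trans; [apply rsum_Rabs_le|]; right; apply rsum_ext; intros k Hk.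
  rewrite !Rabs_mult, pow_1_abs; ring.
- exists (lb * la); apply (is_series_mult (fun k => Rabs (gbinom B k)) (fun k => Rabs (gbinom A k))); auto.
Qed.

Lemma ex_series_evc_odc (A B : R) : 0 < A -> 0 < B ->
  ex_series (fun i => Rabs (evc A B i)) /\ ex_series (fun i => Rabs (odc A B i)).
Proof.
intros HA HB; pose proof (ex_series_ecoef A B HA HB) as HS.
set (g := fun j => Rabs (ecoef A B j)) in *.
assert (Hg : forall k, 0 <= g k) by (intros; apply Rabs_pos).
assert (E1 : forall i, Rabs (evc A B i) = g (2 * i)%nat)
  by (intros; unfold evc, g; rewrite Rabs_mult, pow_1_abs; ring).
assert (E2 : forall i, Rabs (odc A B i) = g (S (2 * i)))
  by (intros; unfold odc, g; rewrite Rabs_mult, pow_1_abs; ring).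
assert (H : forall n, rsum (fun i => Rabs (evc A B i)) n + rsum (fun i => Rabs (odc A B i)) n
                      = rsum g (2 * n)).
{ induction n as [|n IH]; [simpl; ring|].
  replace (2 * S n)%nat with (S (S (2 * n))) by lia; simpl rsum in *.
  rewrite E1, E2; simpl Nat.mul in *; rewrite <- IH; ring. }
assert (Hpos : forall f n, 0 <= rsum (fun i => Rabs (f i)) n).
{ intros f n; induction n as [|n IH]; simpl; [lra|]; pose proof (Rabs_pos (f n)); lra. }
split; apply ex_series_nonneg_bounded with (Series g); try (intros; apply Rabs_pos);
  intros n; pose proof (rsum_le_Series g (2 * n) Hg HS); rewrite <- H in H0.
- pose proof (Hpos (odc A B) n); lra.
- pose proof (Hpos (evc A B) n); lra.
Qed.

(** * The modulus of the generating function at [i], through real power series *)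

Lemma CV_radius_abs_summable (f : nat -> R) (x : R) :
  ex_series (fun n => Rabs (f n)) -> Rabs x < 1 -> Rbar_lt (Rabs x) (CV_radius f).
Proof.
intros Hf Hx; apply Rbar_lt_le_trans with 1; [easy|].
apply (CV_radius_bounded f); exists (Series (fun n => Rabs (f n))); intros n.
rewrite pow1, Rmult_1_r.
apply Rle_trans with (rsum (fun n => Rabs (f n)) (S n)).
- simpl; assert (0 <= rsum (fun k => Rabs (f k)) n); [|lra].
  clear; induction n as [|n IH]; simpl; [lra|]; pose proof (Rabs_pos (f n)); lra.
- apply rsum_le_Series; [intros; apply Rabs_pos|easy].
Qed.

(** At [z = i v], [u = v^2], the differential equation behind [ecoef_rec] splits in two: this is its
    imaginary part, [PSeries_odc_derive] its real part. *)
Lemma PSeries_evc_derive (A B u : R) : 0 < A -> 0 < B -> Rabs u < 1 ->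
  2 * (1 + u) * PSeries (PS_derive (evc A B)) u
  = (A + B) * PSeries (evc A B) u - (A - B) * PSeries (odc A B) u.
Proof.
intros HA HB Hu; destruct (ex_series_evc_odc A B HA HB) as [He Ho].
pose proof (CV_radius_abs_summable _ _ He Hu) as Re.
pose proof (CV_radius_abs_summable _ _ Ho Hu) as Ro.
assert (Xe := CV_radius_inside _ _ Re); assert (Xo := CV_radius_inside _ _ Ro).
assert (Xd : ex_pseries (PS_derive (evc A B)) u)
  by (apply CV_radius_inside; rewrite CV_radius_derive; exact Re).
assert (E : PSeries (PS_plus (PS_scal 2 (PS_derive (evc A B)))
                       (PS_scal 2 (PS_incr_1 (PS_derive (evc A B))))) u
          = PSeries (PS_plus (PS_scal (A + B) (evc A B)) (PS_scal (- (A - B)) (odc A B))) u).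
{ apply PSeries_ext; intros n; unfold PS_plus, PS_scal, plus, scal; simpl; unfold mult; simpl.
  unfold PS_derive, evc, odc.
  pose proof (ecoef_rec A B (2 * n)) as G; rewrite mult_INR in G; simpl (INR 2) in G.
  replace (2 * S n)%nat with (S (S (2 * n))) by lia.
  change (match n with 0%nat => 1 | S _ => INR n + 1 end) with (INR (S n)); rewrite S_INR.
  assert (F : PS_incr_1 (fun k => INR (S k) * ((-1) ^ S k * ecoef A B (2 * S k))) n
              = INR n * ((-1) ^ n * ecoef A B (2 * n))).
  { destruct n as [|n]; unfold PS_incr_1; [unfold zero; simpl; ring|easy]. }
  change (PS_incr_1 (PS_derive (fun i => (-1) ^ i * ecoef A B (2 * i))) n)
    with (PS_incr_1 (fun k => INR (S k) * ((-1) ^ S k * ecoef A B (2 * S k))) n).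
  rewrite F; simpl pow.
  transitivity (- (-1) ^ n * (((1 + 1) * INR n + 2) * ecoef A B (S (S (2 * n))))
     + 2 * (INR n * ((-1) ^ n * ecoef A B (2 * n)))); [ring|rewrite G; ring]. }
assert (Xi := ex_pseries_incr_1 _ _ Xd).
rewrite !PSeries_plus in E by (apply ex_pseries_scal; [apply Rmult_comm|assumption]).
rewrite !PSeries_scal, PSeries_incr_1 in E; lra.
Qed.

Lemma PSeries_odc_derive (A B u : R) : 0 < A -> 0 < B -> Rabs u < 1 ->
  (1 + u) * (PSeries (odc A B) u + 2 * u * PSeries (PS_derive (odc A B)) u)
  = (A + B) * u * PSeries (odc A B) u + (A - B) * PSeries (evc A B) u.
Proof.
intros HA HB Hu; destruct (ex_series_evc_odc A B HA HB) as [He Ho].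
pose proof (CV_radius_abs_summable _ _ He Hu) as Re.
pose proof (CV_radius_abs_summable _ _ Ho Hu) as Ro.
assert (Xe := CV_radius_inside _ _ Re); assert (Xo := CV_radius_inside _ _ Ro).
assert (Xd : ex_pseries (PS_derive (odc A B)) u)
  by (apply CV_radius_inside; rewrite CV_radius_derive; exact Ro).
set (T := PS_plus (odc A B) (PS_scal 2 (PS_incr_1 (PS_derive (odc A B))))).
assert (XT : ex_pseries T u).
{ apply ex_pseries_plus; [exact Xo|]; apply ex_pseries_scal; [apply Rmult_comm|].
  apply ex_pseries_incr_1; exact Xd. }
assert (ET : PSeries T u = PSeries (odc A B) u + 2 * u * PSeries (PS_derive (odc A B)) u).
{ unfold T; rewrite PSeries_plus, PSeries_scal, PSeries_incr_1; [ring|exact Xo|].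
  apply ex_pseries_scal; [apply Rmult_comm|]; apply ex_pseries_incr_1; exact Xd. }
assert (CT : forall n, T n = (2 * INR n + 1) * odc A B n).
{ intros n; unfold T, PS_plus, PS_scal, plus, scal; simpl; unfold mult; simpl.
  destruct n as [|n]; unfold PS_incr_1; [unfold zero; simpl; ring|].
  unfold PS_derive; ring. }
assert (E : PSeries (PS_plus T (PS_incr_1 T)) u
          = PSeries (PS_plus (PS_scal (A + B) (PS_incr_1 (odc A B))) (PS_scal (A - B) (evc A B))) u).
{ apply PSeries_ext; intros n; unfold PS_plus, PS_scal, plus, scal; simpl; unfold mult; simpl.
  destruct n as [|n]; unfold PS_incr_1; rewrite !CT; unfold evc, odc.
  - unfold zero; simpl Nat.mul; simpl; rewrite ecoef_0, ecoef_1; ring.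
  - pose proof (ecoef_rec A B (S (2 * n))) as G; rewrite S_INR, mult_INR in G; simpl (INR 2) in G.
    replace (2 * S n)%nat with (S (S (2 * n))) by lia; rewrite S_INR; simpl pow.
    transitivity (- (-1) ^ n * (((1 + 1) * INR n + 1 + 2) * ecoef A B (S (S (S (2 * n)))))
       + (2 * INR n + 1) * ((-1) ^ n * ecoef A B (S (2 * n)))); [ring|rewrite G; ring]. }
rewrite !PSeries_plus in E.
- rewrite !PSeries_scal, !PSeries_incr_1, ET in E; lra.
- apply ex_pseries_scal; [apply Rmult_comm|]; apply ex_pseries_incr_1; exact Xo.
- apply ex_pseries_scal; [apply Rmult_comm|exact Xe].
- exact XT.
- apply ex_pseries_incr_1; exact XT.
Qed.

(* This is [|(1 + i v)^A (1 - i v)^B|^2 = (1 + v^2)^(A + B)] with [u = v^2]. *)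
Lemma PSeries_evc_odc (A B u : R) : 0 < A -> 0 < B -> 0 <= u < 1 ->
  PSeries (evc A B) u * PSeries (evc A B) u + u * (PSeries (odc A B) u * PSeries (odc A B) u)
  = Rpower (1 + u) (A + B).
Proof.
intros HA HB Hu; destruct (ex_series_evc_odc A B HA HB) as [He Ho].
set (E := PSeries (evc A B)); set (O := PSeries (odc A B)).
set (F := fun v => (E v * E v + v * (O v * O v)) * Rpower (1 + v) (- (A + B))).
assert (HF : forall v, 0 <= v < 1 -> is_derive F v 0).
{ intros v Hv.
  assert (Hv1 : Rabs v < 1) by (rewrite Rabs_pos_eq; lra).
  pose proof (is_derive_PSeries _ _ (CV_radius_abs_summable _ _ He Hv1)) as DE.
  pose proof (is_derive_PSeries _ _ (CV_radius_abs_summable _ _ Ho Hv1)) as DO.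
  fold E in DE; fold O in DO.
  pose proof (PSeries_evc_derive A B v HA HB Hv1) as RE; fold E O in RE.
  pose proof (PSeries_odc_derive A B v HA HB Hv1) as RO; fold E O in RO.
  set (dE := PSeries (PS_derive (evc A B)) v) in *.
  set (dO := PSeries (PS_derive (odc A B)) v) in *.
  assert (ExE : ex_derive E v) by (exists dE; exact DE).
  assert (ExO : ex_derive O v) by (exists dO; exact DO).
  unfold F, Rpower; auto_derive.
  - repeat split; try assumption; lra.
  - assert (EqE : Derive (fun x => E x) v = dE) by (apply is_derive_unique; exact DE).
    assert (EqO : Derive (fun x => O x) v = dO) by (apply is_derive_unique; exact DO).
    rewrite EqE, EqO.
    set (X := exp (- (A + B) * ln (1 + v))).
    apply (Rmult_eq_reg_l (1 + v)); [|lra].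
    transitivity (X * (E v * (2 * (1 + v) * dE) + O v * ((1 + v) * (O v + 2 * v * dO))
       - (A + B) * (E v * E v + v * (O v * O v)))); [field; lra|].
    rewrite RE, RO; ring. }
assert (HFu : F u = F 0).
{ destruct (MVT_gen F 0 u (fun _ => 0)) as [c [_ Hc]].
  - intros x Hx; rewrite Rmin_left, Rmax_right in Hx by lra; apply HF; lra.
  - intros x Hx; rewrite Rmin_left, Rmax_right in Hx by lra.
    apply continuity_pt_filterlim, (ex_derive_continuous (V := R_NormedModule)).
    exists 0; apply HF; lra.
  - lra. }
assert (HF0 : F 0 = 1).
{ unfold F, E, O; rewrite !PSeries_0; unfold evc; simpl Nat.mul; rewrite ecoef_0; simpl pow.
  unfold Rpower; rewrite Rplus_0_r, ln_1, Rmult_0_r, exp_0; ring. }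
rewrite HF0 in HFu; unfold F in HFu; rewrite Rpower_Ropp in HFu.
pose proof (Rpower_pos (1 + u) (A + B)).
apply (Rmult_eq_reg_r (/ Rpower (1 + u) (A + B))).
- rewrite HFu; field; lra.
- apply Rinv_neq_0_compat; lra.
Qed.

(** The point [u = 1] lies outside the range [u < 1] of the previous identity. It is reached as in
    Abel's theorem along [u n = 1 - 1/(n+1)], with the absolutely summable coefficients as
    majorant. *)
Lemma Series_evc_odc (A B : R) : 0 < A -> 0 < B ->
  Series (evc A B) * Series (evc A B) + Series (odc A B) * Series (odc A B) = Rpower 2 (A + B).
Proof.
intros HA HB; destruct (ex_series_evc_odc A B HA HB) as [He Ho].
set (u := fun n : nat => 1 - / (INR n + 1)).
assert (Hu : forall n, 0 <= u n < 1).
{ intros n; unfold u; pose proof (pos_INR n).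
  assert (0 < / (INR n + 1)) by (apply Rinv_0_lt_compat; lra).
  assert (/ (INR n + 1) <= 1) by (rewrite <- Rinv_1; apply Rinv_le_contravar; lra). lra. }
assert (Lu : is_lim_seq u 1).
{ unfold u; replace (Finite 1) with (Finite (1 - 0)) by (f_equal; ring).
  apply is_lim_seq_minus'; [apply is_lim_seq_const|].
  apply (is_lim_seq_ext (fun n => / INR (S n))); [intros n; now rewrite S_INR|].
  apply (is_lim_seq_incr_1 (fun n => / INR n)).
  replace (Finite 0) with (Rbar_inv p_infty) by easy.
  apply is_lim_seq_inv; [apply is_lim_seq_INR|easy]. }
assert (Lp : forall k, is_lim_seq (fun n => u n ^ k) 1).
{ induction k as [|k IH]; simpl; [apply is_lim_seq_const|].
  replace (Finite 1) with (Finite (1 * 1)) by (f_equal; ring); now apply is_lim_seq_mult'. }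
assert (L : forall f, ex_series (fun n => Rabs (f n)) ->
          is_lim_seq (fun n => PSeries f (u n)) (Series f)).
{ intros f Hf; unfold PSeries; apply Series_dominated_lim with (M := fun k => Rabs (f k)); [|exact Hf|].
  - intros n k; apply Rabs_mult_le_l.
    rewrite <- RPow_abs, <- (pow1 k); apply pow_incr; split; [apply Rabs_pos|].
    rewrite Rabs_pos_eq; [apply Rlt_le|]; apply Hu.
  - intros k; replace (Finite (f k)) with (Finite (f k * 1)) by (f_equal; ring).
    apply is_lim_seq_mult'; [apply is_lim_seq_const|apply Lp]. }
pose proof (L _ He) as L1; pose proof (L _ Ho) as L2.
assert (L3 := is_lim_seq_plus' _ _ _ _ (is_lim_seq_mult' _ _ _ _ L1 L1)
  (is_lim_seq_mult' _ _ _ _ Lu (is_lim_seq_mult' _ _ _ _ L2 L2))).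
assert (L4 : is_lim_seq (fun n => Rpower (1 + u n) (A + B)) (Rpower (1 + 1) (A + B))).
{ apply (is_lim_seq_continuous (fun v => Rpower (1 + v) (A + B)) u 1); [|exact Lu].
  apply (continuity_pt_filterlim (fun v => Rpower (1 + v) (A + B)) 1), (ex_derive_continuous (V := R_NormedModule) (fun v => Rpower (1 + v) (A + B))).
  unfold Rpower; auto_derive; lra. }
assert (L5 : is_lim_seq (fun n => Rpower (1 + u n) (A + B))
   (Series (evc A B) * Series (evc A B) + 1 * (Series (odc A B) * Series (odc A B)))).
{ eapply is_lim_seq_ext; [|exact L3]; intros n; simpl; now apply PSeries_evc_odc. }
apply is_lim_seq_unique in L4; apply is_lim_seq_unique in L5; rewrite L4 in L5.
injection L5; replace (1 + 1) with 2 by ring; lra.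
Qed.

(** The limits are the squared real and imaginary parts of [G(i)] over [4 PI]: [1 / PI] from
    [central_lim] and [1/4] from the factors [1/2]. Squaring removes the sign [(-1)^m]. *)
Lemma jacobiP_at_0_sq_lim (a b : R) : -1 < a -> -1 < b ->
  exists l0 l1 : R,
    is_lim_seq (fun m => INR m * jacobiP a b (2 * m) 0 ^ 2) l0 /\
    is_lim_seq (fun m => INR m * jacobiP a b (S (2 * m)) 0 ^ 2) l1 /\
    l0 + l1 = Rpower 2 (a + b) / PI.
Proof.
intros ha hb; set (A := a + 1); set (B := b + 1).
destruct (ex_series_evc_odc A B) as [He Ho]; [unfold A; lra|unfold B; lra|].
set (fe := fun m i => evc A B i * (cratio m i * ((INR m + INR i) / (2 * INR m)))).
set (fo := fun m i => odc A B i * (cratio m i * / 2)).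
assert (Le : is_lim_seq (fun m => Series (fe m)) (Series (fun i => evc A B i * (1 * (1 / 2))))).
(* The shift makes the denominator [2 INR m] positive in the domination bound. *)
{ apply is_lim_seq_incr_1.
  apply Series_dominated_lim with (M := fun i => Rabs (evc A B i)); [|exact He|].
  - intros m i; unfold fe; apply Rabs_mult_le_l.
    destruct (Nat.le_gt_cases i (S m)) as [H|H].
    + pose proof (cratio_bound (S m) i); pose proof (pos_INR i); apply le_INR in H.
      assert (0 < INR (S m)) by (apply lt_0_INR; lia).
      assert (0 <= (INR (S m) + INR i) / (2 * INR (S m)) <= 1).
      { split; [apply Rmult_le_pos; [lra|apply Rlt_le, Rinv_0_lt_compat; lra]|].
        apply (Rmult_le_reg_r (2 * INR (S m))); [lra|].
        unfold Rdiv; rewrite Rmult_assoc, Rinv_l by lra; lra. }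
      rewrite Rabs_pos_eq; nra.
    + rewrite cratio_zero, Rmult_0_l, Rabs_R0 by easy; lra.
  - intros i; apply (is_lim_seq_incr_1 (fun m => fe m i)); unfold fe.
    apply is_lim_seq_mult'; [apply is_lim_seq_const|].
    apply is_lim_seq_mult'; [apply cratio_lim|].
    apply (is_lim_seq_ext_loc (fun m => ((INR m + INR i) / INR m) / 2)).
    + exists 1%nat; intros m Hm; apply (le_INR 1) in Hm; simpl in Hm; field; lra.
    + apply is_lim_seq_div'; [apply is_lim_seq_INR_shift_ratio|apply is_lim_seq_const|lra]. }
assert (Lo : is_lim_seq (fun m => Series (fo m)) (Series (fun i => odc A B i * (1 * / 2)))).
{ apply Series_dominated_lim with (M := fun i => Rabs (odc A B i)); [|exact Ho|].
  - intros m i; unfold fo; apply Rabs_mult_le_l.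
    pose proof (cratio_bound m i); rewrite Rabs_pos_eq; nra.
  - intros i; unfold fo.
    apply is_lim_seq_mult'; [apply is_lim_seq_const|].
    apply is_lim_seq_mult'; [apply cratio_lim|apply is_lim_seq_const]. }
rewrite (Series_ext _ (fun i => / 2 * evc A B i)) in Le by (intros; field).
rewrite (Series_ext _ (fun i => / 2 * odc A B i)) in Lo by (intros; field).
rewrite Series_scal_l in Le, Lo.
pose proof PI_RGT_0.
assert (Hsq : forall m, (-1) ^ m * (-1) ^ m = 1).
{ intros m; rewrite <- Rpow_mult_distr; replace (-1 * -1) with 1 by ring; apply pow1. }
exists (/ PI * (/ 2 * Series (evc A B) * (/ 2 * Series (evc A B)))).
exists (/ PI * (/ 2 * Series (odc A B) * (/ 2 * Series (odc A B)))).
split; [|split].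
- eapply is_lim_seq_ext_loc; [|exact (is_lim_seq_mult' _ _ _ _ central_lim (is_lim_seq_mult' _ _ _ _ Le Le))].
  exists 1%nat; intros m Hm; cbv beta.
  rewrite jacobiP_even_at_0 by easy; fold A B.
  change (rsum (fun i => evc A B i * _) (S m)) with (rsum (fe m) (S m)).
  rewrite <- (Series_finite (fe m) (S m)).
  + transitivity (INR m * (central m * central m) * ((-1) ^ m * (-1) ^ m)
      * (Series (fe m) * Series (fe m))); [rewrite Hsq|]; ring.
  + intros k Hk; unfold fe; rewrite cratio_zero by lia; ring.
- eapply is_lim_seq_ext; [|exact (is_lim_seq_mult' _ _ _ _ central_lim (is_lim_seq_mult' _ _ _ _ Lo Lo))].
  intros m; cbv beta; rewrite jacobiP_odd_at_0; fold A B.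
  change (rsum (fun i => odc A B i * _) (S m)) with (rsum (fo m) (S m)).
  rewrite <- (Series_finite (fo m) (S m)).
  + transitivity (INR m * (central m * central m) * ((-1) ^ m * (-1) ^ m)
      * (Series (fo m) * Series (fo m))); [rewrite Hsq|]; ring.
  + intros k Hk; unfold fo; rewrite cratio_zero by lia; ring.
- transitivity (/ PI * / 4 * Rpower 2 (A + B)).
  + rewrite <- Series_evc_odc by (unfold A, B; lra); field; lra.
  + replace (A + B) with (a + b + 1 + 1) by (unfold A, B; ring).
    rewrite (Rpower_plus (a + b + 1) 1 2), (Rpower_plus (a + b) 1 2), Rpower_1 by lra; field; lra.
Qed.

(** * Rate of convergence of the energy *)

Definition bigO (k : nat) (u : nat -> R) : Prop :=
  exists (C : R) (n0 : nat), forall n, (n0 <= n)%nat -> Rabs (u n) <= C / INR n ^ k.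

Lemma bigO_ext (k : nat) (u v : nat -> R) (m : nat) :
  (forall n, (m <= n)%nat -> u n = v n) -> bigO k u -> bigO k v.
Proof.
intros E [C [n0 H]]; exists C, (max n0 m); intros n Hn.
rewrite <- E by lia; apply H; lia.
Qed.

Lemma bigO_const (c : R) : bigO 0 (fun _ => c).
Proof. exists (Rabs c), 0%nat; intros n _; simpl; right; field. Qed.

Lemma bigO_plus (k : nat) (u v : nat -> R) :
  bigO k u -> bigO k v -> bigO k (fun n => u n + v n).
Proof.
intros [C [n0 H]] [C' [n0' H']]; exists (C + C'), (max n0 n0'); intros n Hn.
eapply Rle_trans; [apply Rabs_triang|].
unfold Rdiv; rewrite Rmult_plus_distr_r; apply Rplus_le_compat; [apply H|apply H']; lia.
Qed.

Lemma bigO_mult (k l : nat) (u v : nat -> R) :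
  bigO k u -> bigO l v -> bigO (k + l) (fun n => u n * v n).
Proof.
intros [C [n0 H]] [C' [n0' H']]; exists (C * C'), (max (max n0 n0') 1); intros n Hn.
assert (Hn0 : 0 < INR n) by (apply lt_0_INR; lia).
rewrite Rabs_mult, pow_add.
replace (C * C' / (INR n ^ k * INR n ^ l)) with ((C / INR n ^ k) * (C' / INR n ^ l))
  by (field; split; apply pow_nonzero; lra).
apply Rmult_le_compat; try apply Rabs_pos; [apply H|apply H']; lia.
Qed.

Lemma bigO_scal (k : nat) (c : R) (u : nat -> R) : bigO k u -> bigO k (fun n => c * u n).
Proof. intros H; exact (bigO_mult 0 k _ _ (bigO_const c) H). Qed.

Lemma bigO_abs (k : nat) (u : nat -> R) : bigO k u -> bigO k (fun n => Rabs (u n)).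
Proof.
intros [C [n0 H]]; exists C, n0; intros n Hn; rewrite Rabs_Rabsolu; now apply H.
Qed.

Lemma bigO_weaken (k l : nat) (u : nat -> R) : bigO (k + l) u -> bigO k u.
Proof.
intros [C [n0 H]]; exists C, (max n0 1); intros n Hn.
assert (Hn1 : 1 <= INR n) by (apply (le_INR 1); lia).
specialize (H n ltac:(lia)); rewrite pow_add in H.
assert (Hk : 0 < INR n ^ k) by (apply pow_lt; lra).
assert (Hl : 1 <= INR n ^ l) by (apply pow_R1_Rle; easy).
assert (HC : 0 <= C).
{ apply (Rmult_le_reg_r (/ (INR n ^ k * INR n ^ l))); [apply Rinv_0_lt_compat; nra|].
  rewrite Rmult_0_l; eapply Rle_trans; [apply Rabs_pos|exact H]. }
eapply Rle_trans; [exact H|]; apply Rmult_le_compat_l; [easy|].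
apply Rinv_le_contravar; [easy|nra].
Qed.

Lemma bigO_inv_shift (c : R) : bigO 1 (fun n => / (INR n + c)).
Proof.
destruct (nfloor_ex (2 * Rabs c)) as [m [_ Hm]]; [pose proof (Rabs_pos c); lra|].
(* For [n >= 2 |c|] one has [n + c >= n / 2], hence the constant 2. *)
exists 2, (S m); intros n Hn; apply le_INR in Hn; rewrite S_INR in Hn.
pose proof (Rle_abs (- c)) as H; rewrite Rabs_Ropp in H; pose proof (pos_INR m).
rewrite Rabs_pos_eq by (apply Rlt_le, Rinv_0_lt_compat; lra).
simpl pow; rewrite Rmult_1_r.
apply (Rmult_le_reg_l (INR n + c)); [lra|]; rewrite Rinv_r by lra.
apply (Rmult_le_reg_r (INR n)); [lra|].
replace ((INR n + c) * (2 / INR n) * INR n) with (2 * (INR n + c)) by (field; lra); lra.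
Qed.

Lemma INR_shift_pos (c : R) : exists n0, forall n, (n0 <= n)%nat -> 0 < INR n + c.
Proof.
destruct (nfloor_ex (Rabs c)) as [m [_ Hm]]; [apply Rabs_pos|].
exists (S m); intros n Hn; apply le_INR in Hn; rewrite S_INR in Hn.
pose proof (Rle_abs (- c)) as H; rewrite Rabs_Ropp in H; pose proof (pos_INR m); lra.
Qed.

Definition near1 (k : nat) (u : nat -> R) : Prop := bigO k (fun n => u n - 1).

Lemma near1_mult (k : nat) (u v : nat -> R) :
  near1 k u -> near1 k v -> near1 k (fun n => u n * v n).
Proof.
intros Hu Hv; unfold near1.
apply (bigO_ext k (fun n => (u n - 1) * (v n - 1) + ((u n - 1) + (v n - 1))) _ 0);
  [intros; ring|].
apply bigO_plus; [|now apply bigO_plus].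
apply (bigO_weaken k k), bigO_mult; easy.
Qed.

Lemma near1_bounded (k : nat) (u : nat -> R) : near1 k u -> bigO 0 u.
Proof.
intros Hu; apply (bigO_ext 0 (fun n => (u n - 1) + 1) _ 0); [intros; ring|].
apply bigO_plus; [now apply (bigO_weaken 0 k)|apply bigO_const].
Qed.

Lemma near1_ratio (p q : R) : near1 1 (fun n => (INR n + p) / (INR n + q)).
Proof.
destruct (INR_shift_pos q) as [m Hm].
apply (bigO_ext 1 (fun n => (p - q) * / (INR n + q)) _ m).
- intros n Hn; specialize (Hm n Hn); field; lra.
- apply bigO_scal, bigO_inv_shift.
Qed.

(** Equal sums cancel the terms linear in [n]: numerator minus denominator is the constant
    [p q - r s], which gains one order over [near1_ratio]. *)
Lemma near1_ratio2 (p q r s : R) : p + q = r + s ->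
  near1 2 (fun n => (INR n + p) * (INR n + q) / ((INR n + r) * (INR n + s))).
Proof.
intros E; destruct (INR_shift_pos r) as [m Hm], (INR_shift_pos s) as [m' Hm'].
apply (bigO_ext 2 (fun n => (p * q - r * s) * (/ (INR n + r) * / (INR n + s))) _ (max m m')).
- intros n Hn; specialize (Hm n ltac:(lia)); specialize (Hm' n ltac:(lia)).
  replace p with (r + s - q) by lra; field; lra.
- apply bigO_scal; apply (bigO_mult 1 1); apply bigO_inv_shift.
Qed.

(** * Asymptotics of norm quotients and recurrence coefficients *)

Lemma jacobi_h_ratio (a b : R) (n : nat) : -1 < a -> -1 < b -> (1 <= n)%nat ->
  jacobi_h a b n = jacobi_h a b (S n) *
    ((INR n + 1) / (INR n + (a + 1)) * ((INR n + (a + b + 1)) / (INR n + (b + 1)))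
     * ((INR n + (a + b + 3) / 2) / (INR n + (a + b + 1) / 2))).
Proof.
intros ha hb Hn; destruct n as [|n]; [lia|].
pose proof (jacobi_h_S a b n ha hb) as E; unfold recA, recC in E; rewrite (S_INR (S n)) in E.
assert (Hk : 1 <= INR (S n)) by (rewrite S_INR; pose proof (pos_INR n); lra).
set (k := INR (S n)) in *.
set (h1 := jacobi_h a b (S (S n))) in *; set (h0 := jacobi_h a b (S n)) in *.
apply (Rmult_eq_reg_l ((k + 1 + a) * (k + 1 + b) * (2 * (k + 1) + a + b + 2)
  / ((k + 1 + 1) * (k + 1 + a + b + 1) * (2 * (k + 1) + a + b)) *
  ((2 * k + a + b + 1) * (2 * k + a + b + 2) / (2 * (k + 1) * (k + a + b + 1))))).
- rewrite <- E; field; repeat split; lra.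
- apply Rgt_not_eq; repeat apply Rmult_lt_0_compat; try lra; apply Rinv_0_lt_compat;
    repeat apply Rmult_lt_0_compat; lra.
Qed.

Lemma jacobi_h_ratio_near1 (a b : R) : -1 < a -> -1 < b ->
  near1 1 (fun n => jacobi_h a b n / jacobi_h a b (S n)).
Proof.
intros ha hb.
apply (bigO_ext 1 (fun n => (INR n + 1) / (INR n + (a + 1))
     * ((INR n + (a + b + 1)) / (INR n + (b + 1)))
     * ((INR n + (a + b + 3) / 2) / (INR n + (a + b + 1) / 2)) - 1) _ 1).
- intros n Hn; rewrite (jacobi_h_ratio a b n ha hb Hn).
  pose proof (jacobi_h_pos a b n ha hb).
  match goal with |- ?q - 1 = _ => set (Q := q) end; field; lra.
- repeat (apply near1_ratio || apply near1_mult).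
Qed.

Lemma bigO_incr (k : nat) (u : nat -> R) : bigO k u -> bigO k (fun n => u (S n)).
Proof.
intros [C [n0 H]]; exists C, (max n0 1); intros n Hn.
assert (Hn0 : 0 < INR n) by (apply lt_0_INR; lia).
specialize (H (S n) ltac:(lia)).
assert (HC : 0 <= C).
{ apply (Rmult_le_reg_r (/ INR (S n) ^ k)).
  - apply Rinv_0_lt_compat, pow_lt, lt_0_INR; lia.
  - rewrite Rmult_0_l; eapply Rle_trans; [apply Rabs_pos|exact H]. }
eapply Rle_trans; [exact H|]; apply Rmult_le_compat_l; [easy|].
apply Rinv_le_contravar; [now apply pow_lt|].
apply pow_incr; split; [lra|]; apply le_INR; lia.
Qed.

Lemma recB_bigO (a b : R) : -1 < a -> -1 < b -> bigO 2 (fun n => recB a b (INR n)).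
Proof.
intros ha hb.
apply (bigO_ext 2 (fun n => (a * a - b * b) / 2 *
   ((INR n + (a + b + 1) / 2) / (INR n + (a + b) / 2) * (/ (INR n + 1) * / (INR n + (a + b + 1))))) _ 1).
- intros n Hn; apply (le_INR 1) in Hn; simpl in Hn; unfold recB; field; lra.
- apply bigO_scal; apply (bigO_mult 0 2); [apply (near1_bounded 1), near1_ratio|].
  apply (bigO_mult 1 1); apply bigO_inv_shift.
Qed.

Lemma recC_near1 (a b : R) : -1 < a -> -1 < b -> near1 1 (fun n => recC a b (INR n)).
Proof.
intros ha hb.
apply (bigO_ext 1 (fun n => (INR n + a) / (INR n + 1) * ((INR n + b) / (INR n + (a + b + 1)))
   * ((INR n + (a + b + 2) / 2) / (INR n + (a + b) / 2)) - 1) _ 1).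
- intros n Hn; apply (le_INR 1) in Hn; simpl in Hn; unfold recC; field; lra.
- repeat (apply near1_ratio || apply near1_mult).
Qed.

Lemma recA_inv_near1 (a b : R) : -1 < a -> -1 < b -> near1 1 (fun n => 2 / recA a b (INR n)).
Proof.
intros ha hb.
apply (bigO_ext 1 (fun n => (INR n + 1) / (INR n + (a + b + 1) / 2)
   * ((INR n + (a + b + 1)) / (INR n + (a + b + 2) / 2)) - 1) _ 1).
- intros n Hn; apply (le_INR 1) in Hn; simpl in Hn; unfold recA; field; lra.
- repeat (apply near1_ratio || apply near1_mult).
Qed.

(** The cancellation on which the rate rests: the linear factors are grouped in pairs of equal sums.
    An error [O(1/n)] here would give increments of the energy that need not be summable. *)
Lemma recC_sq_h_near1 (a b : R) : -1 < a -> -1 < b ->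
  near1 2 (fun n => recC a b (INR (S n)) ^ 2 * (jacobi_h a b n / jacobi_h a b (S (S n)))).
Proof.
intros ha hb; set (c := a + b).
apply (bigO_ext 2 (fun n =>
   (INR n + (a + 1)) * (INR n + (c + 4) / 2) / ((INR n + (a + 2)) * (INR n + (c + 2) / 2))
   * ((INR n + (b + 1)) * (INR n + (c + 4) / 2) / ((INR n + (b + 2)) * (INR n + (c + 2) / 2)))
   * ((INR n + 1) * (INR n + (c + 5) / 2) / ((INR n + 2) * (INR n + (c + 3) / 2)))
   * ((INR n + (c + 1)) * (INR n + (c + 3) / 2) / ((INR n + (c + 2)) * (INR n + (c + 1) / 2))) - 1) _ 1).
- intros n Hn.
  rewrite (jacobi_h_ratio a b n ha hb Hn), (jacobi_h_ratio a b (S n) ha hb) by lia.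
  pose proof (jacobi_h_pos a b (S n) ha hb); rewrite S_INR.
  apply (le_INR 1) in Hn; simpl in Hn; unfold recC, c; field; lra.
- repeat (apply near1_ratio2 || apply near1_mult); field.
Qed.

(** The square [p_n(0)^2] for the orthonormal polynomial. *)
Definition qsq (a b : R) (n : nat) : R := jacobiP a b n 0 ^ 2 / jacobi_h a b n.

Lemma qsq_pos (a b : R) (n : nat) : -1 < a -> -1 < b -> (1 <= n)%nat -> 0 <= qsq a b n.
Proof.
intros ha hb Hn; destruct n as [|n]; [lia|].
apply Rmult_le_pos; [apply pow2_ge_0|]; apply Rlt_le, Rinv_0_lt_compat, jacobi_h_pos; easy.
Qed.

(** At [x = 0] the recurrence reads [P_(n+2) = B P_(n+1) - C P_n]. After squaring, [C^2] with its
    norm quotient is [1 + O(1/n^2)], and every other term carries a factor [B = O(1/n^2)]. The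
    difference bounded is also that of two consecutive energies. *)
Lemma qsq_step (a b : R) : -1 < a -> -1 < b ->
  exists (D : R) (n0 : nat), forall n, (n0 <= n)%nat ->
    Rabs (qsq a b (S (S n)) - qsq a b n) <= D / INR n ^ 2 * (qsq a b n + qsq a b (S n)).
Proof.
intros ha hb.
(* [x] and [y] change the norms of [qsq n] and [qsq (n+1)] into that of degree [n + 2]. *)
set (x := fun n => jacobi_h a b n / jacobi_h a b (S (S n))).
set (y := fun n => jacobi_h a b (S n) / jacobi_h a b (S (S n))).
set (B := fun n : nat => recB a b (INR (S n))); set (C := fun n : nat => recC a b (INR (S n))).
assert (Hy : bigO 0 y).
{ apply (near1_bounded 1), (bigO_incr 1 (fun n => jacobi_h a b n / jacobi_h a b (S n) - 1)).
  now apply jacobi_h_ratio_near1. }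
assert (Hx : bigO 0 x).
{ apply (bigO_ext 0 (fun n => jacobi_h a b n / jacobi_h a b (S n) * y n) _ 1).
  - intros n Hn; unfold x, y; pose proof (jacobi_h_pos a b n ha hb).
    pose proof (jacobi_h_pos a b (S n) ha hb); field; lra.
  - apply (bigO_mult 0 0); [|exact Hy]; apply (near1_bounded 1), jacobi_h_ratio_near1; easy. }
assert (HB : bigO 2 B) by (apply (bigO_incr 2 (fun n => recB a b (INR n))), recB_bigO; easy).
assert (HC : bigO 0 C).
{ apply (bigO_incr 0 (fun n => recC a b (INR n))), (near1_bounded 1), recC_near1; easy. }
assert (HBC : bigO 2 (fun n => B n * C n)) by (apply (bigO_mult 2 0); easy).
assert (HV : bigO 2 (fun n => Rabs (C n ^ 2 * x n - 1) +
   (Rabs (B n * B n * y n) + (Rabs (B n * C n * x n) + Rabs (B n * C n * y n))))).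
{ repeat apply bigO_plus; apply bigO_abs.
  - apply recC_sq_h_near1; easy.
  - apply (bigO_mult 2 0); [|easy]; apply (bigO_weaken 2 2), (bigO_mult 2 2); easy.
  - apply (bigO_mult 2 0); easy.
  - apply (bigO_mult 2 0); easy. }
destruct HV as [D [n0 HD]]; exists D, (max n0 1); intros n Hn.
pose proof (Rle_trans _ _ _ (Rle_abs _) (HD n ltac:(lia))) as HV; clear HD; cbv beta in HV.
destruct n as [|n]; [lia|].
pose proof (qsq_pos a b (S n) ha hb ltac:(lia)) as P0.
pose proof (qsq_pos a b (S (S n)) ha hb ltac:(lia)) as P1.
eapply Rle_trans; [|apply Rmult_le_compat_r; [lra|exact HV]]; clear HV.
pose proof (jacobi_h_pos a b n ha hb) as h0; pose proof (jacobi_h_pos a b (S n) ha hb) as h1.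
pose proof (jacobi_h_pos a b (S (S n)) ha hb) as h2.
(* The inequality [2 |p0 p1| <= p0^2 + p1^2], kept as an equality with a factor [th] so that the
   square can be expanded exactly; [th = 0] serves when both values vanish. *)
assert (Hcross : exists th, -1 <= th <= 1 /\
   2 * (jacobiP a b (S n) 0 * jacobiP a b (S (S n)) 0) / jacobi_h a b (S (S (S n)))
   = th * (x (S n) * qsq a b (S n) + y (S n) * qsq a b (S (S n)))).
{ set (p0 := jacobiP a b (S n) 0); set (p1 := jacobiP a b (S (S n)) 0).
  destruct (Req_dec (p0 * p0 + p1 * p1) 0) as [Z|Z].
  - exists 0; split; [lra|].
    assert (p0 = 0) by nra; rewrite H; unfold Rdiv; ring.
  - exists (2 * (p0 * p1) / (p0 * p0 + p1 * p1)); split.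
    + pose proof (Rle_0_sqr (p0 + p1)) as Q1; pose proof (Rle_0_sqr (p0 - p1)) as Q2.
      pose proof (Rle_0_sqr p0) as Q3; pose proof (Rle_0_sqr p1) as Q4; unfold Rsqr in *.
      assert (0 < p0 * p0 + p1 * p1) by lra.
      split; apply (Rmult_le_reg_r (p0 * p0 + p1 * p1)); try easy;
        unfold Rdiv; rewrite Rmult_assoc, Rinv_l by lra; nra.
    + unfold x, y, qsq; fold p0 p1; field; lra. }
destruct Hcross as [th [Hth Eth]].
assert (E : qsq a b (S (S (S n))) - qsq a b (S n)
   = (C (S n) ^ 2 * x (S n) - 1) * qsq a b (S n)
     + (B (S n) * B (S n) * y (S n)) * qsq a b (S (S n))
     - th * ((B (S n) * C (S n) * x (S n)) * qsq a b (S n)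
             + (B (S n) * C (S n) * y (S n)) * qsq a b (S (S n)))).
{ transitivity ((C (S n) ^ 2 * x (S n) - 1) * qsq a b (S n)
     + (B (S n) * B (S n) * y (S n)) * qsq a b (S (S n))
     - B (S n) * C (S n) * (th * (x (S n) * qsq a b (S n) + y (S n) * qsq a b (S (S n))))); [|ring].
  rewrite <- Eth; unfold qsq at 1; rewrite (jacobiP_rec a b (S n) 0 ha hb).
  fold (B (S n)) (C (S n)); unfold x, y, qsq; field; lra. }
rewrite E; clear E Eth.
set (q0 := qsq a b (S n)) in *; set (q1 := qsq a b (S (S n))) in *.
set (z1 := C (S n) ^ 2 * x (S n) - 1); set (z2 := B (S n) * B (S n) * y (S n)).
set (z3 := B (S n) * C (S n) * x (S n)); set (z4 := B (S n) * C (S n) * y (S n)).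
assert (Hth1 : Rabs th <= 1) by (apply Rabs_le; lra).
assert (T : Rabs (z1 * q0 + z2 * q1 - th * (z3 * q0 + z4 * q1))
   <= Rabs z1 * q0 + Rabs z2 * q1 + (Rabs z3 * q0 + Rabs z4 * q1)).
{ assert (M : forall z q, 0 <= q -> Rabs (z * q) = Rabs z * q)
    by (intros; rewrite Rabs_mult, (Rabs_pos_eq q); easy).
  eapply Rle_trans; [apply Rabs_triang|]; rewrite Rabs_Ropp, Rabs_mult.
  pose proof (Rabs_triang (z1 * q0) (z2 * q1)); pose proof (Rabs_triang (z3 * q0) (z4 * q1)).
  rewrite !M in * by easy; pose proof (Rabs_pos (z3 * q0 + z4 * q1)).
  pose proof (Rabs_pos th); nra. }
pose proof (Rabs_pos z1); pose proof (Rabs_pos z2); pose proof (Rabs_pos z3); pose proof (Rabs_pos z4).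
eapply Rle_trans; [exact T|]; nra.
Qed.

(** The increment bound is relative to [E n], so [E] is first shown to be bounded: by convergence at
    even indices, and by one step from there at odd ones. Then the increments are [O(1/n^2)] and
    their tails telescope. *)
Lemma energy_rate (E : nat -> R) (L D : R) (n0 : nat) :
  (forall n, (n0 <= n)%nat -> 0 <= E n) ->
  (forall n, (n0 <= n)%nat -> Rabs (E (S n) - E n) <= D / INR n ^ 2 * E n) ->
  is_lim_seq (fun m => E (2 * m)%nat) L ->
  bigO 1 (fun n => E n - L).
Proof.
intros Hpos Hstep Hlim.
assert (HM : exists M n1, (n0 <= n1)%nat /\ (2 <= n1)%nat /\
   forall n, (n1 <= n)%nat -> Rabs (E (S n) - E n) <= M / INR n ^ 2).
{ pose proof Hlim as HL; apply is_lim_seq_spec in HL.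
  destruct (HL (mkposreal 1 Rlt_0_1)) as [m0 Hm0]; simpl in Hm0.
  set (K := Rabs L + 1).
  assert (HK : forall m, (m0 <= m)%nat -> E (2 * m)%nat <= K).
  { intros m Hm; specialize (Hm0 m Hm); apply Rabs_def2 in Hm0.
    pose proof (Rle_abs L); simpl Nat.mul; unfold K; lra. }
  set (D' := Rmax D 0).
  assert (HD' : 0 <= D') by apply Rmax_r; assert (HDD : D <= D') by apply Rmax_l.
  assert (HK0 : 0 < K) by (unfold K; pose proof (Rabs_pos L); lra).
  assert (HE : forall n, (2 * m0 + n0 + 2 <= n)%nat -> E n <= (1 + D') * K).
  { intros n Hn; destruct (Nat.Even_or_Odd n) as [[m Em]|[m Em]].
    - rewrite Em; eapply Rle_trans; [apply HK; lia|]; nra.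
    - pose proof (Hstep (2 * m)%nat ltac:(lia)) as S1.
      pose proof (HK m ltac:(lia)) as S2; pose proof (Hpos (2 * m)%nat ltac:(lia)) as S3.
      replace (S (2 * m)) with n in S1 by lia.
      assert (Hn1 : 1 <= INR (2 * m) ^ 2) by (apply pow_R1_Rle, (le_INR 1); lia).
      assert (S4 : D / INR (2 * m) ^ 2 <= D').
      { apply (Rmult_le_reg_r (INR (2 * m) ^ 2)); [lra|].
        unfold Rdiv; rewrite Rmult_assoc, Rinv_l by lra; nra. }
      apply Rabs_le_between in S1; nra. }
  exists (D' * ((1 + D') * K)), (2 * m0 + n0 + 2)%nat; repeat split; try lia.
  intros n Hn; eapply Rle_trans; [apply Hstep; lia|].
  assert (Hn1 : 0 < / INR n ^ 2) by (apply Rinv_0_lt_compat, pow_lt, lt_0_INR; lia).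
  pose proof (HE n Hn); pose proof (Hpos n ltac:(lia)); unfold Rdiv.
  replace (D' * ((1 + D') * K) * / INR n ^ 2) with (/ INR n ^ 2 * (D' * ((1 + D') * K))) by ring.
  rewrite (Rmult_comm D), Rmult_assoc; apply Rmult_le_compat_l; nra. }
destruct HM as [M [n1 [Hn01 [Hn1 HM]]]].
assert (HM0 : 0 <= M).
{ specialize (HM n1 (le_n _)).
  assert (0 < INR n1 ^ 2) by (apply pow_lt, lt_0_INR; lia).
  apply (Rmult_le_reg_r (/ INR n1 ^ 2)); [now apply Rinv_0_lt_compat|].
  rewrite Rmult_0_l; eapply Rle_trans; [apply Rabs_pos|exact HM]. }
(* Uses [1/k^2 <= 1/(k-1) - 1/k]; [n1 >= 2] keeps [INR n - 1] positive. *)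
assert (Htel : forall n j, (n1 <= n)%nat ->
   Rabs (E (n + j)%nat - E n) <= M * (/ (INR n - 1) - / (INR (n + j) - 1))).
{ intros n j Hn; induction j as [|j IH].
  - rewrite Nat.add_0_r, !Rminus_diag, Rabs_R0; lra.
  - replace (n + S j)%nat with (S (n + j)) by lia.
    replace (E (S (n + j)) - E n) with ((E (S (n + j)) - E (n + j)%nat) + (E (n + j)%nat - E n)) by ring.
    eapply Rle_trans; [apply Rabs_triang|].
    specialize (HM (n + j)%nat ltac:(lia)).
    assert (Hk : 2 <= INR (n + j)) by (apply (le_INR 2); lia).
    rewrite S_INR; set (k := INR (n + j)) in *.
    assert (M / k ^ 2 <= M * (/ (k - 1) - / (k + 1 - 1))).
    { apply Rmult_le_compat_l; [easy|].
      replace (/ (k - 1) - / (k + 1 - 1)) with (/ ((k - 1) * k)) by (field; lra).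
      apply Rinv_le_contravar; [|simpl]; nra. }
    lra. }
exists (2 * M), n1; intros n Hn; simpl pow; rewrite Rmult_1_r.
assert (Hn2 : 2 <= INR n) by (apply (le_INR 2); lia).
assert (Hb : forall m, (n <= m)%nat -> Rabs (E m - E n) <= 2 * M / INR n).
{ intros m Hm; replace m with (n + (m - n))%nat by lia.
  eapply Rle_trans; [apply Htel; easy|].
  replace (n + (m - n))%nat with m by lia; apply le_INR in Hm.
  assert (0 < / (INR m - 1)) by (apply Rinv_0_lt_compat; lra).
  assert (/ (INR n - 1) <= 2 / INR n).
  { apply (Rmult_le_reg_l (INR n - 1)); [lra|]; rewrite Rinv_r by lra.
    apply (Rmult_le_reg_r (INR n)); [lra|].
    replace ((INR n - 1) * (2 / INR n) * INR n) with (2 * (INR n - 1)) by (field; lra); lra. }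
  replace (2 * M / INR n) with (M * (2 / INR n)) by (field; lra).
  apply Rmult_le_compat_l; lra. }
rewrite Rabs_minus_sym.
apply (is_lim_seq_le_loc (fun m => Rabs (E (2 * m)%nat - E n)) (fun _ => 2 * M / INR n)
  (Rabs (L - E n)) (2 * M / INR n)).
- exists n; intros m Hm; apply Hb; lia.
- apply (is_lim_seq_abs _ (L - E n)), is_lim_seq_minus'; [exact Hlim|apply is_lim_seq_const].
- apply is_lim_seq_const.
Qed.

Lemma qsq_rate (a b : R) : -1 < a -> -1 < b ->
  bigO 1 (fun n => qsq a b n + qsq a b (S n) - 2 / PI).
Proof.
intros ha hb; destruct (qsq_step a b ha hb) as [D [n0 HD]].
apply (energy_rate (fun n => qsq a b n + qsq a b (S n)) (2 / PI) D (max n0 1)).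
- intros n Hn; pose proof (qsq_pos a b n ha hb ltac:(lia)).
  pose proof (qsq_pos a b (S n) ha hb ltac:(lia)); lra.
- intros n Hn; replace (qsq a b (S n) + qsq a b (S (S n)) - (qsq a b n + qsq a b (S n)))
    with (qsq a b (S (S n)) - qsq a b n) by ring.
  apply HD; lia.
- destruct (jacobiP_at_0_sq_lim a b ha hb) as [l0 [l1 [L0 [L1 El]]]].
  pose proof (Rpower_pos 2 (a + b)) as HP; pose proof PI_RGT_0.
  pose proof (jacobi_h_lim a b ha hb) as Lh.
  assert (Lh0 := is_lim_seq_subseq _ _ (fun m => (2 * m)%nat) ltac:(intros P [N HN]; exists N; intros; apply HN; lia) Lh).
  assert (Lh1 := is_lim_seq_subseq _ _ (fun m => S (2 * m)) ltac:(intros P [N HN]; exists N; intros; apply HN; lia) Lh).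
  cbv beta in Lh0, Lh1.
  (* The norms are scaled by the degree, the values at 0 by [m]; the factors [2] here and
     [2 (m + 1/2) / m] below convert one into the other. *)
  assert (L2 := is_lim_seq_mult' _ _ _ _ (is_lim_seq_div' _ _ _ _ L0 Lh0 ltac:(lra)) (is_lim_seq_const 2)).
  assert (L3 := is_lim_seq_mult' _ _ _ _ (is_lim_seq_div' _ _ _ _ L1 Lh1 ltac:(lra))
     (is_lim_seq_mult' _ _ _ _ (is_lim_seq_const 2) (is_lim_seq_INR_shift_ratio (/ 2)))).
  replace (2 / PI) with (l0 / Rpower 2 (a + b) * 2 + l1 / Rpower 2 (a + b) * (2 * 1)).
  2:{ replace l0 with (Rpower 2 (a + b) / PI - l1) by lra; field; lra. }
  eapply is_lim_seq_ext_loc; [|exact (is_lim_seq_plus' _ _ _ _ L2 L3)].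
  exists 1%nat; intros m Hm; cbv beta; unfold qsq.
  rewrite S_INR, mult_INR; simpl (INR 2).
  assert (1 <= INR m) by (apply (le_INR 1); easy).
  pose proof (jacobi_h_pos a b (2 * m) ha hb).
  assert (0 < jacobi_h a b (2 * m)).
  { replace (2 * m)%nat with (S (2 * m - 1)) by lia; now apply jacobi_h_pos. }
  field; repeat split; lra.
Qed.

(** * Christoffel-Darboux and the rotation estimate *)

Definition pkernel (a b : R) (N : nat) (x y : R) : R :=
  rsum (fun j => jacobiP a b j x * jacobiP a b j y / jacobi_h a b j) N.

(** The Christoffel-Darboux constant [k_n / (k_(n+1) h_n)], where [k_n] is the leading coefficient
    of [P_n]. *)
Definition tau (a b : R) (n : nat) : R := / (recA a b (INR n) * jacobi_h a b n).

Lemma recA_pos (a b k : R) : -1 < a -> -1 < b -> 1 <= k -> 0 < recA a b k.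
Proof.
intros ha hb Hk; unfold recA; apply Rdiv_lt_0_compat; repeat apply Rmult_lt_0_compat; lra.
Qed.

Lemma tau_step (a b : R) (n : nat) (x y : R) : -1 < a -> -1 < b ->
  tau a b (S n) * (jacobiP a b (S (S n)) x * jacobiP a b (S n) y
                   - jacobiP a b (S n) x * jacobiP a b (S (S n)) y)
  = (x - y) * (jacobiP a b (S n) x * jacobiP a b (S n) y / jacobi_h a b (S n))
    + recC a b (INR (S n)) * tau a b (S n)
      * (jacobiP a b (S n) x * jacobiP a b n y - jacobiP a b n x * jacobiP a b (S n) y).
Proof.
intros ha hb; rewrite !(jacobiP_rec a b n _ ha hb); unfold tau.
pose proof (jacobi_h_pos a b n ha hb).
pose proof (recA_pos a b (INR (S n)) ha hb ltac:(rewrite S_INR; pose proof (pos_INR n); lra)).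
field; lra.
Qed.

(** The induction starts at degree 1, where the recurrence coefficients are regular. [D] collects
    what degrees 0 and 1 leave over; being independent of [n], it contributes only [D / N] to the
    scaled kernel. *)
Lemma christoffel_darboux (a b : R) : -1 < a -> -1 < b ->
  exists D, forall n x y,
    (x - y) * pkernel a b (S (S n)) x y
    = tau a b (S n) * (jacobiP a b (S (S n)) x * jacobiP a b (S n) y
                       - jacobiP a b (S n) x * jacobiP a b (S (S n)) y) + D * (x - y).
Proof.
intros ha hb.
exists (/ jacobi_h a b 0 - recC a b (INR 1) * tau a b 1 * ((a + b + 2) / 2)); intros n x y.
induction n as [|n IH].
- rewrite tau_step by easy; unfold pkernel; cbn [rsum].
  assert (E0 : forall z, jacobiP a b 0 z = 1).
  { intros z; unfold jacobiP, gbinom; simpl; field. }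
  assert (E1 : forall z, jacobiP a b 1 z = (a + b + 2) / 2 * z + (a - b) / 2).
  { intros z; unfold jacobiP, gbinom; simpl; field. }
  rewrite !E0, !E1; unfold Rdiv; ring.
- rewrite tau_step by easy; unfold pkernel in *.
  change (rsum ?f (S (S (S n)))) with (rsum f (S (S n)) + f (S (S n))).
  rewrite Rmult_plus_distr_l, IH.
  assert (Et : recC a b (INR (S (S n))) * tau a b (S (S n)) = tau a b (S n)).
  { unfold tau; pose proof (jacobi_h_S a b n ha hb) as E.
    pose proof (jacobi_h_pos a b n ha hb).
    pose proof (recA_pos a b (INR (S n)) ha hb ltac:(rewrite S_INR; pose proof (pos_INR n); lra)).
    assert (H1 : 0 < recA a b (INR (S (S n))) * jacobi_h a b (S (S n))).
    { apply Rmult_lt_0_compat; [|now apply jacobi_h_pos].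
      apply recA_pos; try easy; rewrite S_INR; pose proof (pos_INR (S n)); lra. }
    rewrite E in *.
    assert (recC a b (INR (S (S n))) <> 0) by (intros Z; rewrite Z in H1; lra).
    field; repeat split; lra. }
  rewrite Et; ring.
Qed.

Lemma mvt_bound (f df : R -> R) (M B x y : R) :
  (forall t, Rabs t <= M -> is_derive f t (df t)) ->
  (forall t, Rabs t <= M -> Rabs (df t) <= B) ->
  Rabs x <= M -> Rabs y <= M -> Rabs (f y - f x) <= B * Rabs (y - x).
Proof.
intros Hd HB Hx Hy; apply Rabs_le_between in Hx; apply Rabs_le_between in Hy.
assert (Hin : forall t, Rmin x y <= t <= Rmax x y -> Rabs t <= M).
{ intros t Ht; apply Rabs_le; unfold Rmin, Rmax in Ht; destruct (Rle_dec x y); lra. }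
destruct (MVT_gen f x y df) as [c [Hc E]].
- intros t Ht; apply Hd, Hin; lra.
- intros t Ht; apply continuity_pt_filterlim, (ex_derive_continuous (V := R_NormedModule)).
  exists (df t); now apply Hd, Hin.
- rewrite E, Rabs_mult; apply Rmult_le_compat_r; [apply Rabs_pos|now apply HB, Hin].
Qed.

Lemma Rabs_sin_le (u : R) : Rabs (sin u) <= Rabs u.
Proof.
pose proof (mvt_bound sin cos (Rabs u) 1 0 u) as H.
rewrite sin_0, !Rminus_0_r, Rmult_1_l in H; apply H; try lra.
- intros t _; auto_derive; [easy|ring].
- intros t _; apply Rabs_le; pose proof (COS_bound t); lra.
- rewrite Rabs_R0; apply Rabs_pos.
Qed.

(** Moving from 0 towards [t], the product [r(s) exp (- k |s|)] does not increase. In the proof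
    [|s|] is replaced by the smooth [e s], with [e] the sign of [t]. *)
Lemma gronwall (r dr : R -> R) (M k t : R) : 0 <= k ->
  (forall s, Rabs s <= M -> is_derive r s (dr s)) ->
  (forall s, Rabs s <= M -> Rabs (dr s) <= k * r s) ->
  Rabs t <= M -> r t <= r 0 * exp (k * Rabs t).
Proof.
intros Hk Hd Hb Ht; pose proof Ht as Ht'; apply Rabs_le_between in Ht'.
assert (H : forall e, e * t = Rabs t -> (e = 1 \/ e = -1) -> r t <= r 0 * exp (k * Rabs t)).
{ intros e He1 He.
  destruct (MVT_gen (fun s => r s * exp (- (k * (e * s)))) 0 t
     (fun s => (dr s - k * e * r s) * exp (- (k * (e * s))))) as [c [Hc E]].
  - intros s Hs.
    assert (Hs' : Rabs s <= M).
    { apply Rabs_le; unfold Rmin, Rmax in Hs; destruct (Rle_dec 0 t); lra. }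
    evar_last.
    + apply (is_derive_mult r (fun s => exp (- (k * (e * s)))) s (dr s)); [now apply Hd| |apply Rmult_comm].
      auto_derive; [easy|reflexivity].
    + unfold plus, mult; simpl; ring.
  - intros s Hs.
    assert (Hs' : Rabs s <= M).
    { apply Rabs_le; unfold Rmin, Rmax in Hs; destruct (Rle_dec 0 t); lra. }
    apply continuity_pt_filterlim, (ex_derive_continuous (V := R_NormedModule)
       (fun s => r s * exp (- (k * (e * s))))).
    auto_derive; repeat split; exists (dr s); now apply Hd.
  - assert (Hc' : Rabs c <= M).
    { apply Rabs_le; unfold Rmin, Rmax in Hc; destruct (Rle_dec 0 t); lra. }
    specialize (Hb c Hc'); apply Rabs_le_between in Hb.
    assert (S : (dr c - k * e * r c) * (t - 0) <= 0).
    { rewrite Rminus_0_r; pose proof (Rabs_pos t).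
      destruct He as [He|He]; subst e; nra. }
    pose proof (exp_pos (- (k * (e * c)))) as Hp.
    assert (E2 : r t * exp (- (k * (e * t))) <= r 0).
    { replace (- (k * (e * 0))) with 0 in E by ring; rewrite exp_0 in E; nra. }
    rewrite He1, exp_Ropp in E2.
    pose proof (exp_pos (k * Rabs t)) as Hp2.
    apply (Rmult_le_reg_r (/ exp (k * Rabs t))); [now apply Rinv_0_lt_compat|].
    rewrite Rmult_assoc, Rinv_r by lra; lra. }
destruct (Rle_dec 0 t).
- apply (H 1); [rewrite Rabs_pos_eq; lra|now left].
- apply (H (-1)); [rewrite Rabs_left; lra|now right].
Qed.

(* In the rotating frame [(f cos t - g sin t, f sin t + g cos t)] the system is
   constant up to [O(delta)]. *)
Lemma rotation_estimate (f g e1 e2 : R -> R) (M delta x y : R) :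
  0 <= delta <= 1 ->
  (forall t, Rabs t <= M -> is_derive f t (g t + e1 t)) ->
  (forall t, Rabs t <= M -> is_derive g t (- f t + e2 t)) ->
  (forall t, Rabs t <= M -> Rabs (e1 t) <= delta * (Rabs (f t) + Rabs (g t))) ->
  (forall t, Rabs t <= M -> Rabs (e2 t) <= delta * (Rabs (f t) + Rabs (g t))) ->
  Rabs x <= M -> Rabs y <= M ->
  Rabs (f x * g y - g x * f y - (f 0 * f 0 + g 0 * g 0) * sin (x - y))
    <= (40 * M + 16) * exp (4 * M) * delta * Rabs (x - y) * (f 0 * f 0 + g 0 * g 0).
Proof.
intros Hdel Df Dg B1 B2 Hx Hy.
assert (HM : 0 <= M) by (pose proof (Rabs_pos x); lra).
assert (Xf : forall t, Rabs t <= M -> ex_derive f t) by (intros t Ht; eexists; now apply Df).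
assert (Xg : forall t, Rabs t <= M -> ex_derive g t) by (intros t Ht; eexists; now apply Dg).
assert (Ef : forall t, Rabs t <= M -> Derive (fun s : R => f s) t = g t + e1 t)
  by (intros t Ht; apply is_derive_unique; now apply Df).
assert (Eg : forall t, Rabs t <= M -> Derive (fun s : R => g s) t = - f t + e2 t)
  by (intros t Ht; apply is_derive_unique; now apply Dg).
set (rho := fun t => f t * f t + g t * g t).
assert (Dr : forall t, Rabs t <= M -> is_derive rho t (2 * f t * e1 t + 2 * g t * e2 t)).
{ intros t Ht.
  pose proof (Xf t Ht); pose proof (Xg t Ht).
  unfold rho; auto_derive; [easy|].
  rewrite Ef, Eg by easy; ring. }
(* The 4 comes from [2 |f e1 + g e2| <= 2 delta (|f| + |g|)^2 <= 4 delta (f^2 + g^2)]. *)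
assert (Br : forall t, Rabs t <= M -> Rabs (2 * f t * e1 t + 2 * g t * e2 t) <= 4 * delta * rho t).
{ intros t Ht; specialize (B1 t Ht); specialize (B2 t Ht).
  eapply Rle_trans; [apply Rabs_triang|]; rewrite !Rabs_mult, (Rabs_pos_eq 2) by lra.
  unfold rho; rewrite <- (Rabs_pos_eq (f t * f t)), <- (Rabs_pos_eq (g t * g t)), !Rabs_mult by nra.
  pose proof (Rabs_pos (f t)); pose proof (Rabs_pos (g t)).
  set (F := Rabs (f t)) in *; set (G := Rabs (g t)) in *.
  assert (F * Rabs (e1 t) <= F * (delta * (F + G))) by (apply Rmult_le_compat_l; lra).
  assert (G * Rabs (e2 t) <= G * (delta * (F + G))) by (apply Rmult_le_compat_l; lra).
  assert (0 <= delta * ((F - G) * (F - G))) by (apply Rmult_le_pos; [lra|apply Rle_0_sqr]).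
  lra. }
assert (Hrho0 : 0 <= rho 0) by (unfold rho; nra).
set (K1 := exp (4 * M)).
assert (HK1 : 0 < K1) by apply exp_pos.
assert (Hrho : forall t, Rabs t <= M -> rho t <= K1 * rho 0).
{ intros t Ht.
  pose proof (gronwall rho _ M (4 * delta) t ltac:(lra) Dr Br Ht) as Gr.
  eapply Rle_trans; [exact Gr|]; rewrite Rmult_comm; apply Rmult_le_compat_r; [easy|].
  unfold K1; destruct (Req_dec (4 * delta * Rabs t) (4 * M)) as [->|Hne]; [lra|].
  apply Rlt_le, exp_increasing; pose proof (Rabs_pos t); nra. }
set (m := sqrt (K1 * rho 0)).
assert (Hm0 : 0 <= m) by apply sqrt_pos.
assert (Hm : m * m = K1 * rho 0) by (apply sqrt_sqrt; nra).
assert (Hf : forall t, Rabs t <= M -> Rabs (f t) <= m).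
{ intros t Ht; specialize (Hrho t Ht); unfold rho at 1 in Hrho.
  rewrite <- (Rabs_pos_eq m) by easy; apply Rsqr_le_abs_0; unfold Rsqr; nra. }
assert (Hg : forall t, Rabs t <= M -> Rabs (g t) <= m).
{ intros t Ht; specialize (Hrho t Ht); unfold rho at 1 in Hrho.
  rewrite <- (Rabs_pos_eq m) by easy; apply Rsqr_le_abs_0; unfold Rsqr; nra. }
assert (He : forall t, Rabs t <= M -> Rabs (e1 t) <= 2 * delta * m /\ Rabs (e2 t) <= 2 * delta * m).
{ intros t Ht; specialize (B1 t Ht); specialize (B2 t Ht); specialize (Hf t Ht); specialize (Hg t Ht).
  split; nra. }
set (p := fun t => f t * cos t - g t * sin t); set (q := fun t => f t * sin t + g t * cos t).
assert (Habs : forall u v c s, Rabs c <= 1 -> Rabs s <= 1 -> Rabs (u * c + v * s) <= Rabs u + Rabs v).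
{ intros u v c s Hc Hs; eapply Rle_trans; [apply Rabs_triang|].
  apply Rplus_le_compat; apply Rabs_mult_le_l; easy. }
assert (Hcos : forall t, Rabs (cos t) <= 1) by (intros; apply Rabs_le, COS_bound).
assert (Hsin : forall t, Rabs (sin t) <= 1) by (intros; apply Rabs_le, SIN_bound).
assert (Hsin' : forall t, Rabs (- sin t) <= 1) by (intros; rewrite Rabs_Ropp; apply Hsin).
assert (Dp : forall t, Rabs t <= M -> is_derive p t (e1 t * cos t + e2 t * - sin t)).
{ intros t Ht.
  pose proof (Xf t Ht); pose proof (Xg t Ht).
  unfold p; auto_derive; [easy|].
  rewrite Ef, Eg by easy; ring. }
assert (Dq : forall t, Rabs t <= M -> is_derive q t (e1 t * sin t + e2 t * cos t)).
{ intros t Ht.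
  pose proof (Xf t Ht); pose proof (Xg t Ht).
  unfold q; auto_derive; [easy|].
  rewrite Ef, Eg by easy; ring. }
assert (Lp : Rabs (p y - p x) <= 4 * delta * m * Rabs (y - x)).
{ apply (mvt_bound p (fun t => e1 t * cos t + e2 t * - sin t) M); try easy.
  intros t Ht; eapply Rle_trans; [apply Habs; auto|]; destruct (He t Ht); lra. }
assert (Lq : Rabs (q y - q x) <= 4 * delta * m * Rabs (y - x)).
{ apply (mvt_bound q (fun t => e1 t * sin t + e2 t * cos t) M); try easy.
  intros t Ht; eapply Rle_trans; [apply Habs; auto|]; destruct (He t Ht); lra. }
assert (Lr : Rabs (rho x - rho 0) <= 4 * delta * (m * m) * M).
{ eapply Rle_trans; [apply (mvt_bound rho _ M (4 * delta * (m * m)) 0 x Dr); try easy|].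
  - intros t Ht; eapply Rle_trans; [now apply Br|].
    rewrite Hm; apply Rmult_le_compat_l; [lra|now apply Hrho].
  - rewrite Rabs_R0; easy.
  - rewrite Rminus_0_r; apply Rmult_le_compat_l; [nra|easy]. }
assert (Bp : Rabs (p x) <= 2 * m).
{ unfold p; replace (f x * cos x - g x * sin x) with (f x * cos x + g x * - sin x) by ring.
  eapply Rle_trans; [apply Habs; auto|]; pose proof (Hf x Hx); pose proof (Hg x Hx); lra. }
assert (Bq : Rabs (q x) <= 2 * m).
{ unfold q; eapply Rle_trans; [apply Habs; auto|].
  pose proof (Hf x Hx); pose proof (Hg x Hx); lra. }
assert (T : forall z, (cos z * cos z = 1 - sin z * sin z)).
{ intros z; pose proof (sin2_cos2 z) as E; unfold Rsqr in E; lra. }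
assert (Fx : forall z, f z = p z * cos z + q z * sin z).
{ intros z; unfold p, q.
  transitivity (f z * (cos z * cos z) + f z * (sin z * sin z)); [rewrite T|]; ring. }
assert (Gx : forall z, g z = q z * cos z - p z * sin z).
{ intros z; unfold p, q.
  transitivity (g z * (cos z * cos z) + g z * (sin z * sin z)); [rewrite T|]; ring. }
assert (Rx : rho x = p x * p x + q x * q x).
{ unfold rho; rewrite (Fx x), (Gx x).
  transitivity ((p x * p x + q x * q x) * (cos x * cos x) + (p x * p x + q x * q x) * (sin x * sin x));
    [ring|rewrite T; ring]. }
(* Every error term has either the factor [sin (x - y)] or an increment of [p] or [q] between [x]
   and [y]; hence the bound is proportional to [|x - y|]. *)
assert (EW : f x * g y - g x * f y - rho 0 * sin (x - y)
  = sin (x - y) * ((rho x - rho 0) + (p x * (p y - p x) + q x * (q y - q x)))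
    + cos (x - y) * (p x * (q y - q x) - q x * (p y - p x))).
{ rewrite Rx, (Fx x), (Fx y), (Gx x), (Gx y), sin_minus, cos_minus; ring. }
fold (rho 0); rewrite EW; clear EW.
set (d := Rabs (x - y)); rewrite (Rabs_minus_sym y x) in Lp, Lq; fold d in Lp, Lq.
assert (Hd0 : 0 <= d) by apply Rabs_pos.
assert (Hd : d <= 2 * M).
{ unfold d; eapply Rle_trans; [apply Rabs_triang|]; rewrite Rabs_Ropp; lra. }
assert (Hprod : forall u v, Rabs u <= 2 * m -> Rabs v <= 4 * delta * m * d ->
   Rabs (u * v) <= 8 * delta * (m * m) * d).
{ intros u v Hu Hv; rewrite Rabs_mult.
  replace (8 * delta * (m * m) * d) with ((2 * m) * (4 * delta * m * d)) by ring.
  apply Rmult_le_compat; try apply Rabs_pos; easy. }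
assert (P1 : Rabs (p x * (q y - q x) - q x * (p y - p x)) <= 16 * delta * (m * m) * d).
{ eapply Rle_trans; [apply Rabs_triang|]; rewrite Rabs_Ropp.
  pose proof (Hprod _ _ Bp Lq); pose proof (Hprod _ _ Bq Lp); lra. }
(* [4 M] from [rho], and twice [8 d] with [d <= 2 M]: together [36 M]. *)
assert (P2 : Rabs ((rho x - rho 0) + (p x * (p y - p x) + q x * (q y - q x))) <= 40 * M * delta * (m * m)).
{ eapply Rle_trans; [apply Rabs_triang|].
  pose proof (Rabs_triang (p x * (p y - p x)) (q x * (q y - q x))).
  pose proof (Hprod _ _ Bp Lp); pose proof (Hprod _ _ Bq Lq).
  assert (0 <= delta * (m * m)) by nra.
  assert (delta * (m * m) * d <= delta * (m * m) * (2 * M)) by (apply Rmult_le_compat_l; easy).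
  assert (0 <= delta * (m * m) * M) by (apply Rmult_le_pos; easy).
  lra. }
eapply Rle_trans; [apply Rabs_triang|]; rewrite !Rabs_mult.
replace ((40 * M + 16) * K1 * delta * d * rho 0)
  with (d * (40 * M * delta * (K1 * rho 0)) + 1 * (16 * delta * (K1 * rho 0) * d)) by ring.
rewrite <- Hm; apply Rplus_le_compat; apply Rmult_le_compat; try apply Rabs_pos; auto.
apply Rabs_sin_le.
Qed.

(** * The scaling limit of the kernel *)

Lemma is_derive_scaled (F : R -> R) (k t l : R) :
  is_derive F (t / k) l -> is_derive (fun s => F (s / k)) t (/ k * l).
Proof.
intros H.
apply (is_derive_comp F (fun s => s / k) t l (/ k)); [exact H|].
unfold Rdiv; auto_derive; [easy|ring].
Qed.

(** Scaled by the degree [k = n + 1], the lowering and raising relations have main coefficients [u2]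
    and [- u4], which tend to [1] and [-1]. Their deviations and all remaining terms are [O(1/k)]
    and go into [e1] and [e2]. *)
Lemma jacobi_rotation (a b M : R) : -1 < a -> -1 < b -> 0 <= M ->
  exists (C : R) (n0 : nat), forall n, (n0 <= n)%nat -> exists e1 e2 : R -> R,
    forall t, Rabs t <= M ->
      let f := fun s => jacobiP a b (S n) (s / INR (S n)) in
      let g := fun s => jacobiP a b n (s / INR (S n)) in
      is_derive f t (g t + e1 t) /\ is_derive g t (- f t + e2 t) /\
      Rabs (e1 t) <= C / INR (S n) * (Rabs (f t) + Rabs (g t)) /\
      Rabs (e2 t) <= C / INR (S n) * (Rabs (f t) + Rabs (g t)).
Proof.
intros ha hb HM; set (c := a + b).
assert (H1 : bigO 1 (fun n => (a - b) / (2 * INR n + c))).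
{ apply (bigO_ext 1 (fun n => (a - b) / 2 * / (INR n + c / 2)) _ 1).
  - intros n Hn; apply (le_INR 1) in Hn; simpl in Hn; unfold c; field; lra.
  - apply bigO_scal, bigO_inv_shift. }
assert (H2 : near1 1 (fun n => 2 * (INR n + a) * (INR n + b) / (INR n * (2 * INR n + c)))).
{ apply (bigO_ext 1 (fun n => (INR n + a) / (INR n + 0) * ((INR n + b) / (INR n + c / 2)) - 1) _ 1).
  - intros n Hn; apply (le_INR 1) in Hn; simpl in Hn; unfold c; field; lra.
  - repeat (apply near1_ratio || apply near1_mult). }
assert (H3 : near1 1 (fun n => (INR n + c) / (INR n + 0))) by apply near1_ratio.
assert (H4 : near1 1 (fun n => 2 * (INR n + c) / (2 * INR n + c))).
{ apply (bigO_ext 1 (fun n => (INR n + c) / (INR n + c / 2) - 1) _ 1).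
  - intros n Hn; apply (le_INR 1) in Hn; simpl in Hn; unfold c; field; lra.
  - apply near1_ratio. }
apply near1_bounded in H3.
destruct H1 as [C1 [n1 H1]], H2 as [C2 [n2 H2]], H3 as [C3 [n3 H3]], H4 as [C4 [n4 H4]].
destruct (nfloor_ex (2 * M)) as [m [_ Hm]]; [lra|].
(* The outer 2 bounds [1 / (1 - x^2)], since [k >= 2 M] puts [x = t/k] in [[-1/2, 1/2]]; each [M]
   bounds a term in [x] or [x^2]. *)
exists (2 * (C1 + M + (C2 + M) + C3 * (C1 + M) + (C4 + M))).
exists (max (max n1 n2) (max (max n3 n4) (S m))); intros n Hn.
specialize (H1 (S n) ltac:(lia)); specialize (H2 (S n) ltac:(lia)).
specialize (H3 (S n) ltac:(lia)); specialize (H4 (S n) ltac:(lia)).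
cbv beta in H1, H2, H3, H4; set (k := INR (S n)) in *.
assert (Hk : 2 * M + 1 <= k).
{ assert (INR (S m) <= INR n) by (apply le_INR; lia).
  unfold k; rewrite !S_INR in *; lra. }
rewrite pow_1 in H1, H2, H4; rewrite pow_O, Rdiv_1_r in H3.
set (u1 := (a - b) / (2 * k + c)) in *.
set (u2 := 2 * (k + a) * (k + b) / (k * (2 * k + c))) in *.
rewrite Rplus_0_r in H3; set (u3 := (k + c) / k) in *.
set (u4 := 2 * (k + c) / (2 * k + c)) in *.
assert (Hc : 0 < 2 * k + c) by (unfold c; lra).
set (f := fun s => jacobiP a b (S n) (s / k)); set (g := fun s => jacobiP a b n (s / k)).
exists (fun t => ((u1 - t / k) * f t + (u2 - 1 + t / k * (t / k)) * g t) / (1 - t / k * (t / k))).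
exists (fun t => (u3 * (u1 + t / k) * g t + (- (u4 - 1) - t / k * (t / k)) * f t)
                 / (1 - t / k * (t / k))).
intros t Ht; cbv zeta; fold f g.
assert (Hx : Rabs (t / k) <= M / k).
{ unfold Rdiv; rewrite Rabs_mult, (Rabs_pos_eq (/ k)) by (apply Rlt_le, Rinv_0_lt_compat; lra).
  apply Rmult_le_compat_r; [apply Rlt_le, Rinv_0_lt_compat; lra|easy]. }
assert (HMk : M / k <= / 2).
{ apply (Rmult_le_reg_r k); [lra|]; unfold Rdiv; rewrite Rmult_assoc, Rinv_l by lra; lra. }
assert (Ef : f t = jacobiP a b (S n) (t / k)) by easy.
assert (Eg : g t = jacobiP a b n (t / k)) by easy.
set (x := t / k) in *.
assert (Hx1 : -1 < x < 1) by (assert (Rabs x <= / 2) by lra; apply Rabs_le_between in H; lra).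
assert (Hxx : Rabs (x * x) <= M / k).
{ rewrite Rabs_mult; pose proof (Rabs_pos x); nra. }
assert (Hden : / 2 <= 1 - x * x).
{ assert (Rabs x <= / 2) by lra; apply Rabs_le_between in H; nra. }
pose proof (Rabs_pos (f t)) as Pf; pose proof (Rabs_pos (g t)) as Pg.
assert (Hk0 : 0 < / k) by (apply Rinv_0_lt_compat; lra).
assert (S1 : Rabs (u1 - x) <= (C1 + M) / k).
{ eapply Rle_trans; [apply Rabs_triang|]; rewrite Rabs_Ropp; unfold Rdiv in *; lra. }
assert (S1' : Rabs (u1 + x) <= (C1 + M) / k).
{ eapply Rle_trans; [apply Rabs_triang|]; unfold Rdiv in *; lra. }
assert (S2 : Rabs (u2 - 1 + x * x) <= (C2 + M) / k).
{ eapply Rle_trans; [apply Rabs_triang|]; unfold Rdiv in *; lra. }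
assert (S3 : Rabs (u3 * (u1 + x)) <= C3 * (C1 + M) / k).
{ rewrite Rabs_mult; unfold Rdiv; rewrite Rmult_assoc.
  apply Rmult_le_compat; try apply Rabs_pos; easy. }
assert (S4 : Rabs (- (u4 - 1) - x * x) <= (C4 + M) / k).
{ eapply Rle_trans; [apply Rabs_triang|]; rewrite !Rabs_Ropp; unfold Rdiv in *; lra. }
assert (Hquot : forall z A, Rabs z <= A -> Rabs (z / (1 - x * x)) <= 2 * A).
{ intros z A Hz; unfold Rdiv; rewrite Rabs_mult, Rmult_comm.
  assert (0 < / (1 - x * x)) by (apply Rinv_0_lt_compat; lra).
  apply Rmult_le_compat; try apply Rabs_pos; [|easy].
  rewrite Rabs_pos_eq by lra; replace 2 with (/ / 2) by field.
  apply Rinv_le_contravar; lra. }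
assert (Hcomb : forall z w A B F G, Rabs z <= A / k -> Rabs w <= B / k ->
   Rabs (z * F + w * G) <= (A + B) / k * (Rabs F + Rabs G)).
{ intros z w A B F G Hz Hw; eapply Rle_trans; [apply Rabs_triang|]; rewrite !Rabs_mult.
  pose proof (Rabs_pos F); pose proof (Rabs_pos G); pose proof (Rabs_pos z); pose proof (Rabs_pos w).
  unfold Rdiv in *; rewrite Rmult_plus_distr_r; nra. }
assert (N1 : 0 <= (C1 + M) / k) by (eapply Rle_trans; [apply Rabs_pos|exact S1]).
assert (N2 : 0 <= (C2 + M) / k) by (eapply Rle_trans; [apply Rabs_pos|exact S2]).
assert (N3 : 0 <= C3 * (C1 + M) / k) by (eapply Rle_trans; [apply Rabs_pos|exact S3]).
assert (N4 : 0 <= (C4 + M) / k) by (eapply Rle_trans; [apply Rabs_pos|exact S4]).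
split; [|split; [|split]].
- evar_last.
  + apply is_derive_scaled; apply jacobiP_derive_lower; easy.
  + fold k x; rewrite <- Ef, <- Eg; unfold u1, u2, c in *; field; repeat split; nra.
- evar_last.
  + apply is_derive_scaled; apply jacobiP_derive_raise; easy.
  + fold k x; rewrite <- Ef, <- Eg; unfold u1, u3, u4, c in *; field; repeat split; nra.
- eapply Rle_trans; [apply Hquot, Hcomb; [exact S1|exact S2]|].
  rewrite <- Rmult_assoc; apply Rmult_le_compat_r; [lra|]; unfold Rdiv in *; lra.
- eapply Rle_trans; [apply Hquot, Hcomb; [exact S3|exact S4]|].
  rewrite <- Rmult_assoc, (Rplus_comm (Rabs (g t))).
  apply Rmult_le_compat_r; [lra|]; unfold Rdiv in *; lra.
Qed.

Lemma jacobi_h_ratio_inv_near1 (a b : R) : -1 < a -> -1 < b ->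
  near1 1 (fun n => jacobi_h a b (S n) / jacobi_h a b n).
Proof.
intros ha hb.
apply (bigO_ext 1 (fun n => (INR n + (a + 1)) / (INR n + 1)
     * ((INR n + (b + 1)) / (INR n + (a + b + 1)))
     * ((INR n + (a + b + 1) / 2) / (INR n + (a + b + 3) / 2)) - 1) _ 1).
- intros n Hn; rewrite (jacobi_h_ratio a b n ha hb Hn).
  pose proof (jacobi_h_pos a b n ha hb); apply (le_INR 1) in Hn; simpl in Hn; field; repeat split; lra.
- repeat (apply near1_ratio || apply near1_mult).
Qed.

(** [tau] divides both squares by the same [h_n], so [qsq (n+1)] acquires the quotient [r n] of
    norms, which is [1 + O(1/n)]. The factor [1 / recA], close to [1/2], turns [2 / PI] into the
    height [1 / PI] of the sine kernel. *)
Lemma tau_energy_rate (a b : R) : -1 < a -> -1 < b ->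
  bigO 1 (fun n => tau a b n * (jacobiP a b (S n) 0 * jacobiP a b (S n) 0
                                + jacobiP a b n 0 * jacobiP a b n 0) - / PI).
Proof.
intros ha hb; pose proof PI_RGT_0.
pose proof (qsq_rate a b ha hb) as HE.
assert (HEb : bigO 0 (fun n => qsq a b n + qsq a b (S n))).
{ apply (bigO_ext 0 (fun n => (qsq a b n + qsq a b (S n) - 2 / PI) + 2 / PI) _ 0); [intros; ring|].
  apply bigO_plus; [now apply (bigO_weaken 0 1)|apply bigO_const]. }
assert (HQ : bigO 0 (fun n => qsq a b (S n))).
{ destruct HEb as [C [n0 HC]]; exists C, (max n0 1); intros n Hn.
  specialize (HC n ltac:(lia)).
  pose proof (qsq_pos a b n ha hb ltac:(lia)); pose proof (qsq_pos a b (S n) ha hb ltac:(lia)).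
  rewrite Rabs_pos_eq in * by lra; lra. }
set (r := fun n => jacobi_h a b (S n) / jacobi_h a b n).
assert (Hr : bigO 1 (fun n => r n - 1)) by (apply jacobi_h_ratio_inv_near1; easy).
assert (Hqr : bigO 1 (fun n => qsq a b (S n) * (r n - 1))) by (apply (bigO_mult 0 1); easy).
assert (HA : bigO 1 (fun n => 2 / recA a b (INR n) - 1)) by (apply recA_inv_near1; easy).
apply (bigO_ext 1 (fun n => / 2 * ((2 / recA a b (INR n) - 1)
    * ((qsq a b n + qsq a b (S n)) + qsq a b (S n) * (r n - 1))
    + (qsq a b (S n) * (r n - 1) + (qsq a b n + qsq a b (S n) - 2 / PI)))) _ 1).
- intros n Hn; unfold tau, qsq, r; destruct n as [|n]; [lia|].
  pose proof (jacobi_h_pos a b n ha hb); pose proof (jacobi_h_pos a b (S n) ha hb).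
  pose proof (recA_pos a b (INR (S n)) ha hb ltac:(rewrite S_INR; pose proof (pos_INR n); lra)).
  field; repeat split; lra.
- apply bigO_scal, bigO_plus; [|now apply bigO_plus].
  apply (bigO_mult 1 0); [exact HA|]; apply bigO_plus; [exact HEb|].
  now apply (bigO_weaken 0 1).
Qed.

Lemma pkernel_offdiag (a b M : R) : -1 < a -> -1 < b -> 0 <= M ->
  exists (C : R) (N0 : nat), forall (N : nat) (x y : R), (N0 <= N)%nat ->
    Rabs x <= M -> Rabs y <= M -> x <> y ->
    Rabs (/ INR N * pkernel a b N (x / INR N) (y / INR N) - sin (x - y) / (PI * (x - y)))
      <= C / INR N.
Proof.
intros ha hb HM; pose proof PI_RGT_0 as HPI.
destruct (jacobi_rotation a b M ha hb HM) as [C1 [n1 H1]].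
destruct (tau_energy_rate a b ha hb) as [C2 [n2 H2]].
destruct (christoffel_darboux a b ha hb) as [D HD].
(* The constants carry no sign, hence the maximum with 0. The bound [m] below ensures
   [C1' / N <= 1], as [rotation_estimate] requires of [delta]. *)
set (C1' := Rmax C1 0); set (C2' := Rmax C2 0).
assert (HC1 : 0 <= C1') by apply Rmax_r; assert (HC2 : 0 <= C2') by apply Rmax_r.
destruct (nfloor_ex C1') as [m [_ Hm]]; [easy|].
set (K := (40 * M + 16) * exp (4 * M)).
assert (HK : 0 <= K) by (apply Rmult_le_pos; [lra|apply Rlt_le, exp_pos]).
exists (K * C1' * (/ PI + C2') + Rabs D + 2 * C2'), (S (S (max (max n1 n2) m))).
intros N x y HN Hx Hy Hxy.
destruct N as [|[|n]]; [lia|lia|].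
specialize (H1 (S n) ltac:(lia)); specialize (H2 (S n) ltac:(lia)); cbv beta in H2.
destruct H1 as [e1 [e2 H1]]; cbv zeta in H1; set (k := INR (S (S n))) in *.
assert (Hn1 : 1 <= INR (S n)) by (rewrite S_INR; pose proof (pos_INR n); lra).
assert (Ek : k = INR (S n) + 1) by (unfold k; rewrite (S_INR (S n)); easy).
assert (HkC : C1' <= k).
{ assert (INR m + 1 <= k) by (rewrite <- S_INR; apply le_INR; lia); lra. }
assert (Hkp : 0 < k) by lra; assert (Hk0 : 0 < / k) by (apply Rinv_0_lt_compat; lra).
set (f := fun s => jacobiP a b (S (S n)) (s / k)) in *.
set (g := fun s => jacobiP a b (S n) (s / k)) in *.
assert (Hdel : 0 <= C1' / k <= 1).
{ split; [apply Rmult_le_pos; lra|].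
  apply (Rmult_le_reg_r k); [easy|]; unfold Rdiv; rewrite Rmult_assoc, Rinv_l by lra; lra. }
assert (Hle : forall s, C1 / k * (Rabs (f s) + Rabs (g s)) <= C1' / k * (Rabs (f s) + Rabs (g s))).
{ intros s; apply Rmult_le_compat_r; [pose proof (Rabs_pos (f s)); pose proof (Rabs_pos (g s)); lra|].
  apply Rmult_le_compat_r; [lra|apply Rmax_l]. }
pose proof (rotation_estimate f g e1 e2 M (C1' / k) x y Hdel) as RE; fold K in RE.
assert (W : Rabs (f x * g y - g x * f y - (f 0 * f 0 + g 0 * g 0) * sin (x - y))
   <= K * (C1' / k) * Rabs (x - y) * (f 0 * f 0 + g 0 * g 0)).
{ apply RE; try easy; intros t Ht; destruct (H1 t Ht) as [A1 [A2 [A3 A4]]]; try easy.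
  - eapply Rle_trans; [exact A3|apply Hle].
  - eapply Rle_trans; [exact A4|apply Hle]. }
clear RE H1; specialize (HD n (x / k) (y / k)); fold (f x) (f y) (g x) (g y) in HD.
assert (Hf0 : f 0 = jacobiP a b (S (S n)) 0) by (unfold f; f_equal; unfold Rdiv; ring).
assert (Hg0 : g 0 = jacobiP a b (S n) 0) by (unfold g; f_equal; unfold Rdiv; ring).
rewrite <- Hf0, <- Hg0 in H2.
set (T := tau a b (S n)) in *.
assert (HT : 0 < T).
{ apply Rinv_0_lt_compat, Rmult_lt_0_compat; [now apply recA_pos|now apply jacobi_h_pos]. }
set (rho := f 0 * f 0 + g 0 * g 0) in *.
assert (Hrho : 0 <= rho) by (unfold rho; nra).
(* The energy is taken at index [N - 1]; passing from [1/(N-1)] to [1/N] costs the factor 2. *)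
assert (HL : Rabs (T * rho - / PI) <= 2 * C2' / k).
{ eapply Rle_trans; [exact H2|]; simpl pow; rewrite Rmult_1_r, Ek.
  apply Rle_trans with (C2' / INR (S n)).
  - apply Rmult_le_compat_r; [apply Rlt_le, Rinv_0_lt_compat; lra|apply Rmax_l].
  - apply (Rmult_le_reg_r (INR (S n) * (INR (S n) + 1))); [nra|].
    replace (C2' / INR (S n) * (INR (S n) * (INR (S n) + 1))) with (C2' * (INR (S n) + 1)) by (field; lra).
    replace (2 * C2' / (INR (S n) + 1) * (INR (S n) * (INR (S n) + 1))) with (2 * C2' * INR (S n))
      by (field; lra).
    nra. }
assert (HL2 : T * rho <= / PI + C2').
{ assert (2 * C2' / k <= C2').
  { apply (Rmult_le_reg_r k); [easy|]; unfold Rdiv; rewrite Rmult_assoc, Rinv_l by lra; nra. }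
  apply Rabs_le_between in HL; lra. }
assert (Hd : x - y <> 0) by lra.
assert (E : / k * pkernel a b (S (S n)) (x / k) (y / k)
   = T * (f x * g y - g x * f y) / (x - y) + D / k).
{ apply (Rmult_eq_reg_l (x - y)); [|easy].
  transitivity ((x / k - y / k) * pkernel a b (S (S n)) (x / k) (y / k)); [field; lra|].
  rewrite HD; field; lra. }
rewrite E.
set (w := f x * g y - g x * f y) in *.
(* Three errors: the rotation estimate divided by [x - y], the leftover [D], and the deviation of
   the energy times a bounded [sin u / u]. *)
replace (T * w / (x - y) + D / k - sin (x - y) / (PI * (x - y))) with
  (T * ((w - rho * sin (x - y)) / (x - y)) + D / k + (T * rho - / PI) * (sin (x - y) / (x - y)))
  by (field; lra).
assert (B1 : Rabs ((w - rho * sin (x - y)) / (x - y)) <= K * (C1' / k) * rho).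
{ unfold Rdiv at 1; rewrite Rabs_mult, Rabs_inv.
  pose proof (Rabs_pos_lt _ Hd) as Hp.
  apply (Rmult_le_reg_r (Rabs (x - y))); [easy|].
  rewrite Rmult_assoc, Rinv_l, Rmult_1_r by lra.
  eapply Rle_trans; [exact W|]; right; ring. }
assert (B2 : Rabs (sin (x - y) / (x - y)) <= 1).
{ unfold Rdiv; rewrite Rabs_mult, Rabs_inv.
  pose proof (Rabs_pos_lt _ Hd) as Hp.
  apply (Rmult_le_reg_r (Rabs (x - y))); [easy|].
  rewrite Rmult_assoc, Rinv_l, Rmult_1_r, Rmult_1_l by lra; apply Rabs_sin_le. }
eapply Rle_trans; [apply Rabs_triang|].
eapply Rle_trans; [apply Rplus_le_compat_r, Rabs_triang|].
rewrite (Rabs_mult T), (Rabs_mult (T * rho - / PI)), (Rabs_pos_eq T) by lra.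
assert (Q1 : T * Rabs ((w - rho * sin (x - y)) / (x - y)) <= K * C1' * (/ PI + C2') / k).
{ eapply Rle_trans; [apply Rmult_le_compat_l; [lra|exact B1]|].
  replace (T * (K * (C1' / k) * rho)) with (K * C1' / k * (T * rho)) by (field; lra).
  replace (K * C1' * (/ PI + C2') / k) with (K * C1' / k * (/ PI + C2')) by (field; lra).
  apply Rmult_le_compat_l; [|easy].
  apply Rmult_le_pos; [nra|lra]. }
assert (Q2 : Rabs (D / k) = Rabs D / k).
{ unfold Rdiv; rewrite Rabs_mult, (Rabs_pos_eq (/ k)); lra. }
assert (Q3 : Rabs (T * rho - / PI) * Rabs (sin (x - y) / (x - y)) <= 2 * C2' / k).
{ rewrite <- (Rmult_1_r (2 * C2' / k)); apply Rmult_le_compat; try apply Rabs_pos; easy. }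
rewrite Q2; replace ((K * C1' * (/ PI + C2') + Rabs D + 2 * C2') / k) with
  (K * C1' * (/ PI + C2') / k + Rabs D / k + 2 * C2' / k) by (field; lra).
lra.
Qed.

Lemma jacobiP_continuous (a b : R) (n : nat) (x : R) : -1 < a -> -1 < b ->
  continuity_pt (jacobiP a b n) x.
Proof.
intros ha hb; apply continuity_pt_filterlim, (ex_derive_continuous (V := R_NormedModule)).
destruct (hq_derive a b n x) as [d [Hd _]].
exists (poch a n * poch b n * d).
apply (is_derive_ext (fun y => poch a n * poch b n * hq a b n (xm y) (xp y))).
- intros t; symmetry; now apply jacobiP_hq.
- apply is_derive_scal; exact Hd.
Qed.

Lemma pkernel_lim (a b : R) (N : nat) (x : R) (y : nat -> R) (l : R) : -1 < a -> -1 < b ->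
  is_lim_seq y l -> is_lim_seq (fun j => pkernel a b N x (y j)) (pkernel a b N x l).
Proof.
intros ha hb Hy; unfold pkernel; induction N as [|N IH]; simpl rsum; [apply is_lim_seq_const|].
apply is_lim_seq_plus'; [exact IH|].
apply is_lim_seq_mult'; [|apply is_lim_seq_const].
apply is_lim_seq_mult'; [apply is_lim_seq_const|].
apply is_lim_seq_continuous; [now apply jacobiP_continuous|exact Hy].
Qed.

(** The off-diagonal constant does not depend on [x - y], so at fixed [N] the estimate passes to the
    limit [y -> x]. The range is enlarged to [M + 1] to contain the approximating points
    [x - u j]. *)
Lemma pkernel_bulk (a b M : R) : -1 < a -> -1 < b -> 0 <= M ->
  exists (C : R) (N0 : nat), forall (N : nat) (x y : R), (N0 <= N)%nat ->
    Rabs x <= M -> Rabs y <= M ->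
    Rabs (/ INR N * pkernel a b N (x / INR N) (y / INR N) - Ksine x y) <= C / INR N.
Proof.
intros ha hb HM.
destruct (pkernel_offdiag a b (M + 1) ha hb ltac:(lra)) as [C [N0 H]].
exists C, N0; intros N x y HN Hx Hy; unfold Ksine.
destruct (Req_EM_T x y) as [Exy|Exy]; [|apply H; try easy; lra].
rewrite <- Exy; clear y Hy Exy.
set (u := fun j : nat => / INR (S j)).
assert (Hu : forall j, 0 < u j <= 1).
{ intros j; unfold u; assert (1 <= INR (S j)) by (rewrite S_INR; pose proof (pos_INR j); lra).
  split; [apply Rinv_0_lt_compat; lra|]; rewrite <- Rinv_1; apply Rinv_le_contravar; lra. }
assert (Lu : is_lim_seq u 0).
{ apply (is_lim_seq_incr_1 (fun n => / INR n)).
  replace (Finite 0) with (Rbar_inv p_infty) by easy.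
  apply is_lim_seq_inv; [apply is_lim_seq_INR|easy]. }
apply (is_lim_seq_le
  (fun j => Rabs (/ INR N * pkernel a b N (x / INR N) ((x - u j) / INR N) - sin (u j) / u j * / PI))
  (fun _ => C / INR N)
  (Rabs (/ INR N * pkernel a b N (x / INR N) (x / INR N) - / PI)) (C / INR N)).
- intros j; pose proof (Hu j); pose proof PI_RGT_0.
  specialize (H N x (x - u j) HN); replace (x - (x - u j)) with (u j) in H by ring.
  replace (sin (u j) / u j * / PI) with (sin (u j) / (PI * u j)) by (field; lra).
  apply H; try lra.
  eapply Rle_trans; [apply Rabs_triang|]; rewrite Rabs_Ropp, (Rabs_pos_eq (u j)); lra.
- apply (is_lim_seq_abs _ (/ INR N * pkernel a b N (x / INR N) (x / INR N) - / PI)).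
  apply is_lim_seq_minus'.
  + apply is_lim_seq_mult'; [apply is_lim_seq_const|]; apply pkernel_lim; try easy.
    apply is_lim_seq_mult'; [|apply is_lim_seq_const].
    replace (Finite x) with (Finite (x - 0)) by (f_equal; ring).
    apply is_lim_seq_minus'; [apply is_lim_seq_const|exact Lu].
  + replace (Finite (/ PI)) with (Finite (1 * / PI)) by (f_equal; ring).
    apply is_lim_seq_mult'; [|apply is_lim_seq_const].
    apply (is_lim_comp_seq (fun z => sin z / z) u 0 1); [apply is_lim_sinc_0| |exact Lu].
    exists 0%nat; intros j _ E; injection E; pose proof (Hu j); lra.
- apply is_lim_seq_const.
Qed.

(** * The weight near the origin and the conclusion *)

Lemma rpow_near1 (p : R) : exists C, 0 <= C /\ forall u, Rabs (u - 1) <= / 2 ->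
  Rabs (rpow u p - 1) <= C * Rabs (u - 1).
Proof.
exists (2 * Rabs p * exp (Rabs p)); split.
{ pose proof (Rabs_pos p); pose proof (exp_pos (Rabs p)); nra. }
intros u Hu; pose proof Hu as Hu'; apply Rabs_le_between in Hu'.
unfold rpow; destruct (Rlt_dec 0 u) as [Hu0|]; [|lra].
unfold Rpower.
(* [1 + y <= exp y] at [ln u] and [- ln u] gives [ln u <= u - 1] and [- ln u <= 1/u - 1]; the latter
   is at most [2 |u - 1|] because [u >= 1/2]. *)
assert (Hln : Rabs (ln u) <= 2 * Rabs (u - 1)).
{ pose proof (exp_ineq1_le (ln u)) as A1; rewrite exp_ln in A1 by easy.
  pose proof (exp_ineq1_le (- ln u)) as A2; rewrite exp_Ropp, exp_ln in A2 by easy.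
  assert (A3 : / u - 1 <= 2 * Rabs (u - 1)).
  { apply (Rmult_le_reg_l u); [easy|].
    replace (u * (/ u - 1)) with (1 - u) by (field; lra).
    pose proof (Rle_abs (- (u - 1))) as A4; rewrite Rabs_Ropp in A4; pose proof (Rabs_pos (u - 1)); nra. }
  pose proof (Rle_abs (u - 1)); pose proof (Rabs_pos (u - 1)); apply Rabs_le; lra. }
set (z := p * ln u).
assert (Hz : Rabs z <= 2 * Rabs p * Rabs (u - 1)).
{ unfold z; rewrite Rabs_mult; pose proof (Rabs_pos p); nra. }
assert (Hzp : Rabs z <= Rabs p).
{ assert (Rabs p * Rabs (u - 1) <= Rabs p * / 2) by (apply Rmult_le_compat_l; [apply Rabs_pos|easy]).
  lra. }
assert (Hexp : exp z <= exp (Rabs p)).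
{ pose proof (Rle_abs z); destruct (Req_dec z (Rabs p)) as [->|]; [lra|].
  apply Rlt_le, exp_increasing; lra. }
assert (H1 : 1 <= exp (Rabs p)) by (pose proof (exp_ineq1_le (Rabs p)); pose proof (Rabs_pos p); lra).
apply Rle_trans with (Rabs z * exp (Rabs p)).
- pose proof (exp_ineq1_le z) as A1; pose proof (exp_ineq1_le (- z)) as A2.
  pose proof (exp_pos z) as A3; rewrite exp_Ropp in A2.
  assert (A4 : exp z * (1 + - z) <= 1).
  { apply Rle_trans with (exp z * / exp z); [apply Rmult_le_compat_l|rewrite Rinv_r]; lra. }
  pose proof (Rle_abs z); pose proof (Rle_abs (- z)) as A5; rewrite Rabs_Ropp in A5.
  pose proof (Rabs_pos z).
  assert (A6 : Rabs z * 1 <= Rabs z * exp (Rabs p)) by (apply Rmult_le_compat_l; easy).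
  assert (A7 : z * exp z <= Rabs z * exp z) by (apply Rmult_le_compat_r; lra).
  assert (A8 : Rabs z * exp z <= Rabs z * exp (Rabs p)) by (apply Rmult_le_compat_l; easy).
  apply Rabs_le; split; lra.
- pose proof (exp_pos (Rabs p)); nra.
Qed.

Lemma near1_prod (u v A B e : R) : 0 <= A -> 0 <= B -> 0 <= e <= 1 ->
  Rabs (u - 1) <= A * e -> Rabs (v - 1) <= B * e ->
  Rabs (u * v - 1) <= (A * B + A + B) * e.
Proof.
intros HA HB He Hu Hv.
replace (u * v - 1) with ((u - 1) * (v - 1) + (u - 1) + (v - 1)) by ring.
eapply Rle_trans; [apply Rabs_triang|].
eapply Rle_trans; [apply Rplus_le_compat_r, Rabs_triang|]; rewrite Rabs_mult.
assert (Rabs (u - 1) * Rabs (v - 1) <= (A * e) * (B * e))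
  by (apply Rmult_le_compat; try apply Rabs_pos; easy).
assert (0 <= A * B) by nra.
assert (A * B * (e * e) <= A * B * e) by (apply Rmult_le_compat_l; nra).
lra.
Qed.

Definition hweight (a b x : R) : R := rpow (1 - x) (a / 2) * rpow (1 + x) (b / 2).

Lemma hweight_near1 (a b M : R) : 0 < M ->
  exists C, 0 <= C /\ forall N x, 2 * M <= INR N -> Rabs x <= M ->
    Rabs (hweight a b (x / INR N) - 1) <= C * (M / INR N).
Proof.
intros HM.
destruct (rpow_near1 (a / 2)) as [A [HA H1]], (rpow_near1 (b / 2)) as [B [HB H2]].
exists (A * B + A + B); split; [nra|]; intros N x HN Hx.
assert (Hk : 0 < / INR N) by (apply Rinv_0_lt_compat; lra).
assert (Hq : Rabs (x / INR N) <= M / INR N).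
{ unfold Rdiv; rewrite Rabs_mult, (Rabs_pos_eq (/ INR N)) by lra; apply Rmult_le_compat_r; lra. }
assert (HMN : 0 <= M / INR N <= / 2).
{ split; [apply Rmult_le_pos; lra|]; apply (Rmult_le_reg_r (INR N)); [lra|].
  unfold Rdiv; rewrite Rmult_assoc, Rinv_l by lra; lra. }
assert (E1 : Rabs (1 - x / INR N - 1) = Rabs (x / INR N))
  by (rewrite <- Rabs_Ropp; f_equal; ring).
assert (E2 : Rabs (1 + x / INR N - 1) = Rabs (x / INR N)) by (f_equal; ring).
apply near1_prod; try easy; [lra| |].
- eapply Rle_trans; [apply H1; lra|]; rewrite E1; now apply Rmult_le_compat_l.
- eapply Rle_trans; [apply H2; lra|]; rewrite E2; now apply Rmult_le_compat_l.
Qed.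

Lemma KN2_pkernel (a b : R) (N : nat) (x y : R) : -1 < a -> -1 < b ->
  KN2 a b N x y = hweight a b x * hweight a b y * pkernel a b N x y.
Proof.
intros ha hb; unfold KN2, pkernel; rewrite <- rsum_scal; apply rsum_ext; intros j _.
assert (Hh : 0 < jacobi_h a b j).
{ destruct j as [|j]; [|now apply jacobi_h_pos].
  unfold jacobi_h; apply Rdiv_lt_0_compat; [|apply Gamma_is_RInt_gen; lra].
  repeat apply Rmult_lt_0_compat; try apply exp_pos; apply Gamma_is_RInt_gen; lra. }
unfold phi, hweight.
replace (jacobi_h a b j) with (sqrt (jacobi_h a b j) * sqrt (jacobi_h a b j)) at 3
  by (apply sqrt_sqrt; lra).
pose proof (sqrt_lt_R0 _ Hh); field; lra.
Qed.

Lemma Ksine_bound (x y : R) : Rabs (Ksine x y) <= 1.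
Proof.
pose proof PI_RGT_0; pose proof PI2_1.
assert (Hpi : 0 < / PI <= 1).
{ split; [apply Rinv_0_lt_compat; lra|]; rewrite <- Rinv_1; apply Rinv_le_contravar; lra. }
unfold Ksine; destruct (Req_EM_T x y) as [E|E].
- rewrite Rabs_pos_eq; lra.
- assert (Hd : x - y <> 0) by lra; pose proof (Rabs_pos_lt _ Hd) as Hp.
  replace (sin (x - y) / (PI * (x - y))) with (/ PI * (sin (x - y) / (x - y))) by (field; lra).
  rewrite Rabs_mult, (Rabs_pos_eq (/ PI)) by lra; unfold Rdiv; rewrite Rabs_mult, Rabs_inv.
  assert (Rabs (sin (x - y)) * / Rabs (x - y) <= 1).
  { apply (Rmult_le_reg_r (Rabs (x - y))); [easy|].
    rewrite Rmult_assoc, Rinv_l, Rmult_1_r, Rmult_1_l by lra; apply Rabs_sin_le. }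
  assert (0 <= Rabs (sin (x - y)) * / Rabs (x - y)).
  { apply Rmult_le_pos; [apply Rabs_pos|apply Rlt_le, Rinv_0_lt_compat, Hp]. }
  nra.
Qed.

Theorem theorem1 (a b : R) (ha : -1 < a) (hb : -1 < b) :
  forall M : R, exists C : R, exists N0 : nat,
    forall (N : nat) (x y : R), (N0 <= N)%nat ->
      Rabs x <= M -> Rabs y <= M ->
      Rabs (/ INR N * KN2 a b N (x / INR N) (y / INR N) - Ksine x y)
        <= C / INR N.
Proof.
(* [M] is an arbitrary real; the auxiliary estimates want a positive bound. *)
intros M; set (M1 := Rabs M + 1).
assert (HM1 : 0 < M1) by (unfold M1; pose proof (Rabs_pos M); lra).
destruct (pkernel_bulk a b M1 ha hb ltac:(lra)) as [C [N1 H]].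
destruct (hweight_near1 a b M1 HM1) as [W [HW HWN]].
set (V := W * W + W + W).
assert (HV : 0 <= V) by (unfold V; nra).
destruct (nfloor_ex (2 * M1)) as [m [_ Hm]]; [lra|].
exists ((V + 1) * C + V * M1), (max N1 (S m)); intros N x y HN Hx Hy.
pose proof (Rle_abs M) as HMM.
assert (Hx1 : Rabs x <= M1) by (unfold M1; lra); assert (Hy1 : Rabs y <= M1) by (unfold M1; lra).
assert (HNm : 2 * M1 <= INR N).
{ assert (INR (S m) <= INR N) by (apply le_INR; lia); rewrite S_INR in H0; lra. }
assert (HN0 : 0 < INR N) by lra.
assert (He : 0 <= M1 / INR N <= 1).
{ split; [apply Rmult_le_pos; [lra|apply Rlt_le, Rinv_0_lt_compat; lra]|].
  apply (Rmult_le_reg_r (INR N)); [lra|].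
  unfold Rdiv; rewrite Rmult_assoc, Rinv_l by lra; lra. }
specialize (H N x y ltac:(lia) Hx1 Hy1).
pose proof (near1_prod _ _ W W _ HW HW He (HWN N x HNm Hx1) (HWN N y HNm Hy1)) as HP; fold V in HP.
rewrite KN2_pkernel by easy.
set (w := hweight a b (x / INR N) * hweight a b (y / INR N)) in *.
set (S := pkernel a b N (x / INR N) (y / INR N)) in *.
(* The kernel error meets a bounded weight, and the weight error meets the bounded sine kernel. *)
replace (/ INR N * (w * S) - Ksine x y)
  with (w * (/ INR N * S - Ksine x y) + (w - 1) * Ksine x y) by ring.
eapply Rle_trans; [apply Rabs_triang|]; rewrite !Rabs_mult.
pose proof (Ksine_bound x y) as HK.
assert (Hw : Rabs w <= V + 1).
{ replace w with ((w - 1) + 1) by ring; eapply Rle_trans; [apply Rabs_triang|]; rewrite Rabs_R1; nra. }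
replace (((V + 1) * C + V * M1) / INR N) with ((V + 1) * (C / INR N) + V * (M1 / INR N) * 1)
  by (field; lra).
apply Rplus_le_compat; apply Rmult_le_compat; try apply Rabs_pos; easy.
Qed.
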